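(* Let $n\geq 1$ be an integer, and for integers $1\le p\le n$ define \[ a_{p,n}:=[x]\,U_{2n-1}\!\left(\tfrac1x\right)(\arcsin x)^{2p},\qquad b_{p,n}:=[x]\,U_{2n-2}\!\left(\tfrac1x\right)(\arcsin x)^{2p-1}. \] Then \[ \int_0^{\pi/4}\frac{\sin(4nx)}{\ln(\tan x)}\,dx=\frac{(-1)^n}{2}\sum_{p=1}^{n}(2^{2p+1}-1)\,a_{p,n}\,\frac{\zeta(2p+1)}{\pi^{2p}}, \] and \[ \int_0^{\pi/4}\frac{\cos((4n-2)x)}{\ln(\tan x)}\,dx=(-1)^n\sum_{p=1}^{n}2^{2p-1}\,b_{p,n}\,\frac{\beta(2p)}{\pi^{2p-1}}. \] Moreover, for $1\leq p\leq n$, \[ (-1)^{n-p}a_{p,n}>0\quad\text{and}\quad(-1)^{n-p}b_{p,n}>0 . \] Consequently, after multiplication by the common factor $(-1)^n$, the summands (indexed by $p=1,\dots,n$) in both representations alternate strictly in sign as $-,+,-,+,\ldots$.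
   Context: $\zeta$ is the Riemann zeta function and $\beta(s)=\sum_{j=0}^\infty \frac{(-1)^j}{(2j+1)^s}$ is the Dirichlet beta function. $U_m$ is the Chebyshev polynomial of the second kind, normalized by $U_m(\cos\theta)=\frac{\sin((m+1)\theta)}{\sin\theta}$. For a power series or Laurent series $F$, $[x^r]F(x)$ denotes the coefficient of $x^r$ in the expansion of $F$ at the origin, and $[x]F(x)=[x^1]F(x)$; $\arcsin x$ is expanded as its Taylor series at $0$ (with $\arcsin 0=0$), so that $U_m(1/x)(\arcsin x)^r$ is a Laurent series in $x$. *)

(* Defs.v *)
From Stdlib Require Import Reals Lra Lia ZArith ClassicalEpsilon.
From Coquelicot Require Import Coquelicot.
Open Scope R_scope.

(* The Dirichlet series of the Riemann zeta function and of the Dirichlet beta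
   function at a real argument s.  [Series] is total: [zeta s] is meaningful
   for s > 1 and [dirichlet_beta s] for s > 0. *)
Definition zeta (s : R) : R :=
  Series (fun k : nat => / Rpower (INR (k + 1)) s).

Definition dirichlet_beta (s : R) : R :=
  Series (fun j : nat => (-1) ^ j / Rpower (INR (2 * j + 1)) s).

Fixpoint chebyshevU (m : nat) (x : R) : R :=
  match m with
  | O => 1
  | S m1 =>
      match m1 with
      | O => 2 * x
      | S m2 => 2 * x * chebyshevU m1 x - chebyshevU m2 x
      end
  end.

Lemma chebyshevU_cos (m : nat) (t : R) :
  sin t <> 0 -> chebyshevU m (cos t) = sin (INR (m + 1) * t) / sin t.
Proof.
intros Ht.
assert (H : chebyshevU m (cos t) * sin t = sin (INR (m + 1) * t) /\
            chebyshevU (S m) (cos t) * sin t = sin (INR (m + 2) * t)).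
{ induction m as [|m [IH1 IH2]].
  - split; simpl.
    + now rewrite !Rmult_1_l.
    + replace ((1 + 1) * t) with (2 * t) by ring. rewrite sin_2a. ring.
  - replace (S m + 1)%nat with (m + 2)%nat by lia.
    split; [exact IH2|].
    change (chebyshevU (S (S m)) (cos t))
      with (2 * cos t * chebyshevU (S m) (cos t) - chebyshevU m (cos t)).
    rewrite Rmult_minus_distr_r, IH1, Rmult_assoc, IH2.
    replace (INR (S m + 2) * t) with (INR (m + 2) * t + t)
      by (rewrite !plus_INR, (S_INR m); ring).
    replace (INR (m + 1) * t) with (INR (m + 2) * t - t)
      by (rewrite !plus_INR; simpl; ring).
    rewrite sin_plus, sin_minus. ring. }
destruct H as [H _]. rewrite <- H. now field.
Qed.

(* f x = sum_{k >= -N} c_k x^k for all x <> 0 near 0, with c_k = 0 for k < -N.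
   The value f 0 plays no role. *)
Definition laurent_expansion_from (N : nat) (f : R -> R) (c : Z -> R) : Prop :=
  let u := fun j : nat => c (Z.of_nat j - Z.of_nat N)%Z in
  (forall k : Z, (k < - Z.of_nat N)%Z -> c k = 0) /\
  Rbar_lt 0 (CV_radius u) /\
  locally' 0 (fun x : R => f x = PSeries u x / x ^ N).

Definition is_laurent_expansion (f : R -> R) (c : Z -> R) : Prop :=
  exists N : nat, laurent_expansion_from N f c.

(* [x^r] f(x), as a function of r.  When f has a Laurent expansion at 0 with
   finite principal part, these are its coefficients (laurent_coef_unique);
   otherwise the value is unspecified. *)
Definition laurent_coef (f : R -> R) : Z -> R :=
  epsilon (inhabits (fun _ : Z => 0)) (is_laurent_expansion f).

Lemma laurent_expansion_from_S (N : nat) (f : R -> R) (c : Z -> R) :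
  laurent_expansion_from N f c -> laurent_expansion_from (S N) f c.
Proof.
intros [H0 [Hr Hf]].
set (u := fun j : nat => c (Z.of_nat j - Z.of_nat N)%Z) in *.
assert (E : forall j, PS_incr_1 u j = c (Z.of_nat j - Z.of_nat (S N))%Z).
{ intros [|j].
  - symmetry. apply H0. lia.
  - simpl PS_incr_1. unfold u. f_equal. lia. }
split; [|split].
- intros k Hk. apply H0. lia.
- rewrite <- (CV_radius_ext _ _ E), CV_radius_incr_1. exact Hr.
- revert Hf.
  unfold locally', within. apply filter_imp. intros x Hx Hx0.
  rewrite (Hx Hx0), <- (PSeries_ext _ _ x E), PSeries_incr_1. simpl.
  field. split; [now apply pow_nonzero | exact Hx0].
Qed.

Lemma laurent_expansion_from_le (N M : nat) (f : R -> R) (c : Z -> R) :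
  (N <= M)%nat -> laurent_expansion_from N f c -> laurent_expansion_from M f c.
Proof.
intros H HN. induction H; auto using laurent_expansion_from_S.
Qed.

Lemma PSeries_continuous_0 (u : nat -> R) :
  Rbar_lt 0 (CV_radius u) -> continuous (PSeries u) 0.
Proof.
intros H. apply continuity_pt_filterlim, PSeries_continuity.
now rewrite Rabs_R0.
Qed.

Lemma is_laurent_expansion_unique (f : R -> R) (c d : Z -> R) :
  is_laurent_expansion f c -> is_laurent_expansion f d ->
  forall k : Z, c k = d k.
Proof.
intros [N HN] [M HM] k.
apply (laurent_expansion_from_le _ (N + M)) in HN; [|lia].
apply (laurent_expansion_from_le _ (N + M)) in HM; [|lia].
set (K := (N + M)%nat) in *.
destruct HN as [c0 [cr cf]], HM as [d0 [dr df]].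
destruct (Z_lt_le_dec k (- Z.of_nat K)) as [Hk|Hk].
{ now rewrite c0, d0. }
set (u := fun j : nat => c (Z.of_nat j - Z.of_nat K)%Z) in *.
set (v := fun j : nat => d (Z.of_nat j - Z.of_nat K)%Z) in *.
assert (E' : locally' 0 (fun x => PSeries u x = PSeries v x)).
{ generalize (filter_and _ _ cf df).
  unfold locally', within. apply filter_imp. intros x Hx Hx0.
  destruct (Hx Hx0) as [E1 E2]. rewrite E1 in E2.
  apply (Rmult_eq_reg_r (/ x ^ K)); [exact E2|].
  now apply Rinv_neq_0_compat, pow_nonzero. }
assert (E : locally 0 (fun x => PSeries u x = PSeries v x)).
{ assert (E0 : PSeries u 0 = PSeries v 0).
  { apply (@filterlim_locally_unique R R_AbsRing R_NormedModule (Rbar_locally' 0)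
             (Proper_StrongProper _ (Rbar_locally'_filter 0)) (PSeries u)).
    - apply continuity_pt_filterlim', continuity_pt_filterlim.
      now apply PSeries_continuous_0.
    - apply filterlim_ext_loc with (PSeries v).
      + revert E'. apply filter_imp. now intros x ->.
      + apply continuity_pt_filterlim', continuity_pt_filterlim.
        now apply PSeries_continuous_0. }
  revert E'. unfold locally', within. apply filter_imp. intros x Hx.
  destruct (Req_dec x 0) as [->|Hx0]; auto. }
generalize (PSeries_ext_recip u v (Z.to_nat (k + Z.of_nat K)) cr dr E).
unfold u, v. rewrite Z2Nat.id by lia.
now replace (k + Z.of_nat K - Z.of_nat K)%Z with k by lia.
Qed.

Lemma laurent_coef_unique (f : R -> R) (c : Z -> R) :
  is_laurent_expansion f c -> forall k : Z, laurent_coef f k = c k.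
Proof.
intros H. apply is_laurent_expansion_unique with f; [|exact H].
unfold laurent_coef. apply epsilon_spec. now exists c.
Qed.

Definition a_coef (p n : nat) : R :=
  laurent_coef (fun x => chebyshevU (2 * n - 1) (1 / x) * asin x ^ (2 * p)) 1.

Definition b_coef (p n : nat) : R :=
  laurent_coef (fun x => chebyshevU (2 * n - 2) (1 / x) * asin x ^ (2 * p - 1)) 1.

(* Main.v *)
(** The ODE of the powers of arcsin gives a recursion showing that, up to explicit signs
    and powers of 2, [a_coef p n] and [b_coef p n] are the coefficients of [r^(2n)] and
    [r^(2n-1)] in [(artanh r)^(2p)] and [(artanh r)^(2p-1)]; these are positive.

    With [y = - ln (tan x)] one has [cos (2x) = tanh y] and [sin (2x) = sech y], and the
    integrals become integrals over [y > 0] of (derivative of [cos (2n t)], respectively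
    [sin ((2n-1) t)]) [/ y], where [t = 2x].  The same artanh coefficients express this derivative
    through the higher derivatives of [tanh] and [sech].  Finally [D^r tanh / y] ([r] even)
    and [D^r sech / y] ([r] odd) are integrated from the partial fraction expansions
    [tanh y = sum_k 2 y / (y^2 + w_k^2)] and [sech y = sum_k (-1)^k 2 w_k / (y^2 + w_k^2)],
    [w_k = (2k+1) pi/2]: up to a polynomial of degree less than [r], which [D^r] kills, the
    expanded function is [+- y^(r+1) sum_k (+-1) 2 / (w_k^r (y^2 + w_k^2))], and [r]
    integrations by parts leave an integral of arctangent type whose value is a multiple of
    [zeta (r+1)] or [dirichlet_beta (r+1)]. *)

(* Powers of artanh govern both sides because each side has a closed generating function in [r].
   Formally, the sum over [m >= 1] of [U_(m-1)(1/x) r^m] is [r / (1 - 2 r / x + r^2)], with a pole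
   at [x = 2 r / (1 + r^2)], where [arcsin x = 2 arctan r]; multiplying by [(arcsin x)^q], [q >= 1],
   and taking [[x]] yields [(2 arctan r)^q / 2]. On the other side, [tanh (y - 2 artanh r) = cos t -
   2 sin t (sum over m >= 1 of sin (m t) r^m)], and this translation is [exp (-2 artanh r D)],
   expanded in powers of [D]. The proof only compares the recursions in [m] behind these identities,
   so no series in two variables is handled.

   Parity decides which terms have an integral at all: [D^r tanh / y] with [r] odd and
   [D^r sech / y] with [r] even behave like a multiple of [1 / y] at 0. Since artanh is odd, exactly
   these terms carry the coefficient 0. *)
Require Import Defs.
From Stdlib Require Import Reals Lra Lia ZArith Arith.
From Coquelicot Require Import Coquelicot.
Open Scope R_scope.

(** * Coefficients of the powers of artanh: support, parity, positivity *)

(* [artanh_coef m q] is the coefficient of [r^m] in [(artanh r)^q]; the recursion is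
   the coefficient form of [(1 - r^2) (artanh^q)' = q artanh^(q-1)]. *)
Fixpoint artanh_coef (m q : nat) : R :=
  match m with
  | O => match q with O => 1 | _ => 0 end
  | S O => match q with S O => 1 | _ => 0 end
  | S (S m2 as m1) =>
      (INR m2 * artanh_coef m2 q +
       match q with O => 0 | S q1 => INR q * artanh_coef m1 q1 end) / INR m
  end.

Lemma artanh_coef_SS (m q : nat) :
  INR (m + 2) * artanh_coef (S (S m)) (S q) =
  INR m * artanh_coef m (S q) + INR (S q) * artanh_coef (S m) q.
Proof.
replace (m + 2)%nat with (S (S m)) by lia.
change (artanh_coef (S (S m)) (S q)) with
  ((INR m * artanh_coef m (S q) + INR (S q) * artanh_coef (S m) q) / INR (S (S m))).
field. apply not_0_INR. lia.
Qed.

Lemma artanh_coef_0_r (m : nat) : artanh_coef (S m) 0 = 0.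
Proof.
assert (H : artanh_coef (S m) 0 = 0 /\ artanh_coef (S (S m)) 0 = 0); [|tauto].
induction m as [|m [IH1 IH2]].
- split; simpl; field.
- split; [exact IH2|].
  change (artanh_coef (S (S (S m))) 0) with
    ((INR (S m) * artanh_coef (S m) 0 + 0) / INR (S (S (S m)))).
  rewrite IH1. unfold Rdiv. ring.
Qed.

Lemma artanh_coef_lt (m q : nat) : (m < q)%nat -> artanh_coef m q = 0.
Proof.
enough (H : forall q, ((m < q)%nat -> artanh_coef m q = 0) /\
              ((S m < q)%nat -> artanh_coef (S m) q = 0)) by apply H.
induction m as [|m IH]; intros k; split; intros Hk.
- destruct k; [lia|reflexivity].
- destruct k as [|[|k]]; try lia. reflexivity.
- apply IH. exact Hk.
- destruct k as [|k]; [lia|].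
  apply (Rmult_eq_reg_l (INR (m + 2))); [|apply not_0_INR; lia].
  rewrite artanh_coef_SS.
  rewrite (proj1 (IH (S k))) by lia. rewrite (proj2 (IH k)) by lia. ring.
Qed.

(** artanh is odd, so [artanh^q] contains only exponents of the parity of [q]. For [d = 0] the
    recursion meets degree [q] of the power [q + 1], which is below the support. *)
Lemma artanh_coef_odd (d q : nat) : artanh_coef (q + S (2 * d)) q = 0.
Proof.
enough (H : forall m d q, (m = q + S (2 * d))%nat -> artanh_coef m q = 0)
  by (now apply H with d).
clear. induction m as [m IH] using (well_founded_induction lt_wf). intros d q E.
destruct q as [|q]; [subst m; apply artanh_coef_0_r|].
destruct m as [|[|m]]; try lia.
apply (Rmult_eq_reg_l (INR (m + 2))); [|apply not_0_INR; lia].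
rewrite artanh_coef_SS, (IH (S m)) with (d := d) by lia.
destruct d as [|d].
- replace m with q by lia. rewrite (artanh_coef_lt q (S q)) by lia. ring.
- rewrite (IH m) with (d := d) by lia. ring.
Qed.

(** Both summands of the recursion are non-negative. One vanishes for [d = 0], the other for power
    1, and the two cases meet only in degree 1, a base case. *)
Lemma artanh_coef_pos (d q : nat) : 0 < artanh_coef (S q + 2 * d) (S q).
Proof.
enough (H : forall m d q, (m = S q + 2 * d)%nat -> 0 < artanh_coef m (S q))
  by (now apply H with d).
clear. induction m as [m IH] using (well_founded_induction lt_wf). intros d q E.
destruct m as [|[|m]]; [lia| |].
- assert (q = 0)%nat by lia. subst q. simpl. lra.
- assert (Hm : 0 < INR (m + 2)) by (apply lt_0_INR; lia).
  apply (Rmult_lt_reg_l (INR (m + 2))); [exact Hm|].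
  rewrite Rmult_0_r, artanh_coef_SS.
  assert (Hq : 0 < INR (S q)) by (apply lt_0_INR; lia).
  assert (H1 : d <> O -> 0 < INR m * artanh_coef m (S q)).
  { intros Hd. apply Rmult_lt_0_compat; [apply lt_0_INR; lia|].
    apply (IH m) with (d := Nat.pred d); lia. }
  assert (H2 : q <> O -> 0 < artanh_coef (S m) q).
  { intros H. destruct q as [|q']; [lia|]. apply (IH (S m)) with (d := d); lia. }
  destruct q as [|q'].
  + rewrite artanh_coef_0_r. specialize (H1 ltac:(lia)). lra.
  + specialize (H2 ltac:(lia)). assert (0 < INR (S (S q')) * artanh_coef (S m) (S q')) by now apply Rmult_lt_0_compat.
    destruct d as [|d'].
    * rewrite (artanh_coef_lt m) by lia. lra.
    * specialize (H1 ltac:(lia)). lra.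
Qed.

(** * Power series on the unit disk *)

(** Coefficients and sum are paired on all of [|x| < 1], so that identities between functions pass
    to coefficients with no radius of convergence to track. *)
Definition is_unit_disk_series (a : nat -> R) (f : R -> R) : Prop :=
  forall x : R, Rabs x < 1 -> is_pseries a x (f x).

(** Convergence at the midpoint of [|x|] and 1 excludes a radius of at most [|x|]. *)
Lemma is_unit_disk_series_radius (a : nat -> R) (f : R -> R) (x : R) :
  is_unit_disk_series a f -> Rabs x < 1 -> Rbar_lt (Rabs x) (CV_radius a).
Proof.
intros H Hx. apply Rbar_not_le_lt. intros Hle.
set (y := (Rabs x + 1) / 2).
assert (Hy0 : 0 <= Rabs x) by apply Rabs_pos.
assert (Hy : Rabs y = y) by (apply Rabs_pos_eq; unfold y; lra).
apply (CV_disk_outside a y).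
- rewrite Hy. apply Rbar_le_lt_trans with (Rabs x); [exact Hle|].
  simpl. unfold y. lra.
- apply ex_series_lim_0. exists (f y).
  apply (is_series_ext (fun n => scal (pow_n y n) (a n))).
  + intros n. rewrite pow_n_pow. unfold scal; simpl. unfold mult; simpl. ring.
  + apply H. rewrite Hy. unfold y. lra.
Qed.

Lemma is_unit_disk_series_radius_pos (a : nat -> R) (f : R -> R) :
  is_unit_disk_series a f -> Rbar_lt 0 (CV_radius a).
Proof.
intros H. rewrite <- Rabs_R0.
apply is_unit_disk_series_radius with f; [exact H|]. rewrite Rabs_R0. lra.
Qed.

Lemma locally_unit_disk (x : R) :
  Rabs x < 1 -> locally x (fun y => Rabs y < 1).
Proof.
intros Hx. assert (He : 0 < 1 - Rabs x) by lra. exists (mkposreal _ He).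
intros y Hy. unfold ball in Hy; simpl in Hy. unfold AbsRing_ball, abs, minus, plus, opp in Hy; simpl in Hy.
replace y with (x + (y + - x)) by ring.
apply Rle_lt_trans with (1 := Rabs_triang _ _). lra.
Qed.

Lemma is_unit_disk_series_unique (a b : nat -> R) (f : R -> R) :
  is_unit_disk_series a f -> is_unit_disk_series b f -> forall n, a n = b n.
Proof.
intros Ha Hb n. apply PSeries_ext_recip.
- now apply is_unit_disk_series_radius_pos with f.
- now apply is_unit_disk_series_radius_pos with f.
- generalize (locally_unit_disk 0). rewrite Rabs_R0. intros H.
  generalize (H Rlt_0_1). apply filter_imp. intros x Hx.
  rewrite (is_pseries_unique _ _ _ (Ha x Hx)).
  now rewrite (is_pseries_unique _ _ _ (Hb x Hx)).
Qed.

Lemma is_unit_disk_series_ext (a : nat -> R) (f g : R -> R) :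
  (forall x, Rabs x < 1 -> f x = g x) ->
  is_unit_disk_series a f -> is_unit_disk_series a g.
Proof. intros E H x Hx. rewrite <- E by exact Hx. now apply H. Qed.

Lemma is_unit_disk_series_plus (a b : nat -> R) (f g : R -> R) :
  is_unit_disk_series a f -> is_unit_disk_series b g ->
  is_unit_disk_series (PS_plus a b) (fun x => f x + g x).
Proof. intros Ha Hb x Hx. now apply (is_pseries_plus a b); [apply Ha|apply Hb]. Qed.

Lemma is_unit_disk_series_scal (c : R) (a : nat -> R) (f : R -> R) :
  is_unit_disk_series a f ->
  is_unit_disk_series (PS_scal c a) (fun x => c * f x).
Proof.
intros Ha x Hx. apply (is_pseries_scal c a); [apply Rmult_comm | now apply Ha].
Qed.

Lemma is_unit_disk_series_incr (n : nat) (a : nat -> R) (f : R -> R) :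
  is_unit_disk_series a f ->
  is_unit_disk_series (PS_incr_n a n) (fun x => x ^ n * f x).
Proof.
intros Ha x Hx. rewrite <- pow_n_pow. now apply (is_pseries_incr_n a n), Ha.
Qed.

Lemma is_unit_disk_series_mult (a b : nat -> R) (f g : R -> R) :
  is_unit_disk_series a f -> is_unit_disk_series b g ->
  is_unit_disk_series (PS_mult a b) (fun x => f x * g x).
Proof.
intros Ha Hb x Hx. apply is_pseries_mult; auto.
- now apply is_unit_disk_series_radius with f.
- now apply is_unit_disk_series_radius with g.
Qed.

Lemma is_unit_disk_series_derive (a : nat -> R) (f f' : R -> R) :
  is_unit_disk_series a f ->
  (forall x, Rabs x < 1 -> is_derive f x (f' x)) ->
  is_unit_disk_series (PS_derive a) f'.
Proof.
intros Ha Hf x Hx. replace (f' x) with (Derive (PSeries a) x).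
- apply is_pseries_derive. now apply is_unit_disk_series_radius with f.
- apply is_derive_unique, (is_derive_ext_loc f); [|now apply Hf].
  generalize (locally_unit_disk x Hx). apply filter_imp. intros y Hy.
  symmetry. now apply is_pseries_unique, Ha.
Qed.

Lemma unit_disk_const (f : R -> R) :
  (forall x, Rabs x < 1 -> is_derive f x 0) ->
  forall x, Rabs x < 1 -> f x = f 0.
Proof.
intros H x Hx. apply Rabs_def2 in Hx.
destruct (Rtotal_order x 0) as [L|[->|L]]; [|reflexivity|symmetry];
  apply (eq_is_derive f); auto; intros t Ht; apply H, Rabs_def1; lra.
Qed.

Lemma PS_plus_R (a b : nat -> R) (n : nat) : PS_plus a b n = a n + b n.
Proof. reflexivity. Qed.

Lemma PS_incr_n_lt (a : nat -> R) (m n : nat) : (n < m)%nat -> PS_incr_n a m n = 0.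
Proof.
intros H. rewrite PS_incr_n_simplify. now destruct (le_lt_dec m n); [lia|].
Qed.

Lemma PS_incr_n_ge (a : nat -> R) (m n : nat) :
  (m <= n)%nat -> PS_incr_n a m n = a (n - m)%nat.
Proof.
intros H. rewrite PS_incr_n_simplify. now destruct (le_lt_dec m n); [|lia].
Qed.

(** * Taylor coefficients of the powers of arcsin *)

(** The recursion is [(1 - x^2) y'' = x y'] with [y 0 = 0] and [y' 0 = 1], read on Taylor
    coefficients. *)
Fixpoint asin_coef (k : nat) : R :=
  match k with
  | O => 0
  | S O => 1
  | S (S j) => INR j ^ 2 / (INR (j + 1) * INR (j + 2)) * asin_coef j
  end.

Lemma asin_coef_SS (k : nat) :
  INR (k + 1) * INR (k + 2) * asin_coef (S (S k)) = INR k ^ 2 * asin_coef k.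
Proof.
change (asin_coef (S (S k))) with
  (INR k ^ 2 / (INR (k + 1) * INR (k + 2)) * asin_coef k).
field. split; apply not_0_INR; lia.
Qed.

Lemma asin_coef_bound (k : nat) : Rabs (asin_coef k) <= 1.
Proof.
enough (Rabs (asin_coef k) <= 1 /\ Rabs (asin_coef (S k)) <= 1) by tauto.
induction k as [|k [IH1 IH2]].
- simpl. rewrite Rabs_R0, Rabs_R1. lra.
- split; [exact IH2|].
  change (asin_coef (S (S k))) with
    (INR k ^ 2 / (INR (k + 1) * INR (k + 2)) * asin_coef k).
  rewrite Rabs_mult. rewrite <- (Rmult_1_l 1).
  assert (Hk := pos_INR k).
  assert (P : 0 < INR (k + 1) * INR (k + 2)) by (rewrite !plus_INR; simpl; nra).
  apply Rmult_le_compat; try apply Rabs_pos; [|exact IH1].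
  rewrite Rabs_pos_eq.
  + apply Rle_div_l; [exact P|]. rewrite !plus_INR; simpl; nra.
  + apply Rle_div_r; [exact P|]. rewrite Rmult_0_l. apply pow2_ge_0.
Qed.

Lemma is_derive_asin (x : R) : Rabs x < 1 -> is_derive asin x (/ sqrt (1 - x ^ 2)).
Proof.
intros Hx. apply Rabs_def2 in Hx.
assert (Hx' : -1 < x < 1) by lra.
generalize (derive_pt_asin x Hx').
intros E. apply is_derive_Reals.
replace (/ sqrt (1 - x ^ 2)) with (derive_pt asin x (derivable_pt_asin x Hx')).
- apply derive_pt_eq_1 with (derivable_pt_asin x Hx'). reflexivity.
- rewrite E. unfold Rsqr, Rdiv. rewrite Rmult_1_l. do 3 f_equal. ring.
Qed.

Lemma unit_disk_sqrt_pos (x : R) : Rabs x < 1 -> 0 < 1 - x ^ 2.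
Proof. intros Hx. apply Rabs_def2 in Hx. nra. Qed.

(** The sum [Y] solves [(1 - x^2) Y'' = x Y'], hence [Y' * sqrt (1 - x^2)] is constant, equal to 1;
    then [Y - asin] is constant, equal to 0. *)
Lemma asin_unit_disk_series : is_unit_disk_series asin_coef asin.
Proof.
set (Y := PSeries asin_coef).
set (Z := PSeries (PS_derive asin_coef)).
set (Z' := PSeries (PS_derive (PS_derive asin_coef))).
assert (HY : is_unit_disk_series asin_coef Y).
{ intros x Hx. apply PSeries_correct.
  apply (ex_series_le (V := R_CompleteNormedModule) _ (fun k => Rabs x ^ k)).
  - intros k. rewrite pow_n_pow. unfold scal; simpl. unfold mult, norm; simpl.
    unfold abs; simpl. rewrite Rabs_mult, <- RPow_abs.
    assert (H := asin_coef_bound k). assert (0 <= Rabs x ^ k) by apply pow_le, Rabs_pos.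
    nra.
  - apply ex_series_geom. now rewrite Rabs_Rabsolu. }
assert (dY : forall x, Rabs x < 1 -> is_derive Y x (Z x)).
{ intros x Hx. apply is_derive_PSeries.
  now apply is_unit_disk_series_radius with Y. }
assert (HZ : is_unit_disk_series (PS_derive asin_coef) Z).
{ now apply is_unit_disk_series_derive with Y. }
assert (dZ : forall x, Rabs x < 1 -> is_derive Z x (Z' x)).
{ intros x Hx. apply is_derive_PSeries.
  now apply is_unit_disk_series_radius with Z. }
assert (HZ' : is_unit_disk_series (PS_derive (PS_derive asin_coef)) Z').
{ now apply is_unit_disk_series_derive with Z. }
assert (ODE : forall x, Rabs x < 1 -> Z' x = x ^ 1 * Z x + x ^ 2 * Z' x).
{ intros x Hx. apply is_pseries_unique.
  apply (is_pseries_ext (PS_plus (PS_incr_n (PS_derive asin_coef) 1)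
                                 (PS_incr_n (PS_derive (PS_derive asin_coef)) 2))).
  - intros n. rewrite PS_plus_R.
    destruct n as [|[|n]].
    + rewrite !PS_incr_n_lt by lia. unfold PS_derive. simpl. field.
    + rewrite (PS_incr_n_ge _ 1 1), PS_incr_n_lt by lia. unfold PS_derive. simpl. field.
    + rewrite (PS_incr_n_ge _ 1 (S (S n))), (PS_incr_n_ge _ 2 (S (S n))) by lia.
      generalize (asin_coef_SS (S (S n))). unfold PS_derive.
      replace (S (S n) - 1)%nat with (S n) by lia.
      replace (S (S n) - 2)%nat with n by lia.
      replace (S (S n) + 1)%nat with (S (S (S n))) by lia.
      replace (S (S n) + 2)%nat with (S (S (S (S n)))) by lia.
      intros E. rewrite <- (Rmult_assoc (INR (S (S (S n))))), E, (S_INR (S n)).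
      match goal with |- ?a = ?b => change (@eq R a b) end. ring.
  - now apply (is_unit_disk_series_plus _ _ (fun x => x ^ 1 * Z x) (fun x => x ^ 2 * Z' x));
      [apply is_unit_disk_series_incr|apply is_unit_disk_series_incr|]. }
assert (EZ : forall x, Rabs x < 1 -> Z x = / sqrt (1 - x ^ 2)).
{ intros x Hx.
  assert (E : Z x * sqrt (1 - x ^ 2) = 1).
  { rewrite (unit_disk_const (fun x => Z x * sqrt (1 - x ^ 2))); auto.
    - replace (1 - 0 ^ 2) with 1 by ring. rewrite sqrt_1.
      unfold Z. rewrite PSeries_0. unfold PS_derive. simpl. ring.
    - intros t Ht. assert (Hs := unit_disk_sqrt_pos t Ht).
      assert (Hs' := sqrt_lt_R0 _ Hs). assert (S2 := sqrt_sqrt _ (Rlt_le _ _ Hs)).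
      auto_derive.
      + split; [exists (Z' t); now apply dZ|]. split; [|exact I]. simpl in Hs. lra.
      + replace (Derive (fun x0 => Z x0) t) with (Z' t)
          by (symmetry; apply is_derive_unique, dZ, Ht).
        replace (1 + - (t * (t * 1))) with (1 - t ^ 2) by ring.
        apply (Rmult_eq_reg_r (sqrt (1 - t ^ 2))); [|lra].
        field_simplify; [|lra].
        replace (sqrt (1 - t ^ 2) ^ 2) with (1 - t ^ 2) by (rewrite <- S2 at 1; ring).
        rewrite (ODE t Ht) at 1.
        assert (O := ODE t Ht). nra. }
  assert (Hs' := sqrt_lt_R0 _ (unit_disk_sqrt_pos x Hx)).
  apply (Rmult_eq_reg_r (sqrt (1 - x ^ 2))); [|lra]. rewrite E. field. lra. }
apply is_unit_disk_series_ext with Y; [|exact HY].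
intros x Hx.
assert (E : Y x - asin x = 0).
{ rewrite (unit_disk_const (fun x => Y x - asin x)); auto.
  - rewrite asin_0. unfold Y. rewrite PSeries_0. simpl. ring.
  - intros t Ht. replace 0 with (Z t - / sqrt (1 - t ^ 2)) by (rewrite EZ by exact Ht; ring).
    apply (is_derive_minus (V := R_NormedModule)); [now apply dY|now apply is_derive_asin]. }
lra.
Qed.

Fixpoint asin_pow_coef (q : nat) : nat -> R :=
  match q with
  | O => fun k => match k with O => 1 | _ => 0 end
  | S p => PS_mult asin_coef (asin_pow_coef p)
  end.

Lemma asin_pow_unit_disk_series (q : nat) :
  is_unit_disk_series (asin_pow_coef q) (fun x => asin x ^ q).
Proof.
induction q as [|q IH].
- intros x Hx. change (asin x ^ 0) with 1.
  apply (filterlim_ext (fun _ => 1)); [|apply filterlim_const].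
  intros n. induction n as [|n IH].
  + rewrite sum_O. symmetry. apply Rmult_1_l.
  + rewrite sum_Sn, <- IH. symmetry.
    change (1 + pow_n x (S n) * 0 = 1). ring.
- simpl. apply is_unit_disk_series_mult; [apply asin_unit_disk_series | exact IH].
Qed.

(** Coefficient form of [(1 - x^2) F'' - x F' = q (q - 1) arcsin^(q - 2)] for [F = arcsin^q]. The
    truncated [q - 2] is harmless for [q <= 1], where the factor in front vanishes. *)
Lemma asin_pow_coef_SS (q k : nat) :
  INR (k + 2) * INR (k + 1) * asin_pow_coef q (k + 2) - INR k ^ 2 * asin_pow_coef q k =
  INR q * (INR q - 1) * asin_pow_coef (q - 2) k.
Proof.
set (s x := sqrt (1 - x ^ 2)).
set (F' x := INR q * asin x ^ (q - 1) / s x).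
set (F'' x := INR q * (INR q - 1) * asin x ^ (q - 2) / (s x) ^ 2 +
              INR q * asin x ^ (q - 1) * x / (s x) ^ 3).
assert (ds : forall x, Rabs x < 1 -> is_derive s x (- x / s x)).
{ intros x Hx. assert (H := unit_disk_sqrt_pos x Hx). assert (H2 := sqrt_lt_R0 _ H).
  unfold s. auto_derive.
  - simpl in H. lra.
  - replace (1 + - (x * (x * 1))) with (1 - x ^ 2) by ring. field. lra. }
assert (sp : forall x, Rabs x < 1 -> 0 < s x).
{ intros x Hx. apply sqrt_lt_R0. now apply unit_disk_sqrt_pos. }
assert (dp : forall m x, Rabs x < 1 ->
  is_derive (fun x => asin x ^ m) x (INR m * / s x * asin x ^ (m - 1))).
{ intros m x Hx. replace (m - 1)%nat with (Nat.pred m) by lia.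
  apply is_derive_pow. now apply is_derive_asin. }
assert (H0 := asin_pow_unit_disk_series q).
assert (H1 : is_unit_disk_series (PS_derive (asin_pow_coef q)) F').
{ apply (is_unit_disk_series_derive _ _ _ H0). intros x Hx.
  replace (F' x) with (INR q * / s x * asin x ^ (q - 1)) by (unfold F', Rdiv; ring).
  now apply dp. }
assert (H2 : is_unit_disk_series (PS_derive (PS_derive (asin_pow_coef q))) F'').
{ apply (is_unit_disk_series_derive _ _ _ H1). intros x Hx.
  assert (S0 := sp x Hx).
  evar_last.
  - apply (is_derive_div (fun x => INR q * asin x ^ (q - 1)) s); [|now apply ds|lra].
    apply (is_derive_scal (fun x => asin x ^ (q - 1))). now apply dp.
  - unfold F''. destruct q as [|[|q']].
    + simpl. field. lra.
    + simpl. field. lra.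
    + replace (S (S q') - 1 - 1)%nat with q' by lia.
      replace (S (S q') - 1)%nat with (S q') by lia.
      replace (S (S q') - 2)%nat with q' by lia.
      rewrite !S_INR. field. lra. }
assert (K : forall n,
  PS_derive (PS_derive (asin_pow_coef q)) n =
  PS_plus (PS_plus (PS_incr_n (PS_derive (asin_pow_coef q)) 1)
            (PS_incr_n (PS_derive (PS_derive (asin_pow_coef q))) 2))
          (PS_scal (INR q * (INR q - 1)) (asin_pow_coef (q - 2))) n).
{ apply is_unit_disk_series_unique with F''; [exact H2|].
  apply is_unit_disk_series_ext with
    (fun x => (x ^ 1 * F' x + x ^ 2 * F'' x) + INR q * (INR q - 1) * asin x ^ (q - 2)).
  - intros x Hx. unfold F', F''. assert (S0 := sp x Hx).
    assert (E : s x ^ 2 = 1 - x ^ 2).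
    { unfold s. rewrite <- Rsqr_pow2. apply Rsqr_sqrt. apply Rlt_le, unit_disk_sqrt_pos, Hx. }
    replace (x ^ 2) with (1 - s x ^ 2) by (rewrite E; ring).
    field. lra.
  - apply is_unit_disk_series_plus; [apply is_unit_disk_series_plus|].
    + now apply is_unit_disk_series_incr.
    + now apply is_unit_disk_series_incr.
    + apply is_unit_disk_series_scal, asin_pow_unit_disk_series. }
specialize (K k). rewrite !PS_plus_R in K.
change (PS_scal (INR q * (INR q - 1)) (asin_pow_coef (q - 2)) k) with
  (INR q * (INR q - 1) * asin_pow_coef (q - 2) k) in K.
replace (k + 1)%nat with (S k) by lia. replace (k + 2)%nat with (S (S k)) by lia.
destruct k as [|[|k]].
- rewrite !PS_incr_n_lt in K by lia. unfold PS_derive in K. simpl in *. lra.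
- rewrite (PS_incr_n_ge _ 1 1), PS_incr_n_lt in K by lia. unfold PS_derive in K. simpl in *. lra.
- rewrite (PS_incr_n_ge _ 1 (S (S k))), (PS_incr_n_ge _ 2 (S (S k))) in K by lia.
  unfold PS_derive in K.
  replace (S (S k) - 1)%nat with (S k) in K by lia.
  replace (S (S k) - 2)%nat with k in K by lia.
  rewrite !S_INR in *. lra.
Qed.

(** * Powers of arctan and the recursion in the Chebyshev degree *)

(* [[r^m] (arctan r)^q]; the truncated subtraction is harmless, since
   [artanh_coef m q] vanishes for [m < q]. *)
Definition arctan_coef (m q : nat) : R :=
  (-1) ^ ((m - q) / 2) * artanh_coef m q.

(** Coefficient of [r^(m + 1)] in [(1 + r^2) (arctan^q)' = q arctan^(q - 1)]. *)
Lemma arctan_coef_step (m q : nat) :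
  INR (m + 2) * arctan_coef (m + 2) q + INR m * arctan_coef m q =
  INR q * arctan_coef (m + 1) (q - 1).
Proof.
unfold arctan_coef. destruct q as [|q].
- replace (m + 2)%nat with (S (S m)) by lia. rewrite artanh_coef_0_r.
  destruct m as [|m]; [simpl; ring|]. rewrite artanh_coef_0_r. simpl. ring.
- replace (m + 1 - (S q - 1))%nat with (m + 2 - S q)%nat by lia.
  replace (S q - 1)%nat with q by lia.
  assert (E := artanh_coef_SS m q).
  replace (S (S m)) with (m + 2)%nat in E by lia.
  replace (S m) with (m + 1)%nat in E by lia.
  destruct (le_lt_dec (S q) m) as [H|H].
  + replace (m + 2 - S q)%nat with (m - S q + 1 * 2)%nat by lia.
    rewrite Nat.div_add by lia. rewrite pow_add, pow_1.
    transitivity (- (-1) ^ ((m - S q) / 2) *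
      (INR (m + 2) * artanh_coef (m + 2) (S q) - INR m * artanh_coef m (S q)));
      [ring|]. rewrite E. ring.
  + rewrite (artanh_coef_lt m (S q)) in * by exact H.
    transitivity ((-1) ^ ((m + 2 - S q) / 2) *
      (INR (m + 2) * artanh_coef (m + 2) (S q))); [ring|]. rewrite E. ring.
Qed.

(** The operator [(1 + r^2) d/dr] applied twice to [arctan^q], read in degree [m + 1]. Eliminating
    the power [q - 1] gives the shape that the Chebyshev side reproduces. *)
Lemma arctan_coef_two_steps (m q : nat) :
  INR q * (INR q - 1) * arctan_coef (m + 1) (q - 2) =
  (INR m + 2) * (INR m + 3) * arctan_coef (m + 3) q +
  2 * (INR m + 1) ^ 2 * arctan_coef (m + 1) q +
  INR m * (INR m - 1) * arctan_coef (m - 1) q.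
Proof.
assert (E1 := arctan_coef_step m (q - 1)).
assert (E2 := arctan_coef_step (m + 1) q).
replace (q - 1 - 1)%nat with (q - 2)%nat in E1 by lia.
replace (m + 1 + 2)%nat with (m + 3)%nat in E2 by lia.
replace (m + 1 + 1)%nat with (m + 2)%nat in E2 by lia.
rewrite !plus_INR in *. simpl INR in *.
(* The step relation one index lower, multiplied by [INR m] so that the truncated [m - 1] does no
   harm at [m = 0]. *)
assert (E3 : INR q * (INR m * arctan_coef m (q - 1)) =
  INR m * ((INR m + 1) * arctan_coef (m + 1) q + (INR m - 1) * arctan_coef (m - 1) q)).
{ destruct m as [|m]; [simpl; ring|].
  assert (E3 := arctan_coef_step m q).
  replace (S m + 1)%nat with (m + 2)%nat by lia.
  replace (S m - 1)%nat with m by lia.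
  replace (m + 1)%nat with (S m) in E3 by lia.
  rewrite plus_INR in E3. rewrite S_INR. simpl INR in E3.
  transitivity ((INR m + 1) * (INR q * arctan_coef (S m) (q - 1))); [ring|].
  rewrite <- E3. ring. }
assert (Q : INR q * (INR q - 1) = INR q * INR (q - 1)).
{ destruct q as [|q]; [simpl; ring|].
  replace (S q - 1)%nat with q by lia. rewrite S_INR. ring. }
rewrite Q, Rmult_assoc, <- E1, Rmult_plus_distr_l, E3.
transitivity ((INR m + 2) * (INR q * arctan_coef (m + 2) (q - 1)) +
  INR m * ((INR m + 1) * arctan_coef (m + 1) q + (INR m - 1) * arctan_coef (m - 1) q));
  [simpl; ring|].
rewrite <- E2. ring.
Qed.

Definition asin_pow_laurent (q : nat) (k : Z) : R :=
  if (k <? 0)%Z then 0 else asin_pow_coef q (Z.to_nat k).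

(* [[x^k] U_{m-1}(1/x) (arcsin x)^q], with the convention [U_{-1} = 0]. *)
Fixpoint chebyshev_asin_coef (q m : nat) (k : Z) : R :=
  match m with
  | O => 0
  | S m1 =>
      match m1 with
      | O => asin_pow_laurent q k
      | S m2 => 2 * chebyshev_asin_coef q m1 (k + 1) - chebyshev_asin_coef q m2 k
      end
  end.

Lemma chebyshev_asin_coef_SS (q m : nat) (k : Z) :
  chebyshev_asin_coef q (S (S m)) k =
  2 * chebyshev_asin_coef q (S m) (k + 1) - chebyshev_asin_coef q m k.
Proof. reflexivity. Qed.

Lemma asin_pow_laurent_step (q : nat) (k : Z) :
  (0 <= k)%Z ->
  (IZR k + 2) * (IZR k + 1) * asin_pow_laurent q (k + 2) -
    IZR k ^ 2 * asin_pow_laurent q k =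
  INR q * (INR q - 1) * asin_pow_laurent (q - 2) k.
Proof.
intros Hk. unfold asin_pow_laurent.
destruct (Z.ltb_spec (k + 2) 0); [lia|]. destruct (Z.ltb_spec k 0); [lia|].
rewrite <- asin_pow_coef_SS.
replace (Z.to_nat (k + 2)) with (Z.to_nat k + 2)%nat by lia.
rewrite !plus_INR, INR_IZR_INZ, Z2Nat.id by exact Hk. simpl INR. ring.
Qed.

(** The second-order equation of [arcsin^q], carried over to its product with [U_m(1/x)]. For
    [m = 0] it is [asin_pow_laurent_step]; the Chebyshev recurrence propagates it. *)
Lemma chebyshev_asin_coef_step (q m : nat) (k : Z) :
  (0 <= k)%Z ->
  INR q * (INR q - 1) * chebyshev_asin_coef (q - 2) (S m) k =
  (IZR k + INR m + 1) * (IZR k + INR m + 2) * chebyshev_asin_coef q (S m) (k + 2) -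
  IZR k ^ 2 * chebyshev_asin_coef q (S m) k -
  (2 * IZR k + 1) * (INR m + 1) * chebyshev_asin_coef q m (k + 1).
Proof.
(* The induction carries the relation for [m + 1] and for [m]. In the second one, the coefficient of
   index [m - 1] at [k + 1] is written through the recurrence read backwards, which makes sense for
   [m = 0] too. *)
enough (H : forall k, (0 <= k)%Z ->
  INR q * (INR q - 1) * chebyshev_asin_coef (q - 2) (S m) k =
  (IZR k + INR m + 1) * (IZR k + INR m + 2) * chebyshev_asin_coef q (S m) (k + 2) -
  IZR k ^ 2 * chebyshev_asin_coef q (S m) k -
  (2 * IZR k + 1) * (INR m + 1) * chebyshev_asin_coef q m (k + 1) /\
  INR q * (INR q - 1) * chebyshev_asin_coef (q - 2) m k =
  (IZR k + INR m) * (IZR k + INR m + 1) * chebyshev_asin_coef q m (k + 2) -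
  IZR k ^ 2 * chebyshev_asin_coef q m k -
  (2 * IZR k + 1) * INR m *
    (2 * chebyshev_asin_coef q m (k + 2) - chebyshev_asin_coef q (S m) (k + 1)))
  by (intros; now apply H).
clear k. induction m as [|m IH]; intros k Hk.
- split; [|simpl; ring].
  change (chebyshev_asin_coef (q - 2) 1 k) with (asin_pow_laurent (q - 2) k).
  rewrite <- asin_pow_laurent_step by exact Hk. simpl. ring.
- destruct (IH k Hk) as [I1 I2].
  destruct (IH (k + 1)%Z ltac:(lia)) as [I3 _].
  rewrite !S_INR, !chebyshev_asin_coef_SS.
  rewrite plus_IZR in I3. replace (k + 1 + 2)%Z with (k + 2 + 1)%Z in * by ring.
  replace (k + 1 + 1)%Z with (k + 2)%Z in * by ring.
  split.
  + transitivity (2 * (INR q * (INR q - 1) * chebyshev_asin_coef (q - 2) (S m) (k + 1))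
      - INR q * (INR q - 1) * chebyshev_asin_coef (q - 2) m k); [ring|].
    rewrite I2, I3. ring.
  + rewrite I1. ring.
Qed.

(** At [k = 1] the Chebyshev recurrence trades coefficients of [x^2] and [x^3] for coefficients of
    [x] at neighbouring degrees. What is left is a relation in [m] alone, that of
    [arctan_coef_two_steps] up to the factor 4. *)
Lemma chebyshev_asin_coef_two_steps (q m : nat) :
  4 * (INR q * (INR q - 1) * chebyshev_asin_coef (q - 2) (m + 1) 1) =
  (INR m + 2) * (INR m + 3) * chebyshev_asin_coef q (m + 3) 1 +
  2 * (INR m + 1) ^ 2 * chebyshev_asin_coef q (m + 1) 1 +
  INR m * (INR m - 1) * chebyshev_asin_coef q (m - 1) 1.
Proof.
replace (m + 1)%nat with (S m) by lia. replace (m + 3)%nat with (S (S (S m))) by lia.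
rewrite chebyshev_asin_coef_step by lia.
rewrite !(chebyshev_asin_coef_SS q (S m)).
rewrite chebyshev_asin_coef_SS.
change (1 + 1 + 1)%Z with 3%Z. change (1 + 1)%Z with 2%Z. change (1 + 2)%Z with 3%Z.
destruct m as [|m]; [simpl; ring|].
replace (S m - 1)%nat with m by lia.
assert (E : chebyshev_asin_coef q m 1 =
  2 * chebyshev_asin_coef q (S m) 2 - chebyshev_asin_coef q (S (S m)) 1).
{ rewrite chebyshev_asin_coef_SS. change (1 + 1)%Z with 2%Z. ring. }
rewrite E. ring.
Qed.

Lemma asin_pow_coef_0_r (q : nat) : asin_pow_coef (S q) 0 = 0.
Proof. simpl. unfold PS_mult. simpl. ring. Qed.

Lemma asin_pow_coef_1_r (q : nat) :
  asin_pow_coef q 1 = match q with 1%nat => 1 | _ => 0 end.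
Proof.
destruct q as [|q]; [reflexivity|].
simpl. unfold PS_mult. simpl.
destruct q as [|q]; [simpl; ring|]. rewrite asin_pow_coef_0_r. ring.
Qed.

(** Both sides satisfy the same relation between the indices [m + 3], [m + 1] and [m - 1], the
    factor 4 being absorbed by [2^q = 4 * 2^(q - 2)], and they agree in degrees 1 and 2. All [q] are
    treated together because the relation involves [q - 2]. *)
Lemma chebyshev_asin_coef_1 (q m : nat) :
  2 * chebyshev_asin_coef q (S m) 1 = 2 ^ q * arctan_coef (S m) q.
Proof.
enough (H : forall n m q, (m <= n)%nat ->
    2 * chebyshev_asin_coef q (S m) 1 = 2 ^ q * arctan_coef (S m) q)
  by now apply (H m).
clear. induction n as [n IH] using (well_founded_induction lt_wf); intros m q Hm.
destruct m as [|[|m]].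
- change (2 * asin_pow_coef q 1 = 2 ^ q * arctan_coef 1 q).
  rewrite asin_pow_coef_1_r. unfold arctan_coef.
  destruct q as [|[|q]]; simpl; ring.
- change (2 * (2 * asin_pow_coef q 2 - 0) = 2 ^ q * arctan_coef 2 q).
  assert (E : 2 * asin_pow_coef q 2 = INR q * (INR q - 1) * asin_pow_coef (q - 2) 0).
  { rewrite <- asin_pow_coef_SS. change (0 + 2)%nat with 2%nat. simpl INR. ring. }
  transitivity (2 * (2 * asin_pow_coef q 2)); [ring|]. rewrite E. unfold arctan_coef.
  destruct q as [|[|[|q]]].
  + simpl. field.
  + simpl. field.
  + simpl. field.
  + rewrite artanh_coef_lt by lia.
    replace (S (S (S q)) - 2)%nat with (S q) by lia.
    rewrite asin_pow_coef_0_r. ring.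
- assert (E := chebyshev_asin_coef_two_steps q m).
  assert (F := arctan_coef_two_steps m q).
  replace (m + 3)%nat with (S (S (S m))) in * by lia.
  replace (m + 1)%nat with (S m) in * by lia.
  assert (P : 0 < (INR m + 2) * (INR m + 3)) by (assert (K := pos_INR m); nra).
  apply (Rmult_eq_reg_l ((INR m + 2) * (INR m + 3))); [|lra].
  assert (I1 := IH (S m) ltac:(lia) m q ltac:(lia)).
  assert (I2 := IH (S m) ltac:(lia) m (q - 2)%nat ltac:(lia)).
  (* For [m <= 1] the factor [INR m * (INR m - 1)] vanishes, so nothing is asked in degree 0, where
     the identity fails for [q = 0]. *)
  assert (I3 : 2 * (INR m * (INR m - 1) * chebyshev_asin_coef q (m - 1) 1) =
    2 ^ q * (INR m * (INR m - 1) * arctan_coef (m - 1) q)).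
  { destruct m as [|[|m]]; [simpl; ring|simpl; ring|].
    assert (I3 := IH (S m) ltac:(lia) m q ltac:(lia)).
    replace (S (S m) - 1)%nat with (S m) by lia.
    transitivity (INR (S (S m)) * (INR (S (S m)) - 1) * (2 * chebyshev_asin_coef q (S m) 1)); [ring|].
    rewrite I3. ring. }
  assert (I4 : 4 * (INR q * (INR q - 1) * (2 * chebyshev_asin_coef (q - 2) (S m) 1)) =
     2 ^ q * (INR q * (INR q - 1) * arctan_coef (S m) (q - 2))).
  { rewrite I2. destruct q as [|[|q]]; [simpl; ring|simpl; ring|].
    replace (S (S q) - 2)%nat with q by lia. simpl pow. ring. }
  transitivity (4 * (INR q * (INR q - 1) * (2 * chebyshev_asin_coef (q - 2) (S m) 1))
     - 2 * (INR m + 1) ^ 2 * (2 * chebyshev_asin_coef q (S m) 1)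
     - 2 * (INR m * (INR m - 1) * chebyshev_asin_coef q (m - 1) 1)).
  { apply (f_equal (Rmult 2)) in E. lra. }
  rewrite I4, I1, I3, F. ring.
Qed.

(** * Laurent expansions and closed forms of [a_coef] and [b_coef] *)

Lemma laurent_expansion_from_div (N : nat) (f : R -> R) (c : Z -> R) :
  laurent_expansion_from N f c ->
  laurent_expansion_from (S N) (fun x => / x * f x) (fun k => c (k + 1)%Z).
Proof.
intros [H0 [Hr Hf]].
set (u := fun j : nat => c (Z.of_nat j - Z.of_nat N)%Z) in *.
assert (E : forall j, u j = c (Z.of_nat j - Z.of_nat (S N) + 1)%Z)
  by (intros j; unfold u; f_equal; lia).
split; [|split].
- intros k Hk. apply H0. lia.
- now rewrite <- (CV_radius_ext _ _ E).
- revert Hf. unfold locally', within. apply filter_imp. intros x Hx Hx0.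
  rewrite (Hx Hx0), <- (PSeries_ext _ _ x E). simpl. field.
  split; [now apply pow_nonzero|exact Hx0].
Qed.

Lemma locally_ex_pseries (a : nat -> R) :
  Rbar_lt 0 (CV_radius a) -> locally 0 (fun x => ex_pseries a x).
Proof.
intros H.
assert (K : exists r : posreal, Rbar_le r (CV_radius a)).
{ destruct (CV_radius a) as [r| |].
  - exists (mkposreal r H). apply Rle_refl.
  - exists (mkposreal 1 Rlt_0_1). exact I.
  - destruct H. }
destruct K as [r Hr]. exists r. intros x Hx.
apply CV_radius_inside, Rbar_lt_le_trans with (2 := Hr).
unfold ball in Hx; simpl in Hx. unfold AbsRing_ball, abs, minus, plus, opp in Hx; simpl in Hx.
simpl. now rewrite Ropp_0, Rplus_0_r in Hx.
Qed.

Lemma laurent_expansion_from_lin (a b : R) (N : nat) (f g : R -> R) (c d : Z -> R) :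
  laurent_expansion_from N f c -> laurent_expansion_from N g d ->
  laurent_expansion_from N (fun x => a * f x + b * g x) (fun k => a * c k + b * d k).
Proof.
intros [c0 [cr cf]] [d0 [dr df]].
set (u := fun j : nat => c (Z.of_nat j - Z.of_nat N)%Z) in *.
set (v := fun j : nat => d (Z.of_nat j - Z.of_nat N)%Z) in *.
assert (S : forall (e : R) w, Rbar_lt 0 (CV_radius w) -> Rbar_lt 0 (CV_radius (PS_scal e w))).
{ intros e w Hw. destruct (Req_dec e 0) as [->|He].
  - rewrite (CV_radius_ext _ (fun _ => 0)); [now rewrite CV_radius_const_0|].
    intros n. apply Rmult_0_l.
  - now rewrite CV_radius_scal. }
assert (R1 : Rbar_lt 0 (CV_radius (PS_plus (PS_scal a u) (PS_scal b v)))).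
{ apply Rbar_lt_le_trans with (2 := CV_radius_plus _ _).
  apply Rbar_min_case; now apply S. }
split; [|split].
- intros k Hk. rewrite c0, d0 by exact Hk. ring.
- exact R1.
- assert (Cu : locally 0 (fun x => ex_pseries u x)).
  { apply locally_ex_pseries. exact cr. }
  assert (Cv : locally 0 (fun x => ex_pseries v x)).
  { apply locally_ex_pseries. exact dr. }
  generalize (filter_and _ _ (filter_and _ _ Cu Cv) (filter_and _ _ cf df)).
  unfold locally', within. apply filter_imp.
  intros x [[Xu Xv] X] Hx0. destruct (X Hx0) as [Xf Xg]. rewrite Xf, Xg.
  change (fun j : nat => a * c (Z.of_nat j - Z.of_nat N)%Z + b * d (Z.of_nat j - Z.of_nat N)%Z)
    with (PS_plus (PS_scal a u) (PS_scal b v)).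
  rewrite PSeries_plus, !PSeries_scal; [field; now apply pow_nonzero| |];
    apply ex_pseries_scal; auto using Rmult_comm.
Qed.

(** Two consecutive degrees are carried with a common bound [N] on the principal part, since the
    Chebyshev recurrence uses both; the factor [1/x] shifts coefficients and costs one more negative
    power. *)
Lemma chebyshev_asin_laurent (q m : nat) :
  is_laurent_expansion (fun x => chebyshevU m (1 / x) * asin x ^ q)
    (chebyshev_asin_coef q (S m)).
Proof.
enough (H : exists N,
  laurent_expansion_from N (fun x => chebyshevU m (1 / x) * asin x ^ q)
    (chebyshev_asin_coef q (S m)) /\
  laurent_expansion_from N (fun x => chebyshevU (S m) (1 / x) * asin x ^ q)
    (chebyshev_asin_coef q (S (S m)))) by (destruct H as [N [H _]]; now exists N).
assert (ext : forall N f g c d, (forall x, f x = g x) -> (forall k, c k = d k) ->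
  laurent_expansion_from N f c -> laurent_expansion_from N g d).
{ intros N f g c d E F [H0 [H1 H2]]. split; [|split].
  - intros k Hk. rewrite <- F. now apply H0.
  - now rewrite <- (CV_radius_ext _ _ (fun j => F (Z.of_nat j - Z.of_nat N)%Z)).
  - revert H2. unfold locally', within. apply filter_imp. intros x Hx Hx0.
    rewrite <- E, (Hx Hx0). f_equal. apply PSeries_ext. intros j. apply F. }
assert (H0 : laurent_expansion_from 0 (fun x => asin x ^ q) (asin_pow_laurent q)).
{ assert (E : forall j, asin_pow_coef q j = asin_pow_laurent q (Z.of_nat j - Z.of_nat 0)).
  { intros j. unfold asin_pow_laurent.
    destruct (Z.ltb_spec (Z.of_nat j - Z.of_nat 0) 0); [lia|]. f_equal. lia. }
  assert (H := asin_pow_unit_disk_series q).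
  split; [|split].
  - intros k Hk. unfold asin_pow_laurent. now destruct (Z.ltb_spec k 0); [|lia].
  - rewrite <- (CV_radius_ext _ _ E). now apply is_unit_disk_series_radius_pos in H.
  - exists (mkposreal 1 Rlt_0_1). intros x Hx _.
    rewrite <- (PSeries_ext _ _ x E). simpl. rewrite Rdiv_1_r. symmetry.
    apply is_pseries_unique, H.
    unfold ball in Hx; simpl in Hx. unfold AbsRing_ball, abs, minus, plus, opp in Hx; simpl in Hx.
    now rewrite Ropp_0, Rplus_0_r in Hx. }
induction m as [|m [N [H1 H2]]].
- exists 1%nat. split.
  + apply laurent_expansion_from_S.
    apply ext with (3 := H0); intros; simpl; ring.
  + apply laurent_expansion_from_div in H0.
    apply ext with (3 := laurent_expansion_from_lin 2 0 _ _ _ _ _ H0 H0); intros; simpl;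
      unfold Rdiv; ring.
- exists (S N). split; [now apply laurent_expansion_from_S|].
  assert (H3 := laurent_expansion_from_div _ _ _ H2).
  assert (H4 := laurent_expansion_from_S _ _ _ H1).
  apply ext with (3 := laurent_expansion_from_lin 2 (-1) _ _ _ _ _ H3 H4).
  + intros x. change (chebyshevU (S (S m)) (1 / x)) with
      (2 * (1 / x) * chebyshevU (S m) (1 / x) - chebyshevU m (1 / x)).
    unfold Rdiv. ring.
  + intros k. rewrite (chebyshev_asin_coef_SS q (S m)). ring.
Qed.

Lemma a_coef_artanh (p n : nat) :
  (1 <= p <= n)%nat ->
  a_coef p n = (-1) ^ (n - p) * 2 ^ (2 * p - 1) * artanh_coef (2 * n) (2 * p).
Proof.
intros H. unfold a_coef.
rewrite (laurent_coef_unique _ _ (chebyshev_asin_laurent (2 * p) (2 * n - 1))).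
apply (Rmult_eq_reg_l 2); [|lra]. rewrite chebyshev_asin_coef_1.
replace (S (2 * n - 1)) with (2 * n)%nat by lia. unfold arctan_coef.
replace (2 * n - 2 * p)%nat with ((n - p) * 2)%nat by lia. rewrite Nat.div_mul by lia.
replace (2 ^ (2 * p)) with (2 * 2 ^ (2 * p - 1)); [ring|].
replace (2 * p)%nat with (S (2 * p - 1)) at 2 by lia. reflexivity.
Qed.

Lemma b_coef_artanh (p n : nat) :
  (1 <= p <= n)%nat ->
  b_coef p n = (-1) ^ (n - p) * 2 ^ (2 * p - 2) * artanh_coef (2 * n - 1) (2 * p - 1).
Proof.
intros H. unfold b_coef.
rewrite (laurent_coef_unique _ _ (chebyshev_asin_laurent (2 * p - 1) (2 * n - 2))).
apply (Rmult_eq_reg_l 2); [|lra]. rewrite chebyshev_asin_coef_1.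
replace (S (2 * n - 2)) with (2 * n - 1)%nat by lia. unfold arctan_coef.
replace (2 * n - 1 - (2 * p - 1))%nat with ((n - p) * 2)%nat by lia. rewrite Nat.div_mul by lia.
replace (2 ^ (2 * p - 1)) with (2 * 2 ^ (2 * p - 2)); [ring|].
replace (2 * p - 1)%nat with (S (2 * p - 2)) by lia. reflexivity.
Qed.

(** Turns operations of abstract structures over [R] into the concrete ones, so that [ring] and
    [field] recognise the goal. *)
Ltac eqR :=
  match goal with |- ?a = ?b => change (@eq R a b) end;
  repeat match goal with
  | |- context [@plus ?G ?a ?b] => change (@plus G a b) with (Rplus a b)
  | |- context [@minus ?G ?a ?b] => change (@minus G a b) with (Rminus a b)
  | |- context [@opp ?G ?a] => change (@opp G a) with (Ropp a)
  | |- context [@scal ?K ?V ?a ?b] => change (@scal K V a b) with (Rmult a b)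
  | |- context [@mult ?K ?a ?b] => change (@mult K a b) with (Rmult a b)
  | |- context [@one ?K] => change (@one K) with 1
  | |- context [@zero ?G] => change (@zero G) with 0
  end.

(** * Odd cosine series and the partial fractions of tanh and sech *)

Lemma continuous_bounded (f : R -> R) (a b : R) :
  a <= b -> (forall x, a <= x <= b -> continuous f x) ->
  exists M, 0 <= M /\ forall x, a <= x <= b -> Rabs (f x) <= M.
Proof.
intros Hab Hf.
destruct (continuity_ab_maj (fun x => Rabs (f x)) a b Hab) as [m [Hm _]].
- intros c Hc. apply continuity_pt_filterlim.
  apply (continuous_comp f Rabs); [now apply Hf|].
  apply (continuous_abs (f c)).
- exists (Rabs (f m)). split; [apply Rabs_pos|exact Hm].
Qed.

Lemma sum_Sn_R (a : nat -> R) (n : nat) : sum_n a (S n) = sum_n a n + a (S n).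
Proof. exact (sum_Sn a n). Qed.

Lemma ball_Rabs (x e y : R) : ball x e y -> Rabs (y - x) < e.
Proof. intros H. exact H. Qed.

Lemma Rabs_le_MVT (f f' : R -> R) (a b M : R) :
  (forall t, Rmin a b <= t <= Rmax a b -> is_derive f t (f' t)) ->
  (forall t, Rmin a b <= t <= Rmax a b -> Rabs (f' t) <= M) ->
  Rabs (f b - f a) <= M * Rabs (b - a).
Proof.
intros H HM. destruct (MVT_gen f a b f') as [c [Hc ->]].
- intros x Hx. apply H. lra.
- intros x Hx. apply derivable_continuous_pt. exists (f' x).
  apply is_derive_Reals. now apply H.
- rewrite Rabs_mult. apply Rmult_le_compat_r; [apply Rabs_pos|]. now apply HM.
Qed.

(** From [sin u >= u - u^3 / 6] and [u^2 <= 4]. *)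
Lemma sin_ge_third (u : R) : 0 <= u <= 2 -> u / 3 <= sin u.
Proof.
intros Hu. assert (P := PI2_1).
destruct (sin_bound u 0) as [H _]; [lra|lra|].
unfold sin_approx, sin_term in H. simpl in H.
replace (1 * (u * 1 / 1) + -1 * 1 * (u * (u * (u * 1)) / (1 + 1 + 1 + 1 + 1 + 1)))
  with (u - u * (u * u) / 6) in H by field.
assert (u * u <= 4) by nra. nra.
Qed.

Lemma sin_INR_PI (k : nat) : sin (INR k * PI) = 0.
Proof.
induction k as [|k IH]; [simpl; rewrite Rmult_0_l; apply sin_0|].
rewrite S_INR, Rmult_plus_distr_r, Rmult_1_l, neg_sin, IH. ring.
Qed.

(* Integration by parts: [g' x * cos (N * PI * x) / (N * PI)] is the derivative of
   the integral of [g x * sin (N * PI * x)] plus [g x * cos (N * PI * x) / (N * PI)]. *)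
Lemma RInt_mult_sin_bound (g g' : R -> R) (C : R) :
  (forall x, -1 / 2 < x < 3 / 2 -> continuous g x) ->
  (forall x, 0 < x < 1 -> is_derive g x (g' x)) ->
  (forall x, 0 <= x <= 1 -> Rabs (g' x) <= C) ->
  exists K, forall N, (1 <= N)%nat -> forall I : R,
    is_RInt (fun x => g x * sin (INR N * PI * x)) 0 1 I -> Rabs I <= K / INR N.
Proof.
intros Hc Hd HC. exists (C + Rabs (g 0) + Rabs (g 1)). intros N HN I HI.
assert (PN : 1 <= INR N) by (change 1 with (INR 1); now apply le_INR).
assert (Pi := PI2_1).
set (m := INR N * PI) in *.
assert (Hm : INR N <= m) by (unfold m; nra).
set (h := fun x => g x * sin (m * x)) in *.
assert (hc : forall x, -1 / 2 < x < 3 / 2 -> continuous h x).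
{ intros x Hx. apply (continuous_mult g (fun x => sin (m * x))); [now apply Hc|].
  apply (ex_derive_continuous (fun x => sin (m * x))). auto_derive. exact Logic.I. }
assert (hi : forall x, -1 / 2 < x < 3 / 2 -> ex_RInt h 0 x).
{ intros x Hx. apply (ex_RInt_continuous h). intros z Hz. apply hc. revert Hz.
  unfold Rmin, Rmax. destruct (Rle_dec 0 x); lra. }
assert (dI : forall x, 0 <= x <= 1 -> is_derive (fun x => RInt h 0 x) x (h x)).
{ intros x Hx. apply (is_derive_RInt h (fun x => RInt h 0 x) 0 x); [|apply hc; lra].
  exists (mkposreal (1/2) ltac:(lra)). intros y Hy. apply (RInt_correct h), hi.
  apply ball_Rabs, Rabs_def2 in Hy. simpl in Hy. destruct Hy as [H1 H2].
  split; lra. }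
(* The mean value theorem stands in for the integral of [g' x * cos (m * x) / m], as [g'] is only
   known to be bounded. *)
destruct (MVT_gen (fun x => RInt h 0 x + g x * cos (m * x) / m) 0 1
   (fun x => g' x * cos (m * x) / m)) as [c [Hx E]].
- intros x. rewrite Rmin_left, Rmax_right by lra. intros Hx.
  replace (g' x * cos (m * x) / m) with
    (h x + (g' x * cos (m * x) - m * g x * sin (m * x)) / m)
    by (unfold h; field; lra).
  apply (is_derive_plus (fun x => RInt h 0 x) (fun x => g x * cos (m * x) / m));
    [apply (dI x); lra|].
  auto_derive; [exists (g' x); apply Hd; lra|].
  replace (Derive (fun x0 => g x0) x) with (g' x)
    by (symmetry; apply is_derive_unique, Hd; lra). field. lra.
- intros x. rewrite Rmin_left, Rmax_right by lra. intros Hx.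
  apply continuity_pt_filterlim.
  apply (continuous_plus (fun x => RInt h 0 x) (fun x => g x * cos (m * x) / m)).
  + apply (ex_derive_continuous (fun x => RInt h 0 x)). exists (h x). now apply dI.
  + apply (continuous_mult (fun x => g x * cos (m * x)) (fun _ => / m)); [|apply continuous_const].
    apply (continuous_mult g (fun x => cos (m * x))); [apply Hc; lra|].
    apply (ex_derive_continuous (fun x => cos (m * x))). auto_derive. exact Logic.I.
- rewrite (is_RInt_unique _ _ _ _ HI), RInt_point in E.
  change (zero : R) with 0 in E. rewrite Rmult_0_r, cos_0 in E.
  assert (E' : I = (g' c * cos (m * c) + g 0 - g 1 * cos (m * 1)) / m).
  { apply (Rmult_eq_reg_r m); [|lra]. field_simplify; [|lra].
    apply (f_equal (Rmult m)) in E. field_simplify in E; [|lra|lra].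
    change (@zero R_AbelianGroup) with 0 in E. lra. }
  rewrite E'. unfold Rdiv at 1. rewrite Rabs_mult, Rabs_inv, (Rabs_pos_eq m) by lra.
  rewrite Rmin_left, Rmax_right in Hx by lra.
  apply Rmult_le_compat; try apply Rabs_pos.
  + apply Rlt_le, Rinv_0_lt_compat. lra.
  + apply Rle_trans with (1 := Rabs_triang _ _). rewrite Rabs_Ropp.
    apply Rplus_le_compat; [apply Rle_trans with (1 := Rabs_triang _ _); apply Rplus_le_compat_r|];
      rewrite Rabs_mult.
    * rewrite <- (Rmult_1_r C).
      apply Rmult_le_compat; try apply Rabs_pos; [now apply HC|apply Rabs_le, COS_bound].
    * rewrite <- (Rmult_1_r (Rabs (g 1))) at 2.
      apply Rmult_le_compat_l; [apply Rabs_pos|]. apply Rabs_le, COS_bound.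
  + apply Rinv_le_contravar; lra.
Qed.

Lemma dirichlet_kernel (n : nat) (t : R) :
  sum_n (fun k => 2 * cos ((2 * INR k + 1) * t)) n * sin t = sin (2 * INR (n + 1) * t).
Proof.
induction n as [|n IH].
- rewrite sum_O. simpl. replace ((2 * 0 + 1) * t) with t by ring.
  replace (2 * 1 * t) with (2 * t) by ring. rewrite sin_2a. ring.
- rewrite sum_Sn_R. rewrite Rmult_plus_distr_r, IH.
  rewrite !Nat.add_1_r, !S_INR.
  replace (2 * (INR n + 1) * t) with ((2 * (INR n + 1) + 1) * t - t) by ring.
  replace (2 * (INR n + 1 + 1) * t) with ((2 * (INR n + 1) + 1) * t + t) by ring.
   rewrite sin_minus, sin_plus. ring.
Qed.

(** The kernel reproduces the value of [cos (PI / 2 * x)] at 0 exactly, for every [n]: each new term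
    adds two cosines of whole multiples of [PI * x], whose integrals over [[0, 1]] vanish. Hence
    [phi 0] can be split off without error in [odd_cosine_series]. *)
Lemma dirichlet_kernel_cos_integral (n : nat) :
  is_RInt (fun x => cos (PI / 2 * x) *
    sum_n (fun k => 2 * cos ((2 * INR k + 1) * (PI / 2 * x))) n) 0 1 1.
Proof.
assert (Pi := PI_RGT_0).
induction n as [|n IH].
- apply (is_RInt_ext (fun x => cos (PI * x) + 1)).
  { intros x _. rewrite sum_O. simpl.
    replace ((2 * 0 + 1) * (PI / 2 * x)) with (PI / 2 * x) by ring.
    replace (PI * x) with (2 * (PI / 2 * x)) by field. rewrite cos_2a_cos. ring. }
  evar_last.
  + apply (is_RInt_derive (fun x => sin (PI * x) / PI + x)).
    * intros x _. auto_derive; [exact I|]. field. lra.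
    * intros x _. apply (ex_derive_continuous (fun x => cos (PI * x) + 1)). auto_derive. exact I.
  + rewrite Rmult_1_r, Rmult_0_r, sin_PI, sin_0. unfold minus, plus, opp; simpl. field. lra.
- apply (is_RInt_ext (fun x => cos (PI / 2 * x) *
     sum_n (fun k => 2 * cos ((2 * INR k + 1) * (PI / 2 * x))) n +
     (cos (INR (S (S n)) * PI * x) + cos (INR (S n) * PI * x)))).
  { intros x _. rewrite sum_Sn_R.
    rewrite Rmult_plus_distr_l. f_equal.
    rewrite (S_INR (S n)).
    replace ((INR (S n) + 1) * PI * x) with ((2 * INR (S n) + 1) * (PI / 2 * x) + PI / 2 * x) by field.
    replace (INR (S n) * PI * x) with ((2 * INR (S n) + 1) * (PI / 2 * x) - PI / 2 * x) by field.
    rewrite cos_plus, cos_minus. eqR. ring. }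
  evar_last; [apply (is_RInt_plus (V := R_NormedModule)); [exact IH|] | apply Rplus_0_r].
  set (a := INR (S (S n))). set (b := INR (S n)).
  assert (Ha : 0 < a) by (apply lt_0_INR; lia). assert (Hb : 0 < b) by (apply lt_0_INR; lia).
  assert (Pa : 0 < a * PI) by nra. assert (Pb : 0 < b * PI) by nra.
  evar_last.
  + apply (is_RInt_derive (fun x => sin (a * PI * x) / (a * PI) + sin (b * PI * x) / (b * PI))).
    * intros x _. auto_derive; [exact I|]. field. lra.
    * intros x _. apply (ex_derive_continuous (fun x => cos (a * PI * x) + cos (b * PI * x))).
      auto_derive. exact I.
  + rewrite !Rmult_1_r, !Rmult_0_r. unfold a, b. rewrite !sin_INR_PI, sin_0.
    unfold minus, plus, opp; simpl. unfold Rdiv. ring.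
Qed.

(* Subtracting [phi 0 * cos (PI / 2 * x)] and a multiple of [sin (PI / 2 * x)] from
   [phi] leaves a function with a double zero at 0, whose quotient by
   [sin (PI / 2 * x)] is Lipschitz. *)
Lemma odd_cosine_series (phi phi' phi'' : R -> R) (I : nat -> R) :
  (forall x, is_derive phi x (phi' x)) ->
  (forall x, is_derive phi' x (phi'' x)) ->
  (forall x, continuous phi'' x) ->
  (forall k, is_RInt (fun x => phi x * cos ((2 * INR k + 1) * (PI / 2 * x))) 0 1 (I k)) ->
  is_series (fun k => 2 * I k) (phi 0).
Proof.
intros d1 d2 c2 HI.
assert (Pi := PI2_1). assert (Pi4 := PI_4).
set (b := PI / 2) in *.
set (c := phi' 0 / b).
set (psi x := phi x - phi 0 * cos (b * x) - c * sin (b * x)).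
set (psi' x := phi' x + phi 0 * b * sin (b * x) - c * b * cos (b * x)).
set (psi'' x := phi'' x + phi 0 * b ^ 2 * cos (b * x) + c * b ^ 2 * sin (b * x)).
assert (e1 : forall x, is_derive psi x (psi' x)).
{ intros x. unfold psi. auto_derive; [exists (phi' x); apply d1|].
  replace (Derive (fun x0 => phi x0) x) with (phi' x)
    by (symmetry; apply is_derive_unique, d1). unfold psi'. ring. }
assert (e2 : forall x, is_derive psi' x (psi'' x)).
{ intros x. unfold psi'. auto_derive; [exists (phi'' x); apply d2|].
  replace (Derive (fun x0 => phi' x0) x) with (phi'' x)
    by (symmetry; apply is_derive_unique, d2). unfold psi''. ring. }
destruct (continuous_bounded psi'' (-1) 1) as [M [M0 HM]]; [lra| |].
{ intros x _. unfold psi''.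
  apply (continuous_plus (fun x => phi'' x + phi 0 * b ^ 2 * cos (b * x)) (fun x => c * b ^ 2 * sin (b * x))).
  - apply (continuous_plus phi'' (fun x => phi 0 * b ^ 2 * cos (b * x))); [apply c2|].
    apply (ex_derive_continuous (fun x => phi 0 * b ^ 2 * cos (b * x))). auto_derive. exact Logic.I.
  - apply (ex_derive_continuous (fun x => c * b ^ 2 * sin (b * x))). auto_derive. exact Logic.I. }
assert (z1 : psi' 0 = 0).
{ unfold psi', c. rewrite Rmult_0_r, sin_0, cos_0. field. lra. }
assert (z0 : psi 0 = 0).
{ unfold psi. rewrite Rmult_0_r, sin_0, cos_0. ring. }
assert (mm : forall t x, Rmin 0 x <= t <= Rmax 0 x -> -1 <= x <= 1 ->
   -1 <= t <= 1 /\ Rabs t <= Rabs x).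
{ intros t x. unfold Rmin, Rmax. destruct (Rle_dec 0 x); intros Ht Hx; split; try lra.
  - rewrite !Rabs_pos_eq; lra.
  - rewrite !Rabs_left1; lra. }
assert (b1 : forall x, -1 <= x <= 1 -> Rabs (psi' x) <= M * Rabs x).
{ intros x Hx. replace (psi' x) with (psi' x - psi' 0) by (rewrite z1; ring).
  replace (Rabs x) with (Rabs (x - 0)) by (f_equal; ring).
  apply Rabs_le_MVT with psi''; [intros; apply e2|].
  intros t Ht. apply HM. now apply (mm t x). }
assert (b0 : forall x, -1 <= x <= 1 -> Rabs (psi x) <= M * Rabs x * Rabs x).
{ intros x Hx. replace (psi x) with (psi x - psi 0) by (rewrite z0; ring).
  replace (Rabs x) with (Rabs (x - 0)) at 2 by (f_equal; ring).
  apply Rabs_le_MVT with psi'; [intros; apply e1|].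
  intros t Ht. destruct (mm t x Ht Hx) as [T1 T2].
  apply Rle_trans with (1 := b1 t T1). now apply Rmult_le_compat_l. }
assert (s3 : forall x, 0 <= x <= 1 -> x / 3 <= sin (b * x)).
{ intros x Hx. apply Rle_trans with (b * x / 3); [nra|]. apply sin_ge_third. unfold b in *. nra. }
assert (s3' : forall x, -1 <= x <= 1 -> Rabs x / 3 <= Rabs (sin (b * x))).
{ intros x Hx. destruct (Rle_dec 0 x) as [L|L].
  - rewrite (Rabs_pos_eq x) by exact L. apply Rle_trans with (2 := Rle_abs _). apply s3. lra.
  - rewrite (Rabs_left1 x) by lra. rewrite <- Rabs_Ropp, <- sin_neg.
    apply Rle_trans with (2 := Rle_abs _).
    replace (- (b * x)) with (b * - x) by ring. apply s3. lra. }
assert (snz : forall x, -1/2 < x < 3/2 -> x <> 0 -> sin (b * x) <> 0).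
{ intros x Hx H0. destruct (Rle_dec x 0) as [L|L].
  - assert (X := s3 (- x) ltac:(lra)). rewrite Ropp_mult_distr_r_reverse, sin_neg in X. lra.
  - assert (0 < sin (b * x)); [|lra]. apply sin_gt_0; unfold b in *; nra. }
(* Chosen so that [phi x - phi 0 * cos (b * x)] times the kernel is
   [g x * sin (INR (n + 1) * PI * x)]; the subtracted sine returns as the constant [c]. At 0 the
   numerators vanish, so [g 0 = c] and [g' 0 = 0] whatever the inverse of 0 is. *)
set (g x := psi x / sin (b * x) + c).
set (g' x := psi' x / sin (b * x) - psi x * b * cos (b * x) / sin (b * x) ^ 2).
assert (dg : forall x, -1/2 < x < 3/2 -> x <> 0 -> is_derive g x (g' x)).
{ intros x Hx H0. assert (S := snz x Hx H0). unfold g.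
  auto_derive.
  - split; [exists (psi' x); apply e1|]. now split.
  - replace (Derive (fun x0 => psi x0) x) with (psi' x)
      by (symmetry; apply is_derive_unique, e1). unfold g'. field. exact S. }
assert (bg : forall x, -1 <= x <= 1 -> Rabs (psi x / sin (b * x)) <= 3 * M * Rabs x).
{ intros x Hx. destruct (Req_dec x 0) as [->|H0].
  - rewrite z0. unfold Rdiv. rewrite Rmult_0_l, Rabs_R0. lra.
  - assert (P := Rabs_pos_lt x H0). assert (S := s3' x Hx).
    unfold Rdiv. rewrite Rabs_mult, Rabs_inv.
    apply Rle_div_l; [lra|]. apply Rle_trans with (1 := b0 x Hx).
    assert (M * Rabs x * (Rabs x / 3) <= M * Rabs x * Rabs (sin (b * x)))
      by (apply Rmult_le_compat_l; nra). lra. }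
(* From [|psi'| <= M x], [|psi| <= M x^2] and [sin (b x) >= x / 3]: the first term of [g'] is at
   most [3 * M], the second at most [3 * M * x] times [3 * b / x]. *)
destruct (RInt_mult_sin_bound g g' (3 * M + 9 * M * b)) as [K HK].
- intros x Hx. destruct (Req_dec x 0) as [->|H0].
  + apply (continuous_plus (fun x => psi x / sin (b * x)) (fun _ => c)); [|apply continuous_const].
    intros P [e He].
    assert (Hd : 0 < Rmin 1 (e / (3 * M + 1))).
    { apply Rmin_case; [lra|]. apply Rdiv_lt_0_compat; [apply cond_pos|lra]. }
    exists (mkposreal _ Hd). intros y Hy. apply ball_Rabs in Hy. simpl in Hy.
    rewrite Rminus_0_r in Hy. apply He.
    rewrite z0. unfold Rdiv at 1. rewrite Rmult_0_l.
    assert (Y1 := Rlt_le_trans _ _ _ Hy (Rmin_l _ _)).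
    assert (Y2 := Rlt_le_trans _ _ _ Hy (Rmin_r _ _)).
    apply Rlt_div_r in Y2; [|lra].
    assert (Y3 : -1 <= y <= 1) by (apply Rabs_def2 in Y1; lra).
    change (Rabs (psi y / sin (b * y) - 0) < e). rewrite Rminus_0_r.
    apply Rle_lt_trans with (1 := bg y Y3). assert (Y4 := Rabs_pos y). nra.
  + apply (ex_derive_continuous g). exists (g' x). now apply dg.
- intros x Hx. apply dg; lra.
- intros x Hx. destruct (Req_dec x 0) as [->|H0].
  + unfold g'. rewrite z0, z1. unfold Rdiv. rewrite !Rmult_0_l, Rminus_0_r, Rabs_R0. nra.
  + assert (S := s3 x Hx). assert (X := b1 x ltac:(lra)). assert (X' := bg x ltac:(lra)).
    rewrite (Rabs_pos_eq x) in * by lra.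
    assert (S0 : 0 < sin (b * x)) by lra.
    unfold g'. apply Rle_trans with (1 := Rabs_triang _ _). rewrite Rabs_Ropp.
    apply Rplus_le_compat.
    * unfold Rdiv. rewrite Rabs_mult, Rabs_inv, (Rabs_pos_eq (sin _)) by lra.
      apply Rle_div_l; [lra|]. nra.
    * replace (psi x * b * cos (b * x) / sin (b * x) ^ 2) with
        (psi x / sin (b * x) * (b / sin (b * x)) * cos (b * x)) by (field; lra).
      rewrite !Rabs_mult, <- (Rmult_1_r (9 * M * b)).
      assert (B : Rabs (b / sin (b * x)) * x <= 3 * b).
      { unfold Rdiv. rewrite Rabs_mult, Rabs_inv, (Rabs_pos_eq (sin _)), (Rabs_pos_eq b) by lra.
        rewrite Rmult_assoc. rewrite (Rmult_comm (/ _)).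
        rewrite (Rmult_comm 3). apply Rmult_le_compat_l; [lra|]. apply Rle_div_l; lra. }
      apply Rmult_le_compat.
      -- apply Rmult_le_pos; apply Rabs_pos.
      -- apply Rabs_pos.
      -- apply Rle_trans with (3 * M * x * Rabs (b / sin (b * x))).
         { apply Rmult_le_compat_r; [apply Rabs_pos|exact X']. }
         replace (9 * M * b) with (3 * M * (3 * b)) by ring.
         rewrite Rmult_assoc, (Rmult_comm x). apply Rmult_le_compat_l; lra.
      -- apply Rabs_le, COS_bound.
- assert (Hsum : forall n, is_RInt (fun x => phi x *
      sum_n (fun k => 2 * cos ((2 * INR k + 1) * (b * x))) n) 0 1 (sum_n (fun k => 2 * I k) n)).
  { induction n as [|n IH].
    - rewrite sum_O. apply (is_RInt_ext (fun x => 2 * (phi x * cos ((2 * INR 0 + 1) * (b * x))))).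
      { intros x _. rewrite sum_O. eqR. ring. }
      apply (is_RInt_scal (V := R_NormedModule)), HI.
    - rewrite sum_Sn_R.
      apply (is_RInt_ext (fun x => phi x * sum_n (fun k => 2 * cos ((2 * INR k + 1) * (b * x))) n
         + 2 * (phi x * cos ((2 * INR (S n) + 1) * (b * x))))).
      { intros x _. rewrite sum_Sn_R. eqR. ring. }
      apply (is_RInt_plus (V := R_NormedModule)); [exact IH|].
      apply (is_RInt_scal (V := R_NormedModule)), HI. }
  assert (Hb : forall n, Rabs (sum_n (fun k => 2 * I k) n - phi 0) <= K * / (INR n + 1)).
  { intros n. replace (K * / (INR n + 1)) with (K / INR (n + 1))
      by (now rewrite plus_INR).
    apply HK; [lia|].
    apply (is_RInt_ext (fun x => phi x * sum_n (fun k => 2 * cos ((2 * INR k + 1) * (b * x))) n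
       - phi 0 * (cos (b * x) * sum_n (fun k => 2 * cos ((2 * INR k + 1) * (b * x))) n))).
    - intros x. rewrite Rmin_left, Rmax_right by lra. intros Hx.
      assert (E2 : INR (n + 1) * PI * x = 2 * INR (n + 1) * (b * x)).
      { unfold b. field. }
      rewrite E2.
      rewrite <- dirichlet_kernel. unfold g.
      replace (phi x) with (psi x + phi 0 * cos (b * x) + c * sin (b * x)) by (unfold psi; ring).
      eqR. field. apply snz; lra.
    - replace (sum_n (fun k => 2 * I k) n - phi 0) with
        (sum_n (fun k => 2 * I k) n - phi 0 * 1) by ring.
      apply (is_RInt_minus (V := R_NormedModule)); [apply Hsum|].
      apply (is_RInt_scal (V := R_NormedModule)), dirichlet_kernel_cos_integral. }
  assert (L0 : is_lim_seq (fun n => K * / (INR n + 1)) 0).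
  { replace (Finite 0) with (Rbar_mult K 0) by (simpl; f_equal; ring).
    apply is_lim_seq_scal_l. apply (is_lim_seq_inv _ p_infty); [|easy].
    apply (is_lim_seq_ext (fun n => INR (S n))); [intros; apply S_INR|].
    apply -> is_lim_seq_incr_1. apply is_lim_seq_INR. }
  assert (L1 : is_lim_seq (fun n => sum_n (fun k => 2 * I k) n) (phi 0)).
  { apply (is_lim_seq_ext (fun n => (sum_n (fun k => 2 * I k) n - phi 0) + phi 0)); [intros; ring|].
    replace (Finite (phi 0)) with (Rbar_plus 0 (phi 0)) by (simpl; f_equal; ring).
    apply is_lim_seq_plus'; [|apply is_lim_seq_const].
    apply is_lim_seq_abs_0, is_lim_seq_le_le with (fun _ => 0) (fun n => K * / (INR n + 1)); auto.
    - intros n. split; [apply Rabs_pos|apply Hb].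
    - apply is_lim_seq_const. }
  exact L1.
Qed.

Definition odd_half_pi (k : nat) : R := (2 * INR k + 1) * (PI / 2).

Lemma odd_half_pi_ge_1 (k : nat) : 1 <= odd_half_pi k.
Proof. unfold odd_half_pi. assert (H := PI2_1). assert (K := pos_INR k). nra. Qed.

Lemma sin_odd_half_pi (k : nat) : sin (odd_half_pi k) = (-1) ^ k.
Proof.
induction k as [|k IH].
- unfold odd_half_pi. simpl. rewrite Rmult_0_r, Rplus_0_l, Rmult_1_l. apply sin_PI2.
- replace (odd_half_pi (S k)) with (odd_half_pi k + PI)
    by (unfold odd_half_pi; rewrite S_INR; field).
  rewrite neg_sin, IH. simpl. ring.
Qed.

Lemma cos_odd_half_pi (k : nat) : cos (odd_half_pi k) = 0.
Proof.
induction k as [|k IH].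
- unfold odd_half_pi. simpl. rewrite Rmult_0_r, Rplus_0_l, Rmult_1_l. apply cos_PI2.
- replace (odd_half_pi (S k)) with (odd_half_pi k + PI)
    by (unfold odd_half_pi; rewrite S_INR; field).
  rewrite neg_cos, IH. ring.
Qed.

Lemma cosh_pos (y : R) : 0 < cosh y.
Proof. unfold cosh. assert (H := exp_pos y). assert (K := exp_pos (- y)). lra. Qed.

(** The odd cosine series of [sinh (y * (1 - x))] at [x = 0], divided by [cosh y]. The boundary term
    at [x = 1] vanishes because [sinh 0 = 0] and [cos (odd_half_pi k) = 0]. *)
Lemma tanh_series (y : R) :
  is_series (fun k => 2 * y / (y ^ 2 + odd_half_pi k ^ 2)) (sinh y / cosh y).
Proof.
assert (C := cosh_pos y).
apply (is_series_ext (fun k => / cosh y *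
  (2 * (y * cosh y / (y ^ 2 + odd_half_pi k ^ 2))))).
{ intros k. eqR. field. assert (W := odd_half_pi_ge_1 k). split; nra. }
replace (sinh y / cosh y) with (/ cosh y * sinh (y * (1 - 0)))
  by (replace (y * (1 - 0)) with y by ring; unfold Rdiv; ring).
apply (is_series_scal (V := R_NormedModule) (/ cosh y)).
apply odd_cosine_series with (phi := fun x => sinh (y * (1 - x)))
  (phi' := fun x => - y * cosh (y * (1 - x)))
  (phi'' := fun x => y ^ 2 * sinh (y * (1 - x))).
- intros x. unfold sinh, cosh. auto_derive; [exact I|]. unfold Rminus. field.
- intros x. unfold sinh, cosh. auto_derive; [exact I|]. unfold Rminus. field.
- intros x. apply (ex_derive_continuous (fun x => y ^ 2 * sinh (y * (1 - x)))).
  unfold sinh. auto_derive. exact I.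
- intros k. set (w := odd_half_pi k).
  assert (W := odd_half_pi_ge_1 k). fold w in W.
  assert (D : y ^ 2 + w ^ 2 <> 0) by nra.
  apply (is_RInt_ext (fun x => sinh (y * (1 - x)) * cos (w * x))).
  { intros x _. unfold w, odd_half_pi. eqR. do 2 f_equal. ring. }
  evar_last.
  + apply (is_RInt_derive (fun x => (- y * cosh (y * (1 - x)) * cos (w * x) +
       w * sinh (y * (1 - x)) * sin (w * x)) / (y ^ 2 + w ^ 2))).
    * intros x _. unfold sinh, cosh. auto_derive; [exact I|]. unfold Rminus. field. nra.
    * intros x _. apply (ex_derive_continuous (fun x => sinh (y * (1 - x)) * cos (w * x))).
      unfold sinh. auto_derive. exact I.
  + unfold minus, plus, opp; simpl.
    rewrite !Rmult_1_r, !Rmult_0_r, Rminus_0_r, Rminus_diag, Rmult_0_r, Rmult_1_r.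
    unfold w at 1 3. rewrite cos_odd_half_pi. fold w.
    rewrite sin_0, cos_0, sinh_0. eqR. field. nra.
Qed.

(** The odd cosine series of [cosh (y * x)] at [x = 0], divided by [cosh y]. Only the boundary term
    at [x = 1] survives, and [sin (odd_half_pi k)] supplies the sign. *)
Lemma sech_series (y : R) :
  is_series (fun k => (-1) ^ k * (2 * odd_half_pi k / (y ^ 2 + odd_half_pi k ^ 2))) (/ cosh y).
Proof.
assert (C := cosh_pos y).
apply (is_series_ext (fun k => / cosh y *
  (2 * ((-1) ^ k * odd_half_pi k * cosh y / (y ^ 2 + odd_half_pi k ^ 2))))).
{ intros k. eqR. field. assert (W := odd_half_pi_ge_1 k). split; nra. }
evar_last; [|apply Rmult_1_r]. rewrite <- cosh_0, <- (Rmult_0_r y) at 1.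
apply (is_series_scal (V := R_NormedModule) (/ cosh y)).
apply odd_cosine_series with (phi := fun x => cosh (y * x))
  (phi' := fun x => y * sinh (y * x))
  (phi'' := fun x => y ^ 2 * cosh (y * x)).
- intros x. unfold sinh, cosh. auto_derive; [exact I|]. field.
- intros x. unfold sinh, cosh. auto_derive; [exact I|]. field.
- intros x. apply (ex_derive_continuous (fun x => y ^ 2 * cosh (y * x))).
  unfold cosh. auto_derive. exact I.
- intros k. set (w := odd_half_pi k).
  assert (W := odd_half_pi_ge_1 k). fold w in W.
  assert (D : y ^ 2 + w ^ 2 <> 0) by nra.
  apply (is_RInt_ext (fun x => cosh (y * x) * cos (w * x))).
  { intros x _. unfold w, odd_half_pi. eqR. do 2 f_equal. ring. }
  evar_last.
  + apply (is_RInt_derive (fun x => (y * sinh (y * x) * cos (w * x) +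
       w * cosh (y * x) * sin (w * x)) / (y ^ 2 + w ^ 2))).
    * intros x _. unfold sinh, cosh. auto_derive; [exact I|]. field. nra.
    * intros x _. apply (ex_derive_continuous (fun x => cosh (y * x) * cos (w * x))).
      unfold cosh. auto_derive. exact I.
  + unfold minus, plus, opp; simpl.
    rewrite !Rmult_1_r, !Rmult_0_r.
    unfold w at 1 3. rewrite cos_odd_half_pi, sin_odd_half_pi. fold w.
    rewrite sin_0, cos_0, sinh_0. eqR. field. nra.
Qed.

(** * Derivative chains and repeated integration by parts *)

(** A function [Q 0] given together with all its derivatives, which avoids iterated [Derive] and its
    differentiability side conditions. *)
Definition derivative_chain (Q : nat -> R -> R) : Prop :=
  forall i y, is_derive (Q i) y (Q (S i) y).

Lemma derivative_chain_opp (Q : nat -> R -> R) :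
  derivative_chain Q -> derivative_chain (fun i y => - Q i y).
Proof. intros H i y. apply (is_derive_opp (V := R_NormedModule)), H. Qed.

Lemma derivative_chain_continuous (Q : nat -> R -> R) (i : nat) (y : R) :
  derivative_chain Q -> continuous (Q i) y.
Proof. intros H. apply (ex_derive_continuous (Q i)). eexists. apply H. Qed.

Lemma is_derive_pow_fact (m : R) (k : nat) (x : R) :
  is_derive (fun y => m * (y ^ S k / INR (fact (S k)))) x (m * (x ^ k / INR (fact k))).
Proof.
apply (is_derive_ext (fun y => m / INR (fact (S k)) * y ^ S k)).
{ intros t. eqR. field. apply INR_fact_neq_0. }
evar_last.
- apply (is_derive_scal (fun y => y ^ S k)).
  apply (is_derive_pow (fun y => y) (S k) x 1). apply (is_derive_id (K := R_AbsRing)).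
- rewrite fact_simpl, mult_INR, Nat.pred_succ. eqR. field.
  split; [apply INR_fact_neq_0|apply not_0_INR; lia].
Qed.

(** Taylor's inequality at a zero of order [k]. By induction on the shifted chain,
    [Q 0 y - m * y^k / k!] has a non-negative derivative, and it vanishes at 0 when [k > 0]. *)
Lemma derivative_chain_lower (k : nat) (Q : nat -> R -> R) (m d : R) :
  derivative_chain Q -> (forall j, (j < k)%nat -> Q j 0 = 0) ->
  (forall y, 0 <= y <= d -> m <= Q k y) ->
  forall y, 0 <= y <= d -> m * (y ^ k / INR (fact k)) <= Q 0%nat y.
Proof.
revert Q. induction k as [|k IH]; intros Q HQ H0 Hm y Hy.
- simpl. replace (m * (1 / 1)) with m by field. now apply Hm.
- assert (F : 0 < INR (fact k)) by apply INR_fact_lt_0.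
  destruct (MVT_gen (fun y => Q 0%nat y - m * (y ^ S k / INR (fact (S k)))) 0 y
    (fun y => Q 1%nat y - m * (y ^ k / INR (fact k)))) as [c [Hc E]].
  + intros x _. apply (is_derive_minus (V := R_NormedModule)); [apply HQ|apply is_derive_pow_fact].
  + intros x _. apply derivable_continuous_pt. exists (Q 1%nat x - m * (x ^ k / INR (fact k))).
    apply is_derive_Reals.
    apply (is_derive_minus (V := R_NormedModule)); [apply HQ|apply is_derive_pow_fact].
  + rewrite H0 in E by lia. rewrite Rmin_left, Rmax_right in Hc by lra.
    assert (L := IH (fun i => Q (S i)) (fun i => HQ (S i)) (fun j Hj => H0 (S j) ltac:(lia)) Hm c ltac:(lra)).
    simpl pow in E. rewrite Rmult_0_l in E. unfold Rdiv in E at 2. rewrite Rmult_0_l, Rmult_0_r, !Rminus_0_r in E.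
    simpl pow. nra.
Qed.

Lemma derivative_chain_bound (k : nat) (Q : nat -> R -> R) (M : R) :
  derivative_chain Q -> (forall j, (j < k)%nat -> Q j 0 = 0) ->
  (forall y, 0 <= y <= 1 -> Rabs (Q k y) <= M) ->
  forall y, 0 <= y <= 1 -> Rabs (Q 0%nat y) <= M * y ^ k.
Proof.
intros HQ H0 HM y Hy.
assert (M0 : 0 <= M) by (apply Rle_trans with (2 := HM y Hy), Rabs_pos).
assert (P : 0 <= y ^ k) by (apply pow_le; lra).
assert (F : 1 <= INR (fact k)) by (change 1 with (INR 1); apply le_INR, lt_O_fact).
assert (B : y ^ k / INR (fact k) <= y ^ k) by (apply Rle_div_l; nra).
assert (L1 := derivative_chain_lower k Q (- M) 1 HQ H0
  ltac:(intros z Hz; apply (proj1 (Rabs_le_between _ _) (HM z Hz))) y Hy).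
assert (L2 : - M * (y ^ k / INR (fact k)) <= - Q 0%nat y).
{ apply (derivative_chain_lower k (fun i z => - Q i z) (- M) 1); auto.
  - now apply derivative_chain_opp.
  - intros j Hj. rewrite H0 by exact Hj. ring.
  - intros z Hz. assert (K := proj1 (Rabs_le_between _ _) (HM z Hz)). lra. }
apply Rabs_le. nra.
Qed.

(** If [Q i 0] with [i <= r] were the first nonzero value, say positive, then [Q 0 y] would be at
    least a positive multiple of [y^i] near 0, against the bound of order [y^(r + 1)]. The negative
    case uses the opposite chain. *)
Lemma derivative_chain_vanish (r : nat) (Q : nat -> R -> R) (C : R) :
  derivative_chain Q -> (forall y, 0 < y <= 1 -> Rabs (Q 0%nat y) <= C * y ^ (r + 1)) ->
  forall i, (i <= r)%nat -> Q i 0 = 0.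
Proof.
assert (K : forall i Q, derivative_chain Q ->
  (forall y, 0 < y <= 1 -> Rabs (Q 0%nat y) <= C * y ^ (r + 1)) ->
  (i <= r)%nat -> (forall j, (j < i)%nat -> Q j 0 = 0) -> Q i 0 <= 0).
{ clear Q. intros i Q HQ HC Hi H0. apply Rnot_lt_le. intros Hpos.
  assert (Hc := derivative_chain_continuous Q i 0 HQ).
  destruct (Hc (fun z => Q i 0 / 2 < z)) as [e He].
  { exists (mkposreal (Q i 0 / 2) ltac:(lra)). intros z Hz. apply ball_Rabs, Rabs_def2 in Hz.
    simpl in Hz. lra. }
  set (C' := Rabs C + 1). assert (HC' : 0 < C') by (unfold C'; assert (X := Rabs_pos C); lra).
  set (a := Q i 0 / 2 / INR (fact i)).
  assert (Ha : 0 < a).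
  { unfold a. apply Rdiv_lt_0_compat; [lra|apply INR_fact_lt_0]. }
  (* Small enough that [Q i] stays above half its value at 0 on [[0, y]], and that
     [C' * y <= a / 2]. *)
  set (y := Rmin (Rmin 1 (e / 2)) (a / 2 / C')).
  assert (e0 := cond_pos e).
  assert (Y0 : 0 < y).
  { unfold y. repeat apply Rmin_case; try lra. apply Rdiv_lt_0_compat; lra. }
  assert (Y1 : y <= 1) by (unfold y; eapply Rle_trans; [apply Rmin_l|apply Rmin_l]).
  assert (Y2 : y <= e / 2) by (unfold y; eapply Rle_trans; [apply Rmin_l|apply Rmin_r]).
  assert (Y3 : y <= a / 2 / C') by (unfold y; apply Rmin_r).
  apply Rle_div_r in Y3; [|exact HC'].
  assert (L := derivative_chain_lower i Q (Q i 0 / 2) y HQ H0).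
  specialize (L ltac:(intros z Hz; apply Rlt_le, He; unfold ball; simpl;
    unfold AbsRing_ball, abs, minus, plus, opp; simpl; rewrite Ropp_0, Rplus_0_r, Rabs_pos_eq; lra) y ltac:(lra)).
  assert (U := HC y ltac:(lra)). assert (U' := Rle_trans _ _ _ (Rle_abs _) U).
  assert (P : 0 < y ^ i) by now apply pow_lt.
  assert (Q1 : y ^ (r + 1) <= y ^ i * y).
  { replace (r + 1)%nat with (i + 1 + (r - i))%nat by lia. rewrite pow_add, (pow_add y i 1), pow_1.
    assert (W : y ^ (r - i) <= 1) by (rewrite <- (pow1 (r - i)); apply pow_incr; lra).
    assert (0 < y ^ i * y) by nra. nra. }
  assert (Q2 : 0 < y ^ (r + 1)) by now apply pow_lt.
  assert (Q3 : C <= C') by (unfold C'; assert (X := Rle_abs C); lra).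
  assert (E : Q i 0 / 2 * (y ^ i / INR (fact i)) = a * y ^ i) by (unfold a; field; apply INR_fact_neq_0).
  rewrite E in L. nra. }
intros HQ HC i. induction i as [i IH] using (well_founded_induction lt_wf). intros Hi.
assert (H0 : forall j, (j < i)%nat -> Q j 0 = 0) by (intros j Hj; apply IH; lia).
apply Rle_antisym.
- now apply K.
- apply Ropp_le_cancel. rewrite Ropp_0. apply (K i (fun i y => - Q i y)); auto.
  + now apply derivative_chain_opp.
  + intros y Hy. rewrite Rabs_Ropp. now apply HC.
  + intros j Hj. rewrite H0 by exact Hj. ring.
Qed.

(* The boundary terms of [m] integrations by parts of [Q r y / y]. *)
Fixpoint by_parts_sum (Q : nat -> R -> R) (r m : nat) (y : R) : R :=
  match m with
  | O => 0
  | S j => by_parts_sum Q r j y + INR (fact j) * (Q (r - 1 - j)%nat y / y ^ S j)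
  end.

(** The derivative telescopes: the negative part from the term [j] cancels the positive part from
    the term [j + 1]. *)
Lemma is_derive_by_parts_sum (Q : nat -> R -> R) (r m : nat) (y : R) :
  derivative_chain Q -> (m <= r)%nat -> 0 < y ->
  is_derive (by_parts_sum Q r m) y
    (Q r y / y - INR (fact m) * (Q (r - m)%nat y / y ^ S m)).
Proof.
intros HQ Hm Hy. induction m as [|m IH].
- replace (Q r y / y - INR (fact 0) * (Q (r - 0)%nat y / y ^ 1)) with 0.
  + apply (is_derive_const (V := R_NormedModule) 0).
  + rewrite Nat.sub_0_r. simpl. field. lra.
- evar_last.
  + apply (is_derive_plus (V := R_NormedModule) (by_parts_sum Q r m)); [apply IH; lia|].
    apply (is_derive_scal (fun y => Q (r - 1 - m)%nat y / y ^ S m)).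
    apply is_derive_div; [apply HQ| |apply pow_nonzero; lra].
    apply (is_derive_pow (fun y => y) (S m) y 1). apply (is_derive_id (K := R_AbsRing)).
  + replace (S (r - 1 - m)) with (r - m)%nat by lia.
    replace (r - S m)%nat with (r - 1 - m)%nat by lia.
    rewrite fact_simpl, mult_INR, Nat.pred_succ. eqR. rewrite <- !tech_pow_Rmult.
    assert (Y : y ^ m <> 0) by (apply pow_nonzero; lra).
    field. split; [exact Y|lra].
Qed.

(** All [Q i 0] with [i <= r] vanish, so [Q (r - 1 - j)] is of order [y^(j + 2)] and each boundary
    term is of order [y]. *)
Lemma by_parts_sum_lim_0 (Q : nat -> R -> R) (r m : nat) (C : R) :
  derivative_chain Q -> (forall y, 0 < y <= 1 -> Rabs (Q 0%nat y) <= C * y ^ (r + 1)) ->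
  (m <= r)%nat -> filterlim (by_parts_sum Q r m) (at_right 0) (locally 0).
Proof.
intros HQ HC Hm.
assert (V := derivative_chain_vanish r Q C HQ HC).
destruct (continuous_bounded (Q (r + 1)%nat) 0 1) as [M [M0 HM]]; [lra| |].
{ intros x _. now apply derivative_chain_continuous. }
assert (B : exists K, forall y, 0 < y <= 1 -> Rabs (by_parts_sum Q r m y) <= K * y).
{ induction m as [|m IH].
  - exists 0. intros y Hy. simpl. rewrite Rabs_R0. lra.
  - destruct IH as [K HK]; [lia|]. exists (K + INR (fact m) * M). intros y Hy.
    simpl by_parts_sum. apply Rle_trans with (1 := Rabs_triang _ _).
    rewrite Rmult_plus_distr_r. apply Rplus_le_compat; [now apply HK|].
    rewrite Rabs_mult, Rabs_pos_eq, Rmult_assoc by apply pos_INR.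
    apply Rmult_le_compat_l; [apply pos_INR|].
    assert (Y : 0 < y ^ S m) by (apply pow_lt; lra).
    unfold Rdiv. rewrite Rabs_mult, Rabs_inv, (Rabs_pos_eq (y * y ^ m)) by (simpl in Y; lra).
    apply Rle_div_l; [exact Y|].
    replace (M * y * (y * y ^ m)) with (M * y ^ (m + 2)) by (rewrite pow_add; simpl; ring).
    replace (r - 1 - m)%nat with (r - 1 - m + 0)%nat at 1 by lia.
    apply (derivative_chain_bound (m + 2) (fun i => Q (r - 1 - m + i)%nat) M).
    + intros i z. replace (r - 1 - m + S i)%nat with (S (r - 1 - m + i)) by lia. apply HQ.
    + intros j Hj. apply V. lia.
    + intros z Hz. replace (r - 1 - m + (m + 2))%nat with (r + 1)%nat by lia. now apply HM.
    + lra. }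
destruct B as [K HK].
intros P [e He].
assert (D : 0 < Rmin 1 (e / (Rabs K + 1))).
{ assert (X := Rabs_pos K). apply Rmin_case; [lra|]. apply Rdiv_lt_0_compat; [apply cond_pos|lra]. }
exists (mkposreal _ D). intros y Hy Hy0. apply ball_Rabs in Hy. simpl in Hy.
rewrite Rminus_0_r, Rabs_pos_eq in Hy by lra. apply He.
assert (X := Rabs_pos K).
assert (Y1 := Rlt_le_trans _ _ _ Hy (Rmin_l _ _)).
assert (Y2 := Rlt_le_trans _ _ _ Hy (Rmin_r _ _)). apply Rlt_div_r in Y2; [|lra].
change (Rabs (by_parts_sum Q r m y - 0) < e). rewrite Rminus_0_r.
apply Rle_lt_trans with (1 := HK y ltac:(lra)).
assert (X' := Rle_abs K). nra.
Qed.

(** The hypothesis says that [Q i] grows at most like [y^(r - i - 1)], as does a polynomial of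
    degree less than [r] plus a function with bounded derivatives; each boundary term is then of
    order [1 / y]. *)
Lemma by_parts_sum_lim_infty (Q : nat -> R -> R) (r m : nat) :
  (forall i, (i < r)%nat -> exists K, forall y, 1 <= y -> Rabs (Q i y) * y <= K * y ^ (r - i)) ->
  (m <= r)%nat -> is_lim (by_parts_sum Q r m) p_infty 0.
Proof.
intros HQ Hm.
assert (B : exists K, forall y, 1 <= y -> Rabs (by_parts_sum Q r m y) <= K * / y).
{ induction m as [|m IH].
  - exists 0. intros y Hy. simpl. rewrite Rabs_R0. lra.
  - destruct IH as [K HK]; [lia|]. destruct (HQ (r - 1 - m)%nat ltac:(lia)) as [K' HK'].
    exists (K + INR (fact m) * K'). intros y Hy.
    simpl by_parts_sum. apply Rle_trans with (1 := Rabs_triang _ _).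
    rewrite Rmult_plus_distr_r. apply Rplus_le_compat; [now apply HK|].
    rewrite Rabs_mult, Rabs_pos_eq, Rmult_assoc by apply pos_INR.
    apply Rmult_le_compat_l; [apply pos_INR|].
    assert (Y : 0 < y ^ S m) by (apply pow_lt; lra).
    unfold Rdiv. rewrite Rabs_mult, Rabs_inv, (Rabs_pos_eq (y * y ^ m)) by (simpl in Y; lra).
    apply Rle_div_l; [exact Y|].
    apply (Rmult_le_reg_r y); [lra|].
    replace (K' * / y * (y * y ^ m) * y) with (K' * y ^ S m) by (simpl; field; lra).
    specialize (HK' y Hy). now replace (r - (r - 1 - m))%nat with (S m) in HK' by lia. }
destruct B as [K HK].
apply is_lim_le_le_loc with (fun y => - (K * / y)) (fun y => K * / y).
- exists 1. intros y Hy. apply Rabs_le_between, HK. lra.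
- replace (Finite 0) with (Rbar_opp (Rbar_mult K 0)) by (simpl; f_equal; ring).
  apply is_lim_opp, is_lim_scal_l. apply (is_lim_inv (fun y => y) p_infty p_infty); [apply is_lim_id|easy].
- replace (Finite 0) with (Rbar_mult K 0) by (simpl; f_equal; ring).
  apply is_lim_scal_l. apply (is_lim_inv (fun y => y) p_infty p_infty); [apply is_lim_id|easy].
Qed.

(** The improper integral over [y > 0], recorded by a primitive normalised to the limit 0 at [0+].
    In this form linearity is immediate and a change of variable is a composition. *)
Definition half_line_integral (f : R -> R) (L : R) : Prop :=
  exists A : R -> R,
    (forall y, 0 < y -> is_derive A y (f y)) /\
    filterlim A (at_right 0) (locally 0) /\
    is_lim A p_infty L.

(** The primitive consists of the boundary terms, which vanish at both ends, and of [r!] times the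
    primitive [J] of what remains after [r] integrations by parts. *)
Lemma half_line_integral_by_parts (Q : nat -> R -> R) (r : nat) (C : R) (J : R -> R) (L : R) :
  derivative_chain Q ->
  (forall y, 0 < y <= 1 -> Rabs (Q 0%nat y) <= C * y ^ (r + 1)) ->
  (forall i, (i < r)%nat -> exists K, forall y, 1 <= y -> Rabs (Q i y) * y <= K * y ^ (r - i)) ->
  (forall y, 0 < y -> is_derive J y (Q 0%nat y / y ^ (r + 1))) ->
  filterlim J (at_right 0) (locally 0) -> is_lim J p_infty L ->
  half_line_integral (fun y => Q r y / y) (INR (fact r) * L).
Proof.
intros HQ H0 H1 dJ J0 J1.
exists (fun y => by_parts_sum Q r r y + INR (fact r) * J y). split; [|split].
- intros y Hy. evar_last.
  + apply (is_derive_plus (V := R_NormedModule) (by_parts_sum Q r r)).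
    * apply (is_derive_by_parts_sum Q r r y HQ); [lia|exact Hy].
    * apply (is_derive_scal J), dJ, Hy.
  + rewrite Nat.sub_diag, Nat.add_1_r. eqR. simpl pow. ring.
- replace 0 with (0 + INR (fact r) * 0) at 2 by ring.
  apply (filterlim_comp_2 (G := locally 0) (H := locally (INR (fact r) * 0)) (by_parts_sum Q r r) (fun y => INR (fact r) * J y) Rplus).
  + apply (by_parts_sum_lim_0 Q r r C HQ H0). lia.
  + apply (filterlim_comp _ _ _ J (fun z => INR (fact r) * z) _ (locally 0) _ J0).
    apply (continuous_scal_r (K := R_AbsRing) (V := R_NormedModule) (INR (fact r)) (fun z => z)). apply continuous_id.
  + apply (filterlim_plus (V := R_NormedModule)).
- replace (Finite (INR (fact r) * L)) with (Rbar_plus 0 (Rbar_mult (INR (fact r)) L))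
    by (simpl; f_equal; ring).
  apply is_lim_plus'.
  + now apply by_parts_sum_lim_infty.
  + now apply (is_lim_scal_l J (INR (fact r)) p_infty L).
Qed.

Lemma half_line_integral_ext (f g : R -> R) (L : R) :
  (forall y, 0 < y -> f y = g y) -> half_line_integral f L -> half_line_integral g L.
Proof.
intros E [A [H1 [H2 H3]]]. exists A. split; [|now split].
intros y Hy. rewrite <- E by exact Hy. now apply H1.
Qed.

Lemma half_line_integral_lin (f g : R -> R) (a b K L : R) :
  half_line_integral f K -> half_line_integral g L ->
  half_line_integral (fun y => a * f y + b * g y) (a * K + b * L).
Proof.
intros [A [A1 [A2 A3]]] [B [B1 [B2 B3]]].
exists (fun y => a * A y + b * B y). split; [|split].
- intros y Hy. apply (is_derive_plus (V := R_NormedModule) (fun y => a * A y));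
    [now apply (is_derive_scal A), A1 | now apply (is_derive_scal B), B1].
- replace 0 with (a * 0 + b * 0) at 2 by ring.
  apply (filterlim_comp_2 (G := locally (a * 0)) (H := locally (b * 0)) (fun y => a * A y) (fun y => b * B y) Rplus).
  + apply (filterlim_comp _ _ _ A (fun z => a * z) _ (locally 0) _ A2).
    apply (continuous_scal_r (K := R_AbsRing) (V := R_NormedModule) a (fun z => z)). apply continuous_id.
  + apply (filterlim_comp _ _ _ B (fun z => b * z) _ (locally 0) _ B2).
    apply (continuous_scal_r (K := R_AbsRing) (V := R_NormedModule) b (fun z => z)). apply continuous_id.
  + apply (filterlim_plus (V := R_NormedModule)).
- apply is_lim_plus'.
  + now apply (is_lim_scal_l A a p_infty K).
  + now apply (is_lim_scal_l B b p_infty L).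
Qed.

(** * Series over the poles and their primitives *)

Lemma odd_half_pi_pow_ge_1 (k r : nat) : 1 <= odd_half_pi k ^ r.
Proof. apply pow_R1_Rle, odd_half_pi_ge_1. Qed.

Lemma ex_series_odd_half_pi (r : nat) :
  (2 <= r)%nat -> ex_series (fun k => / odd_half_pi k ^ r).
Proof.
intros Hr.
(* The dominating series is the partial fraction series of tanh at [y = 1], already known to
   converge. *)
apply (ex_series_le (V := R_CompleteNormedModule) _ (fun k => 2 * 1 / (1 ^ 2 + odd_half_pi k ^ 2))).
- intros k. assert (W := odd_half_pi_ge_1 k). assert (W2 := odd_half_pi_pow_ge_1 k r).
  change (Rabs (/ odd_half_pi k ^ r) <= 2 * 1 / (1 ^ 2 + odd_half_pi k ^ 2)).
  rewrite Rabs_pos_eq by (apply Rlt_le, Rinv_0_lt_compat; lra).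
  apply Rle_trans with (/ odd_half_pi k ^ 2).
  + apply Rinv_le_contravar; [nra|]. apply Rle_pow; assumption.
  + apply Rle_div_r; [nra|]. apply (Rmult_le_reg_l (odd_half_pi k ^ 2)); [nra|].
    rewrite <- Rmult_assoc, Rinv_r by nra. nra.
- eexists. apply tanh_series.
Qed.

Lemma ex_series_dominated (a b : nat -> R) :
  (forall k, Rabs (a k) <= b k) -> ex_series b -> ex_series a.
Proof. intros H. now apply (ex_series_le (V := R_CompleteNormedModule)). Qed.

Lemma Series_abs_le (a b : nat -> R) :
  (forall k, Rabs (a k) <= b k) -> ex_series b -> Rabs (Series a) <= Series b.
Proof.
intros H Hb.
assert (Ha : ex_series (fun k => Rabs (a k))).
{ apply ex_series_dominated with b; [|exact Hb]. intros k. now rewrite Rabs_Rabsolu. }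
apply Rle_trans with (1 := Series_Rabs a Ha).
apply Series_le; [|exact Hb]. intros k. split; [apply Rabs_pos|apply H].
Qed.

(** Tannery's theorem: a tail bounded uniformly in [y], and a finite sum of functions tending to
    0. *)
Lemma is_lim_Series_dominated (f : nat -> R -> R) (b : nat -> R) :
  ex_series b -> (forall k y, 0 < y -> Rabs (f k y) <= b k) ->
  (forall k, is_lim (f k) p_infty 0) ->
  is_lim (fun y => Series (fun k => f k y)) p_infty 0.
Proof.
intros [lb Hb] Hf H0.
assert (Hs : forall N, is_lim (fun y => sum_n (fun k => f k y) N) p_infty 0).
{ induction N as [|N IH].
  - apply (is_lim_ext (f 0%nat)); [|apply H0]. intros y. now rewrite sum_O.
  - apply (is_lim_ext (fun y => sum_n (fun k => f k y) N + f (S N) y)).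
    { intros y. now rewrite sum_Sn_R. }
    replace (Finite 0) with (Rbar_plus 0 0) by (simpl; f_equal; ring).
    apply is_lim_plus'; [exact IH|apply H0]. }
apply is_lim_spec. intros e.
assert (E2 : 0 < e / 2) by (apply is_pos_div_2).
assert (Hb' : is_lim_seq (sum_n b) lb) by exact Hb. apply is_lim_seq_spec in Hb'.
destruct (Hb' (mkposreal _ E2)) as [N HN]. simpl in HN.
generalize (Hs N). intros HsN. apply is_lim_spec in HsN.
destruct (HsN (mkposreal _ E2)) as [M HM]. simpl in HM.
exists (Rmax M 0). intros y Hy.
assert (Y1 : M < y) by (apply Rle_lt_trans with (2 := Hy), Rmax_l).
assert (Y2 : 0 < y) by (apply Rle_lt_trans with (2 := Hy), Rmax_r).
specialize (HM y Y1). specialize (HN N (le_n N)).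
assert (Eb : ex_series b) by now exists lb.
assert (Ef : ex_series (fun k => f k y)).
{ apply ex_series_dominated with b; [|exact Eb]. intros k. now apply Hf. }
rewrite Rminus_0_r in *.
rewrite (Series_incr_n (fun k => f k y) (S N)) by (lia || exact Ef).
simpl pred. rewrite <- sum_n_Reals.
apply Rle_lt_trans with (1 := Rabs_triang _ _).
assert (T : Rabs (Series (fun k => f (S N + k)%nat y)) < e / 2); [|lra].
apply Rle_lt_trans with (Series (fun k => b (S N + k)%nat)).
- apply Series_abs_le; [intros k; now apply Hf|]. now apply -> (ex_series_incr_n b (S N)).
- assert (B := Series_incr_n b (S N) ltac:(lia) Eb). simpl pred in B.
  rewrite <- sum_n_Reals in B. rewrite (is_series_unique _ _ Hb) in B.
  apply Rabs_def2 in HN. lra.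
Qed.

(** Quadratic error estimates can be summed over [k]; this gives termwise differentiation of
    [pole_tail_primitive]. *)
Lemma is_derive_quadratic (F : R -> R) (y l B : R) :
  (forall z, Rabs (F z - F y - (z - y) * l) <= B * (z - y) ^ 2) -> is_derive F y l.
Proof.
intros H. apply is_derive_Reals. intros e He.
assert (P : 0 < e / (Rabs B + 1)).
{ apply Rdiv_lt_0_compat; [exact He|]. assert (X := Rabs_pos B). lra. }
exists (mkposreal _ P). intros h Hh Hh'. simpl in Hh'.
assert (X := Rabs_pos B). apply Rlt_div_r in Hh'; [|lra].
specialize (H (y + h)). replace (y + h - y) with h in H by ring.
replace ((F (y + h) - F y) / h - l) with ((F (y + h) - F y - h * l) / h) by (field; exact Hh).
unfold Rdiv. rewrite Rabs_mult, Rabs_inv.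
assert (Hp := Rabs_pos_lt h Hh).
apply Rlt_div_l; [exact Hp|]. apply Rle_lt_trans with (1 := H).
rewrite <- pow2_abs. assert (X' := Rle_abs B). simpl. nra.
Qed.

(** The derivative [w / (t^2 + w^2)] of [atan (t / w)] is 1-Lipschitz for [w >= 1]: [w (y + t)] is
    at most the mean of [t^2 + w^2] and [y^2 + w^2], and that mean is at most their product, as both
    are at least 1. *)
Lemma atan_scaled_quadratic (w y z : R) :
  1 <= w ->
  Rabs (atan (z / w) - atan (y / w) - (z - y) * (w / (y ^ 2 + w ^ 2))) <= (z - y) ^ 2.
Proof.
intros Hw.
assert (D : forall t, is_derive (fun t => atan (t / w) - t * (w / (y ^ 2 + w ^ 2))) t
  (w / (t ^ 2 + w ^ 2) - w / (y ^ 2 + w ^ 2))).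
{ intros t. evar_last.
  - apply (is_derive_minus (V := R_NormedModule) (fun t => atan (t / w))).
    + apply (is_derive_comp (V := R_NormedModule) atan (fun t => t / w)).
      * apply is_derive_Reals, derivable_pt_lim_atan.
      * auto_derive; [exact I|reflexivity].
    + auto_derive; [exact I|reflexivity].
  - eqR. unfold Rsqr. field. repeat split; try nra. }
replace (atan (z / w) - atan (y / w) - (z - y) * (w / (y ^ 2 + w ^ 2))) with
  ((atan (z / w) - z * (w / (y ^ 2 + w ^ 2))) - (atan (y / w) - y * (w / (y ^ 2 + w ^ 2)))) by ring.
replace ((z - y) ^ 2) with (Rabs (z - y) * Rabs (z - y)) by (rewrite <- pow2_abs; simpl; ring).
apply Rabs_le_MVT with (f := fun t => atan (t / w) - t * (w / (y ^ 2 + w ^ 2)))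
  (f' := fun t => w / (t ^ 2 + w ^ 2) - w / (y ^ 2 + w ^ 2)); [intros; apply D|].
intros t Ht.
assert (T : Rabs (t - y) <= Rabs (z - y)).
{ revert Ht. unfold Rmin, Rmax. destruct (Rle_dec y z); intros Ht.
  - rewrite !Rabs_pos_eq; lra.
  - rewrite !Rabs_left1; lra. }
apply Rle_trans with (2 := T).
assert (A : 1 <= y ^ 2 + w ^ 2) by nra. assert (B : 1 <= t ^ 2 + w ^ 2) by nra.
replace (w / (t ^ 2 + w ^ 2) - w / (y ^ 2 + w ^ 2)) with
  (w * (y + t) / ((t ^ 2 + w ^ 2) * (y ^ 2 + w ^ 2)) * (y - t)) by (field; lra).
rewrite Rabs_mult, (Rabs_minus_sym t y). rewrite <- (Rmult_1_l (Rabs (y - t))) at 2.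
apply Rmult_le_compat_r; [apply Rabs_pos|].
assert (AB : 0 < (t ^ 2 + w ^ 2) * (y ^ 2 + w ^ 2)) by (apply Rmult_lt_0_compat; lra).
unfold Rdiv. rewrite Rabs_mult, Rabs_inv, (Rabs_pos_eq ((t ^ 2 + w ^ 2) * (y ^ 2 + w ^ 2))) by lra.
apply Rle_div_l; [exact AB|]. rewrite Rmult_1_l.
assert (U : Rabs (w * (y + t)) <= ((t ^ 2 + w ^ 2) + (y ^ 2 + w ^ 2)) / 2).
{ assert (S1 := pow2_ge_0 (w - y)). assert (S2 := pow2_ge_0 (w + y)).
  assert (S3 := pow2_ge_0 (w - t)). assert (S4 := pow2_ge_0 (w + t)).
  apply Rabs_le. split; lra. }
apply Rle_trans with (1 := U). nra.
Qed.

(** Serves both expansions: [s k = 1] for tanh and [s k = (-1)^k] for sech. *)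
Definition pole_tail (s : nat -> R) (r : nat) (y : R) : R :=
  Series (fun k => s k * (2 / (odd_half_pi k ^ r * (y ^ 2 + odd_half_pi k ^ 2)))).

Section PoleTail.

Context (s : nat -> R) (s_le_1 : forall k, Rabs (s k) <= 1).

Lemma pole_tail_term_bound (r k : nat) (y : R) :
  Rabs (s k * (2 / (odd_half_pi k ^ r * (y ^ 2 + odd_half_pi k ^ 2)))) <= 2 * / odd_half_pi k ^ 2.
Proof.
assert (W := odd_half_pi_ge_1 k). assert (W2 := odd_half_pi_pow_ge_1 k r).
assert (Y := pow2_ge_0 y).
assert (D : odd_half_pi k ^ 2 <= odd_half_pi k ^ r * (y ^ 2 + odd_half_pi k ^ 2)) by nra.
assert (D0 : 0 < odd_half_pi k ^ 2) by nra.
rewrite Rabs_mult. rewrite <- (Rmult_1_l (2 * _)).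
apply Rmult_le_compat; try apply Rabs_pos; [apply s_le_1|].
rewrite Rabs_pos_eq.
- apply Rmult_le_compat_l; [lra|]. now apply Rinv_le_contravar.
- apply Rlt_le, Rdiv_lt_0_compat; lra.
Qed.

Lemma ex_series_pole_bound : ex_series (fun k => 2 * / odd_half_pi k ^ 2).
Proof. apply (ex_series_scal (V := R_NormedModule) 2). now apply ex_series_odd_half_pi. Qed.

Lemma ex_series_pole_tail (r : nat) (y : R) :
  ex_series (fun k => s k * (2 / (odd_half_pi k ^ r * (y ^ 2 + odd_half_pi k ^ 2)))).
Proof.
apply ex_series_dominated with (2 := ex_series_pole_bound).
intros k. apply pole_tail_term_bound.
Qed.

(** Termwise, [1 / (y^2 + w^2) = 1 / w^2 - y^2 / (w^2 (y^2 + w^2))]. *)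
Lemma pole_tail_step (r : nat) (y : R) :
  pole_tail s r y = pole_tail s r 0 - y ^ 2 * pole_tail s (r + 2) y.
Proof.
unfold pole_tail. rewrite <- Series_scal_l, <- Series_minus.
- apply Series_ext. intros k. assert (W := odd_half_pi_ge_1 k).
  rewrite pow_add. assert (W2 := odd_half_pi_pow_ge_1 k r). field. repeat split; nra.
- apply ex_series_pole_tail.
- apply (ex_series_scal (V := R_NormedModule) (y ^ 2)), ex_series_pole_tail.
Qed.

Definition pole_tail_primitive (r : nat) (y : R) : R :=
  Series (fun k => s k * (2 / odd_half_pi k ^ (r + 1) * atan (y / odd_half_pi k))).

Lemma atan_abs_le_2 (x : R) : Rabs (atan x) <= 2.
Proof. assert (H := atan_bound x). assert (K := PI_4). apply Rabs_le. lra. Qed.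

Lemma pole_coef_bound (r k : nat) :
  (1 <= r)%nat -> Rabs (s k * (2 / odd_half_pi k ^ (r + 1))) <= 2 * / odd_half_pi k ^ 2.
Proof.
intros Hr. assert (B := pole_tail_term_bound (r - 1) k 0).
replace (odd_half_pi k ^ (r - 1) * (0 ^ 2 + odd_half_pi k ^ 2)) with (odd_half_pi k ^ (r + 1)) in B; [exact B|].
replace (r + 1)%nat with (r - 1 + 2)%nat by lia. rewrite pow_add. ring.
Qed.

Lemma ex_series_pole_tail_primitive (r : nat) (y : R) :
  (1 <= r)%nat ->
  ex_series (fun k => s k * (2 / odd_half_pi k ^ (r + 1) * atan (y / odd_half_pi k))).
Proof.
intros Hr. apply ex_series_dominated with (fun k => 2 * (2 * / odd_half_pi k ^ 2)).
- intros k. rewrite <- Rmult_assoc, Rabs_mult, Rmult_comm.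
  apply Rmult_le_compat; try apply Rabs_pos; [apply atan_abs_le_2|now apply pole_coef_bound].
- apply (ex_series_scal (V := R_NormedModule) 2), ex_series_pole_bound.
Qed.

Lemma is_derive_pole_tail_primitive (r : nat) (y : R) :
  (1 <= r)%nat -> is_derive (pole_tail_primitive r) y (pole_tail s r y).
Proof.
intros Hr. apply is_derive_quadratic with (Series (fun k => 2 * / odd_half_pi k ^ 2)).
intros z. unfold pole_tail_primitive, pole_tail.
assert (E1 := ex_series_pole_tail_primitive r z Hr).
assert (E2 := ex_series_pole_tail_primitive r y Hr).
assert (E3 := ex_series_scal (V := R_NormedModule) (z - y) _ (ex_series_pole_tail r y)).
rewrite <- Series_scal_l, <- Series_minus by assumption.
rewrite <- Series_minus; [|now apply (ex_series_minus (V := R_NormedModule))|exact E3].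
rewrite <- Series_scal_r.
apply Series_abs_le; [|apply ex_series_scal_r, ex_series_pole_bound].
intros k. assert (W := odd_half_pi_ge_1 k). assert (W1 := odd_half_pi_pow_ge_1 k r).
replace (s k * (2 / odd_half_pi k ^ (r + 1) * atan (z / odd_half_pi k)) -
   s k * (2 / odd_half_pi k ^ (r + 1) * atan (y / odd_half_pi k)) -
   (z - y) * (s k * (2 / (odd_half_pi k ^ r * (y ^ 2 + odd_half_pi k ^ 2))))) with
 (s k * (2 / odd_half_pi k ^ (r + 1)) *
  (atan (z / odd_half_pi k) - atan (y / odd_half_pi k) -
   (z - y) * (odd_half_pi k / (y ^ 2 + odd_half_pi k ^ 2))))
  by (rewrite pow_add, pow_1; field; repeat split; nra).
rewrite Rabs_mult. apply Rmult_le_compat; try apply Rabs_pos.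
- now apply pole_coef_bound.
- now apply atan_scaled_quadratic.
Qed.

Lemma pole_tail_primitive_lim_0 (r : nat) :
  (1 <= r)%nat -> filterlim (pole_tail_primitive r) (at_right 0) (locally 0).
Proof.
intros Hr. apply (filterlim_filter_le_1 (F := locally 0)).
- intros P [e He]. exists e. intros y Hy _. now apply He.
- replace 0 with (pole_tail_primitive r 0) at 2.
  + apply (ex_derive_continuous (pole_tail_primitive r)). eexists.
    now apply is_derive_pole_tail_primitive.
  + unfold pole_tail_primitive. apply is_series_unique.
    apply (is_series_ext (fun _ => 0)).
    * intros k. unfold Rdiv. rewrite Rmult_0_l, atan_0. eqR. ring.
    * apply (filterlim_ext (fun _ => 0)); [|apply filterlim_const].
      intros n. rewrite sum_n_const. symmetry. apply Rmult_0_r.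
Qed.

(** Each arctangent tends to [PI / 2]. The dominated limit is applied to the differences, where
    [atan (y / w) - PI / 2 = - atan (w / y)]. *)
Lemma pole_tail_primitive_lim_infty (r : nat) :
  (1 <= r)%nat ->
  is_lim (pole_tail_primitive r) p_infty (PI * Series (fun k => s k * / odd_half_pi k ^ (r + 1))).
Proof.
intros Hr.
set (L := PI * Series (fun k => s k * / odd_half_pi k ^ (r + 1))).
set (f := fun k y => s k * (2 / odd_half_pi k ^ (r + 1)) * (atan (y / odd_half_pi k) - PI / 2)).
assert (Ec : ex_series (fun k => s k * / odd_half_pi k ^ (r + 1))).
{ apply ex_series_dominated with (2 := ex_series_odd_half_pi (r + 1) ltac:(lia)).
  intros k. rewrite Rabs_mult, <- (Rmult_1_l (/ odd_half_pi k ^ (r + 1))).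
  assert (W := odd_half_pi_pow_ge_1 k (r + 1)).
  assert (V : 0 < / odd_half_pi k ^ (r + 1)) by (apply Rinv_0_lt_compat; lra).
  rewrite Rmult_1_l, (Rabs_pos_eq (/ _)) by lra. assert (S := s_le_1 k). nra. }
assert (E : forall y, Series (fun k => f k y) + L = pole_tail_primitive r y).
{ intros y. unfold L. rewrite <- Series_scal_l. unfold pole_tail_primitive.
  rewrite (Series_ext (fun k => f k y) (fun k =>
     s k * (2 / odd_half_pi k ^ (r + 1) * atan (y / odd_half_pi k)) -
     PI * (s k * / odd_half_pi k ^ (r + 1)))).
  - rewrite Series_minus; [ring|now apply ex_series_pole_tail_primitive|].
    now apply (ex_series_scal (V := R_NormedModule) PI).
  - intros k. unfold f. assert (W := odd_half_pi_pow_ge_1 k (r + 1)). field. lra. }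
apply (is_lim_ext (fun y => Series (fun k => f k y) + L)); [exact E|].
replace (Finite L) with (Rbar_plus 0 L) by (simpl; f_equal; ring).
apply is_lim_plus'; [|apply is_lim_const].
apply is_lim_Series_dominated with (fun k => 4 * (2 * / odd_half_pi k ^ 2)).
- apply (ex_series_scal (V := R_NormedModule) 4), ex_series_pole_bound.
- intros k y _. unfold f. rewrite Rabs_mult, Rmult_comm.
  apply Rmult_le_compat; try apply Rabs_pos; [|now apply pole_coef_bound].
  assert (H := atan_bound (y / odd_half_pi k)). assert (K := PI_4). apply Rabs_le. lra.
- intros k. assert (W := odd_half_pi_ge_1 k). unfold f.
  set (c := s k * (2 / odd_half_pi k ^ (r + 1))).
  replace (Finite 0) with (Rbar_mult c (- atan 0)) by (simpl; rewrite atan_0; f_equal; ring).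
  apply is_lim_scal_l.
  apply (is_lim_ext_loc (fun y => - atan (odd_half_pi k * / y))).
  + exists 0. intros y Hy.
    replace (y / odd_half_pi k) with (/ (odd_half_pi k * / y)) by (field; lra).
    rewrite atan_inv; [ring|]. apply Rmult_lt_0_compat; [lra|now apply Rinv_0_lt_compat].
  + apply (is_lim_opp (fun y => atan (odd_half_pi k * / y)) p_infty (atan 0)).
    apply (is_lim_comp_continuous (fun y => odd_half_pi k * / y) atan p_infty 0).
    * replace (Finite 0) with (Rbar_mult (odd_half_pi k) 0) by (simpl; f_equal; ring).
      apply is_lim_scal_l. apply (is_lim_inv (fun y => y) p_infty p_infty); [apply is_lim_id|easy].
    * apply continuity_pt_filterlim, derivable_continuous_pt. eexists.
      apply derivable_pt_lim_atan.
Qed.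

End PoleTail.

(** * Polynomial parts and the integrals of [D^r tanh / y] and [D^r sech / y] *)

(* [f] is a polynomial of degree less than [r], presented through its derivatives. *)
Definition degree_lt (r : nat) (f : R -> R) : Prop :=
  exists P : nat -> R -> R,
    derivative_chain P /\ (forall y, P 0%nat y = f y) /\
    (forall i y, (r <= i)%nat -> P i y = 0) /\
    forall i, (i < r)%nat -> exists K, forall y, 1 <= y -> Rabs (P i y) * y <= K * y ^ (r - i).

Lemma degree_lt_zero (r : nat) : degree_lt r (fun _ => 0).
Proof.
exists (fun _ _ => 0). split; [|split; [|split]]; auto.
- intros i y. apply (is_derive_const (V := R_NormedModule) 0).
- intros i _. exists 0. intros y _. rewrite Rabs_R0. lra.
Qed.

(** [falling_factorial e i * y ^ (e - i)] is the [i]-th derivative of [y ^ e] for every [i]: beyond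
    [e] a factor [INR 0] enters, so the truncated exponent is harmless. *)
Fixpoint falling_factorial (e i : nat) : R :=
  match i with
  | O => 1
  | S j => falling_factorial e j * INR (e - j)
  end.

Lemma falling_factorial_eq_0 (e i : nat) : (e < i)%nat -> falling_factorial e i = 0.
Proof.
induction i as [|i IH]; intros H; [lia|]. simpl.
destruct (Nat.eq_dec e i) as [->|E].
- rewrite Nat.sub_diag. simpl. ring.
- rewrite IH by lia. ring.
Qed.

Lemma degree_lt_add_monomial (r r' e : nat) (c : R) (f : R -> R) :
  degree_lt r f -> (r <= r')%nat -> (e < r')%nat ->
  degree_lt r' (fun y => f y + c * y ^ e).
Proof.
intros [P [dP [P0 [Pr PK]]]] Hr He.
exists (fun i y => P i y + c * falling_factorial e i * y ^ (e - i)).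
split; [|split; [|split]].
- intros i y. evar_last.
  + apply (is_derive_plus (V := R_NormedModule) (P i)); [apply dP|].
    apply (is_derive_scal (fun y => y ^ (e - i))).
    apply (is_derive_pow (fun y => y) (e - i) y 1). apply (is_derive_id (K := R_AbsRing)).
  + eqR. simpl falling_factorial. replace (e - S i)%nat with (pred (e - i)) by lia. ring.
- intros y. rewrite P0, Nat.sub_0_r. simpl. ring.
- intros i y Hi. rewrite Pr, falling_factorial_eq_0 by lia. ring.
- intros i Hi.
  assert (X : exists K, 0 <= K /\ forall y, 1 <= y -> Rabs (P i y) * y <= K * y ^ (r' - i)).
  { destruct (le_lt_dec r i) as [L|L].
    - exists 0. split; [lra|]. intros y Hy. rewrite Pr, Rabs_R0 by exact L. lra.
    - destruct (PK i L) as [K HK]. exists (Rabs K). split; [apply Rabs_pos|].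
      intros y Hy. apply Rle_trans with (1 := HK y Hy).
      apply Rle_trans with (Rabs K * y ^ (r - i)).
      + apply Rmult_le_compat_r; [apply pow_le; lra|apply Rle_abs].
      + apply Rmult_le_compat_l; [apply Rabs_pos|]. apply Rle_pow; [lra|lia]. }
  destruct X as [K [K0 HK]]. exists (K + Rabs (c * falling_factorial e i)). intros y Hy.
  rewrite Rmult_plus_distr_r.
  apply Rle_trans with (Rabs (P i y) * y + Rabs (c * falling_factorial e i * y ^ (e - i)) * y).
  { rewrite <- Rmult_plus_distr_r. apply Rmult_le_compat_r; [lra|apply Rabs_triang]. }
  apply Rplus_le_compat; [now apply HK|].
  destruct (le_lt_dec i e) as [L|L].
  + rewrite Rabs_mult, Rmult_assoc. apply Rmult_le_compat_l; [apply Rabs_pos|].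
    rewrite Rabs_pos_eq by (apply pow_le; lra).
    rewrite Rmult_comm, tech_pow_Rmult. apply Rle_pow; [lra|lia].
  + rewrite falling_factorial_eq_0 by exact L.
    rewrite Rmult_0_r, Rmult_0_l, Rabs_R0. lra.
Qed.

Definition has_pole_remainder (s : nat -> R) (r : nat) (c : R) (u : R -> R) : Prop :=
  exists f, degree_lt r f /\ forall y, u y = f y + c * (y ^ (r + 1) * pole_tail s r y).

Lemma has_pole_remainder_step (s : nat -> R) (r : nat) (c : R) (u : R -> R) :
  (forall k, Rabs (s k) <= 1) ->
  has_pole_remainder s r c u -> has_pole_remainder s (r + 2) (- c) u.
Proof.
intros Hs [f [Hf E]].
exists (fun y => f y + c * pole_tail s r 0 * y ^ (r + 1)). split.
- apply degree_lt_add_monomial with r; [exact Hf|lia|lia].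
- intros y. rewrite E, (pole_tail_step s Hs r y).
  replace (r + 2 + 1)%nat with (r + 1 + 2)%nat by lia. rewrite (pow_add y (r + 1) 2). ring.
Qed.

(** Integration by parts is applied to [U - P], with [P] the polynomial part. Its [r]-th derivative
    is that of [U], it is of order [y^(r + 1)] at 0, and at infinity the bounds on [U i] and the
    degree of [P] give the required growth. *)
Lemma half_line_integral_pole (s : nat -> R) (U : nat -> R -> R) (r : nat) (c : R) :
  (forall k, Rabs (s k) <= 1) -> (1 <= r)%nat -> derivative_chain U ->
  (forall i, exists K, forall y, Rabs (U i y) <= K) ->
  has_pole_remainder s r c (U 0%nat) ->
  half_line_integral (fun y => U r y / y)
    (INR (fact r) * (c * (PI * Series (fun k => s k * / odd_half_pi k ^ (r + 1))))).
Proof.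
intros Hs Hr dU bU [f [[P [dP [P0 [Pr PK]]]] E]].
set (Q := fun i y => U i y - P i y).
assert (Q0 : forall y, Q 0%nat y = c * (y ^ (r + 1) * pole_tail s r y)).
{ intros y. unfold Q. rewrite E, P0. ring. }
apply (half_line_integral_ext (fun y => Q r y / y)).
{ intros y _. unfold Q. rewrite Pr by lia. unfold Rdiv. ring. }
apply (half_line_integral_by_parts Q r (Rabs c * Series (fun k => 2 * / odd_half_pi k ^ 2))
  (fun y => c * pole_tail_primitive s r y)).
- intros i y. apply (is_derive_minus (V := R_NormedModule)); [apply dU|apply dP].
- intros y Hy. rewrite Q0, Rabs_mult, Rmult_assoc.
  apply Rmult_le_compat_l; [apply Rabs_pos|].
  rewrite Rabs_mult, Rmult_comm, (Rabs_pos_eq (y ^ (r + 1))) by (apply pow_le; lra).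
  apply Rmult_le_compat_r; [apply pow_le; lra|].
  apply Series_abs_le; [|apply ex_series_pole_bound]. intros k. now apply pole_tail_term_bound.
- intros i Hi. destruct (bU i) as [K HK]. destruct (PK i Hi) as [K' HK'].
  exists (K + K'). intros y Hy. unfold Q.
  assert (K0 : 0 <= K) by (apply Rle_trans with (2 := HK y), Rabs_pos).
  apply Rle_trans with (Rabs (U i y) * y + Rabs (P i y) * y).
  { rewrite <- Rmult_plus_distr_r. apply Rmult_le_compat_r; [lra|].
    apply Rle_trans with (1 := Rabs_triang _ _). rewrite Rabs_Ropp. lra. }
  rewrite Rmult_plus_distr_r. apply Rplus_le_compat; [|now apply HK'].
  apply Rmult_le_compat; [apply Rabs_pos|lra|apply HK|].
  rewrite <- (pow_1 y) at 1. apply Rle_pow; [lra|lia].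
- intros y Hy. replace (Q 0%nat y / y ^ (r + 1)) with (c * pole_tail s r y).
  + apply (is_derive_scal (pole_tail_primitive s r)). now apply is_derive_pole_tail_primitive.
  + rewrite Q0. field. apply pow_nonzero. lra.
- replace 0 with (c * 0) at 2 by ring.
  apply (filterlim_comp _ _ _ (pole_tail_primitive s r) (fun z => c * z) _ (locally 0)).
  + now apply pole_tail_primitive_lim_0.
  + apply (continuous_scal_r (K := R_AbsRing) (V := R_NormedModule) c (fun z => z)). apply continuous_id.
- apply (is_lim_scal_l (pole_tail_primitive s r) c p_infty
    (PI * Series (fun k => s k * / odd_half_pi k ^ (r + 1)))).
  now apply pole_tail_primitive_lim_infty.
Qed.

Lemma tanh_pole_remainder (p : nat) :
  has_pole_remainder (fun _ => 1) (2 * p) ((-1) ^ p) (fun y => sinh y / cosh y).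
Proof.
induction p as [|p IH].
- exists (fun _ => 0). split; [apply degree_lt_zero|]. intros y. simpl.
  rewrite <- (is_series_unique _ _ (tanh_series y)). unfold pole_tail.
  rewrite Rmult_1_r, Rplus_0_l, Rmult_1_l, <- Series_scal_l.
  apply Series_ext. intros k. simpl. rewrite !Rmult_1_l. unfold Rdiv. ring.
- replace (2 * S p)%nat with (2 * p + 2)%nat by lia.
  replace ((-1) ^ S p) with (- (-1) ^ p) by (simpl; ring).
  apply has_pole_remainder_step; [|exact IH]. intros _. rewrite Rabs_R1. lra.
Qed.

Lemma Rabs_pow_neg1 (k : nat) : Rabs ((-1) ^ k) <= 1.
Proof. rewrite pow_1_abs. lra. Qed.

(** Here the induction starts at [r = 1]: subtracting the expansion at [y = 0] turns
    [2 w / (y^2 + w^2)] into [- 2 y^2 / (w (y^2 + w^2))], whence the additional sign. *)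
Lemma sech_pole_remainder (p : nat) :
  has_pole_remainder (pow (-1)) (2 * p + 1) (- (-1) ^ p) (fun y => / cosh y).
Proof.
induction p as [|p IH].
- exists (fun y => 0 + / cosh 0 * y ^ 0). split.
  + apply degree_lt_add_monomial with 0%nat; [apply degree_lt_zero|lia|lia].
  + intros y. rewrite <- (is_series_unique _ _ (sech_series y)).
    rewrite <- (is_series_unique _ _ (sech_series 0)). unfold pole_tail.
    rewrite Rplus_0_l, Rmult_1_r.
    replace (- (-1) ^ 0) with (-1) by (simpl; ring).
    rewrite <- !Series_scal_l, <- Series_plus.
    * apply Series_ext. intros k. assert (W := odd_half_pi_ge_1 k). simpl. field.
      split; nra.
    * eexists. apply sech_series.
    * apply (ex_series_scal (V := R_NormedModule) (-1)).
      apply (ex_series_scal (V := R_NormedModule) (y ^ (2 * 0 + 1 + 1))).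
      apply ex_series_pole_tail, Rabs_pow_neg1.
- replace (2 * S p + 1)%nat with (2 * p + 1 + 2)%nat by lia.
  replace ((-1) ^ S p) with (- (-1) ^ p) by (simpl; ring).
  apply has_pole_remainder_step; [apply Rabs_pow_neg1|exact IH].
Qed.

(** * The angle as a function of [y], and derivatives of multiple angles *)

(* With [y = - ln (tan x)] one has [gd_angle y = 2 x], [cos (gd_angle y) = tanh y] and
   [sin (gd_angle y) = sech y]. *)
Definition gd_angle (y : R) : R := 2 * atan (exp (- y)).

Lemma sin_2_atan (x : R) : sin (2 * atan x) = 2 * x / (1 + x ^ 2).
Proof.
rewrite sin_2a, sin_atan, cos_atan.
assert (P : 0 < 1 + x²) by (unfold Rsqr; nra).
assert (S := sqrt_lt_R0 _ P). assert (E := sqrt_sqrt (1 + x²) (Rlt_le _ _ P)).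
replace (1 + x ^ 2) with (sqrt (1 + x²) * sqrt (1 + x²)) by (rewrite E; unfold Rsqr; ring).
field. lra.
Qed.

Lemma cos_2_atan (x : R) : cos (2 * atan x) = (1 - x ^ 2) / (1 + x ^ 2).
Proof.
rewrite cos_2a, sin_atan, cos_atan.
assert (P : 0 < 1 + x²) by (unfold Rsqr; nra).
assert (S := sqrt_lt_R0 _ P). assert (E := sqrt_sqrt (1 + x²) (Rlt_le _ _ P)).
replace (1 + x ^ 2) with (sqrt (1 + x²) * sqrt (1 + x²)) by (rewrite E; unfold Rsqr; ring).
field. lra.
Qed.

Lemma cos_gd_angle (y : R) : cos (gd_angle y) = sinh y / cosh y.
Proof.
unfold gd_angle. rewrite cos_2_atan. unfold sinh, cosh. rewrite exp_Ropp.
assert (E := exp_pos y). field. repeat split; nra.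
Qed.

Lemma sin_gd_angle (y : R) : sin (gd_angle y) = / cosh y.
Proof.
unfold gd_angle. rewrite sin_2_atan. unfold cosh. rewrite exp_Ropp.
assert (E := exp_pos y). field. repeat split; nra.
Qed.

Lemma is_derive_gd_angle (y : R) : is_derive gd_angle y (- sin (gd_angle y)).
Proof.
unfold gd_angle at 2. rewrite sin_2_atan. evar_last.
- apply (is_derive_scal (fun y => atan (exp (- y)))).
  apply (is_derive_comp (V := R_NormedModule) atan (fun y => exp (- y))).
  + apply is_derive_Reals, derivable_pt_lim_atan.
  + auto_derive; [exact I|reflexivity].
- eqR. assert (E := exp_pos (- y)). unfold Rsqr. field. nra.
Qed.

(* The [r]-th derivative of [g (m * gd_angle y)] for [g = cos] or [g = sin]. *)
Fixpoint gd_derivative (g : R -> R) (r m : nat) (y : R) : R :=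
  match r with
  | O => g (INR m * gd_angle y)
  | S r1 => INR m / 2 * (gd_derivative g r1 (m - 1) y - gd_derivative g r1 (m + 1) y)
  end.

Lemma gd_derivative_1_cos (m : nat) (y : R) :
  gd_derivative cos 1 m y = INR m * (sin (INR m * gd_angle y) * sin (gd_angle y)).
Proof.
simpl. destruct m as [|m]; [simpl; unfold Rdiv; ring|].
replace (S m - 1)%nat with m by lia.
replace (INR m * gd_angle y) with (INR (S m) * gd_angle y - gd_angle y) by (rewrite S_INR; ring).
replace (INR (S m + 1) * gd_angle y) with (INR (S m) * gd_angle y + gd_angle y)
  by (rewrite plus_INR; simpl (INR 1); ring).
rewrite cos_plus, cos_minus. field.
Qed.

Lemma gd_derivative_1_sin (m : nat) (y : R) :
  gd_derivative sin 1 m y = - INR m * (cos (INR m * gd_angle y) * sin (gd_angle y)).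
Proof.
simpl. destruct m as [|m]; [simpl; unfold Rdiv; ring|].
replace (S m - 1)%nat with m by lia.
replace (INR m * gd_angle y) with (INR (S m) * gd_angle y - gd_angle y) by (rewrite S_INR; ring).
replace (INR (S m + 1) * gd_angle y) with (INR (S m) * gd_angle y + gd_angle y)
  by (rewrite plus_INR; simpl (INR 1); ring).
rewrite sin_plus, sin_minus. field.
Qed.

(** Only the first derivative needs trigonometry: the later levels are the same linear combinations,
    over neighbouring [m], of earlier ones. *)
Lemma derivative_chain_gd (g : R -> R) (m : nat) :
  (forall m y, is_derive (gd_derivative g 0 m) y (gd_derivative g 1 m y)) ->
  derivative_chain (fun i => gd_derivative g i m).
Proof.
intros H i. revert m. induction i as [|i IH]; intros m y; [apply H|].
apply (is_derive_scal (fun y => gd_derivative g i (m - 1) y - gd_derivative g i (m + 1) y)).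
apply (is_derive_minus (V := R_NormedModule) (gd_derivative g i (m - 1))); apply IH.
Qed.

Lemma derivative_chain_gd_cos (m : nat) : derivative_chain (fun i => gd_derivative cos i m).
Proof.
apply derivative_chain_gd. clear m. intros m y. rewrite gd_derivative_1_cos. evar_last.
- apply (is_derive_comp (V := R_NormedModule) cos (fun y => INR m * gd_angle y)).
  + apply is_derive_cos.
  + apply (is_derive_scal gd_angle), is_derive_gd_angle.
- eqR. ring.
Qed.

Lemma derivative_chain_gd_sin (m : nat) : derivative_chain (fun i => gd_derivative sin i m).
Proof.
apply derivative_chain_gd. clear m. intros m y. rewrite gd_derivative_1_sin. evar_last.
- apply (is_derive_comp (V := R_NormedModule) sin (fun y => INR m * gd_angle y)).
  + apply is_derive_sin.
  + apply (is_derive_scal gd_angle), is_derive_gd_angle.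
- eqR. ring.
Qed.

Lemma gd_derivative_bounded (g : R -> R) (i m : nat) :
  (forall x, Rabs (g x) <= 1) -> exists K, forall y, Rabs (gd_derivative g i m y) <= K.
Proof.
intros Hg. revert m. induction i as [|i IH]; intros m; [exists 1; intros y; apply Hg|].
destruct (IH (m - 1)%nat) as [K HK]. destruct (IH (m + 1)%nat) as [K' HK'].
exists (Rabs (INR m / 2) * (K + K')). intros y. simpl. rewrite Rabs_mult.
apply Rmult_le_compat_l; [apply Rabs_pos|].
apply Rle_trans with (1 := Rabs_triang _ _). rewrite Rabs_Ropp. now apply Rplus_le_compat.
Qed.

(** The coefficient of [D^q] in [[r^m] exp (-2 artanh r D)]. *)
Definition gd_coef (m q : nat) : R := (-2) ^ q / INR (fact q) * artanh_coef m q.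

Lemma gd_coef_SS (m q : nat) :
  INR (m + 2) * gd_coef (S (S m)) (S q) =
  INR m * gd_coef m (S q) - 2 * gd_coef (S m) q.
Proof.
unfold gd_coef. rewrite <- tech_pow_Rmult.
transitivity (-2 * (-2) ^ q / INR (fact (S q)) * (INR (m + 2) * artanh_coef (S (S m)) (S q)));
  [ring|].
rewrite artanh_coef_SS, fact_simpl, mult_INR. field.
split; [apply INR_fact_neq_0|apply not_0_INR; lia].
Qed.

Lemma sum_n_shift_R (a : nat -> R) (n : nat) :
  sum_n a (S n) = a 0%nat + sum_n (fun k => a (S k)) n.
Proof.
induction n as [|n IH]; [now rewrite sum_Sn_R, !sum_O|].
rewrite sum_Sn_R, IH, (sum_Sn_R (fun k => a (S k))). eqR. ring.
Qed.

Lemma sum_n_lin_R (c d : R) (a b : nat -> R) (n : nat) :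
  sum_n (fun k => c * a k + d * b k) n = c * sum_n a n + d * sum_n b n.
Proof.
induction n as [|n IH]; [now rewrite !sum_O|]. rewrite !sum_Sn_R, IH. eqR. ring.
Qed.

(** Solving the definition of [gd_derivative] at [m + 1] for the index [m + 2] gives the recursion
    [gd_coef_SS], the additional derivative matching the shift of [q]. Any upper limit [N >= m] is
    allowed because the step uses both [N] and [S N]. *)
Lemma gd_derivative_S (g : R -> R) (m N r : nat) (y : R) :
  (m <= N)%nat ->
  gd_derivative g (S r) m y =
  - (INR m / 2) * sum_n (fun q => gd_coef m q * gd_derivative g (r + q) 1 y) N.
Proof.
revert N r. induction m as [m IH] using (well_founded_induction lt_wf). intros N r HN.
destruct m as [|[|m]].
- simpl. unfold Rdiv. eqR. ring.
- destruct N as [|N]; [lia|]. rewrite sum_n_shift_R.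
  assert (Z : forall M, sum_n (fun k => gd_coef 1 (S k) * gd_derivative g (r + S k) 1 y) M =
     -2 * gd_derivative g (S r) 1 y).
  { induction M as [|M IHM].
    - rewrite sum_O. replace (r + 1)%nat with (S r) by lia. unfold gd_coef. simpl artanh_coef.
      simpl fact. simpl pow. simpl INR. eqR. field.
    - rewrite sum_Sn_R, IHM. unfold gd_coef. simpl artanh_coef. eqR. ring. }
  rewrite Z. unfold gd_coef. simpl artanh_coef. simpl INR. eqR. field.
- destruct N as [|N]; [lia|].
  assert (E : INR (m + 2) * sum_n (fun q => gd_coef (S (S m)) q * gd_derivative g (r + q) 1 y) (S N) =
    INR m * sum_n (fun q => gd_coef m q * gd_derivative g (r + q) 1 y) (S N)
    - 2 * sum_n (fun q => gd_coef (S m) q * gd_derivative g (S r + q) 1 y) N).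
  { rewrite !sum_n_shift_R.
    assert (E0 : gd_coef (S (S m)) 0 = 0) by (unfold gd_coef; rewrite artanh_coef_0_r; eqR; ring).
    (* For [m = 0] the coefficient is 1, and it is the factor [INR m] that vanishes. *)
    assert (E1 : INR m * gd_coef m 0 = 0).
    { destruct m as [|m]; [simpl; ring|]. unfold gd_coef. rewrite artanh_coef_0_r. eqR. ring. }
    rewrite E0, !Rmult_plus_distr_l.
    replace (INR m * (gd_coef m 0 * gd_derivative g (r + 0) 1 y)) with 0
      by (rewrite <- Rmult_assoc, E1; eqR; ring).
    rewrite Rmult_0_l, Rmult_0_r, !Rplus_0_l.
    transitivity (sum_n (fun k => INR (m + 2) * (gd_coef (S (S m)) (S k) * gd_derivative g (r + S k) 1 y)
       + 0 * 0) N).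
    { rewrite (sum_n_lin_R (INR (m + 2)) 0 _ (fun _ => 0)). eqR. ring. }
    unfold Rminus. rewrite <- Ropp_mult_distr_l_reverse, <- sum_n_lin_R.
    apply sum_n_ext. intros k. replace (r + S k)%nat with (S r + k)%nat by lia.
    transitivity (INR (m + 2) * gd_coef (S (S m)) (S k) * gd_derivative g (S r + k) 1 y);
      [eqR; ring|]. rewrite gd_coef_SS. eqR. ring. }
  assert (I1 := IH m ltac:(lia) (S N) r ltac:(lia)).
  assert (I2 := IH (S m) ltac:(lia) N (S r) ltac:(lia)).
  replace (S (S m)) with (m + 2)%nat in * by lia.
  transitivity (- / 2 * (INR (m + 2) * sum_n (fun q => gd_coef (m + 2) q * gd_derivative g (r + q) 1 y) (S N)));
    [|eqR; field].
  rewrite E.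
  assert (R1 : gd_derivative g (S (S r)) (S m) y = INR (S m) / 2 * (gd_derivative g (S r) m y - gd_derivative g (S r) (m + 2) y)).
  { change (gd_derivative g (S (S r)) (S m) y) with
      (INR (S m) / 2 * (gd_derivative g (S r) (S m - 1) y - gd_derivative g (S r) (S m + 1) y)).
    replace (S m - 1)%nat with m by lia. now replace (S m + 1)%nat with (m + 2)%nat by lia. }
  rewrite R1 in I2.
  assert (Sm : 0 < INR (S m)) by (apply lt_0_INR; lia).
  assert (I3 : gd_derivative g (S r) m y - gd_derivative g (S r) (m + 2) y =
     - sum_n (fun q => gd_coef (S m) q * gd_derivative g (S r + q) 1 y) N).
  { apply (Rmult_eq_reg_l (INR (S m) / 2)); [|lra]. rewrite I2. eqR. ring. }
  rewrite I1 in I3. lra.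
Qed.

(** The alternative [a q = 0] admits the terms without an integral, such as [D tanh / y], which
    behaves like [1 / y] at 0. *)
Lemma half_line_integral_sum (f : nat -> R -> R) (a L : nat -> R) (N : nat) :
  (forall q, a q = 0 \/ half_line_integral (f q) (L q)) ->
  half_line_integral (fun y => sum_n (fun q => a q * f q y) N) (sum_n (fun q => a q * L q) N).
Proof.
intros H.
assert (Z : half_line_integral (fun _ => 0) 0).
{ exists (fun _ => 0). split; [|split].
  - intros y _. apply (is_derive_const (V := R_NormedModule) 0).
  - apply filterlim_const.
  - apply is_lim_const. }
assert (T : forall q, half_line_integral (fun y => a q * f q y) (a q * L q)).
{ intros q. destruct (H q) as [E|K].
  - rewrite E, Rmult_0_l. apply (half_line_integral_ext (fun _ => 0)); [intros; ring|exact Z].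
  - replace (a q * L q) with (a q * L q + 0 * 0) by ring.
    apply (half_line_integral_ext (fun y => a q * f q y + 0 * 0)); [intros; ring|].
    apply (half_line_integral_lin (f q) (fun _ => 0)); [exact K|exact Z]. }
induction N as [|N IH].
- rewrite sum_O. apply (half_line_integral_ext (fun y => a 0%nat * f 0%nat y)); [|apply T].
  intros y _. now rewrite sum_O.
- rewrite sum_Sn_R.
  replace (sum_n (fun q => a q * L q) N + a (S N) * L (S N)) with
    (1 * sum_n (fun q => a q * L q) N + 1 * (a (S N) * L (S N))) by ring.
  apply (half_line_integral_ext (fun y => 1 * sum_n (fun q => a q * f q y) N + 1 * (a (S N) * f (S N) y))).
  + intros y _. rewrite sum_Sn_R. ring.
  + now apply (half_line_integral_lin (fun y => sum_n (fun q => a q * f q y) N)).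
Qed.

(** * Return to the variable [x] *)

(** The fundamental theorem for an integrand and a primitive known at the ends only through limits,
    as [ln (tan x)] degenerates at both. Continuous extensions replace them, and the mean value
    theorem shows that [G] minus the integral of [g] has equal values at the ends. *)
Lemma is_RInt_primitive_limits (f F : R -> R) (a b fa fb la lb : R) :
  a < b ->
  (forall x, a < x < b -> continuous f x) ->
  (forall x, a < x < b -> is_derive F x (f x)) ->
  filterlim f (at_right a) (locally fa) -> filterlim f (at_left b) (locally fb) ->
  filterlim F (at_right a) (locally la) -> filterlim F (at_left b) (locally lb) ->
  is_RInt f a b (lb - la).
Proof.
intros Hab fc Fd f1 f2 F1 F2.
destruct (C0_extension_lt f fa fb a b Hab fc f1 f2) as [g [gc [ge _]]].
assert (Fc : forall x, a < x < b -> continuous F x).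
{ intros x Hx. apply (ex_derive_continuous F). eexists. now apply Fd. }
destruct (C0_extension_lt F la lb a b Hab Fc F1 F2) as [G [Gc [Ge [Ga Gb]]]].
apply (is_RInt_ext g).
{ intros x. rewrite Rmin_left, Rmax_right by lra. apply ge. }
assert (gi : forall x, is_RInt g a x (RInt g a x)).
{ intros x. apply (RInt_correct g), (ex_RInt_continuous g). intros z _. apply gc. }
assert (gd : forall x, is_derive (fun x => RInt g a x) x (g x)).
{ intros x. apply (is_derive_RInt g _ a); [|apply gc]. apply filter_forall. exact gi. }
destruct (MVT_gen (fun x => G x - RInt g a x) a b (fun _ => 0)) as [c [_ E]].
- intros x. rewrite Rmin_left, Rmax_right by lra. intros Hx.
  replace 0 with (f x - g x) by (rewrite ge by exact Hx; ring).
  apply (is_derive_minus (V := R_NormedModule)); [|apply gd].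
  apply (is_derive_ext_loc F); [|now apply Fd].
  generalize (open_and _ _ (open_gt a) (open_lt b) x Hx). apply filter_imp.
  intros y Hy. symmetry. now apply Ge.
- intros x _. apply continuity_pt_filterlim.
  apply (continuous_minus (V := R_NormedModule) G); [apply Gc|].
  apply (ex_derive_continuous (fun x => RInt g a x)). eexists. apply gd.
- assert (Z : RInt g a a = 0) by exact (RInt_point a g).
  rewrite Z, Ga, Gb in E. replace (lb - la) with (RInt g a b) by lra. apply gi.
Qed.

Lemma tan_quarter (x : R) : 0 < x < PI / 4 -> 0 < tan x < 1.
Proof.
intros Hx. assert (P := PI_RGT_0). split.
- apply tan_gt_0; lra.
- rewrite <- tan_PI4. apply tan_increasing_1; lra.
Qed.

Lemma is_derive_ln_tan (x : R) :
  0 < x <= PI / 4 -> is_derive (fun x => ln (tan x)) x (2 / sin (2 * x)).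
Proof.
intros Hx. assert (P := PI_RGT_0).
assert (T : 0 < tan x) by (apply tan_gt_0; lra).
assert (S : 0 < sin x) by (apply sin_gt_0; lra).
assert (C : 0 < cos x) by (apply cos_gt_0; lra).
evar_last.
- apply (is_derive_comp (V := R_NormedModule) ln tan).
  + apply is_derive_Reals, derivable_pt_lim_ln, T.
  + apply is_derive_tan. lra.
- eqR. rewrite sin_2a. unfold tan.
  assert (E := sin2_cos2 x). unfold Rsqr in E.
  replace ((sin x / cos x) ^ 2 + 1) with (/ (cos x * cos x)).
  + field. lra.
  + apply (Rmult_eq_reg_r (cos x * cos x)); [|nra].
    rewrite Rinv_l by nra.
    transitivity (sin x * sin x + cos x * cos x); [now rewrite E|field; lra].
Qed.

Lemma at_right_0_quarter : at_right 0 (fun y => 0 < y < PI / 4).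
Proof.
assert (P := PI_RGT_0). exists (mkposreal (PI / 4) ltac:(lra)). intros y Hy H0.
apply ball_Rabs in Hy. simpl in Hy. rewrite Rminus_0_r, Rabs_pos_eq in Hy; lra.
Qed.

Lemma at_left_quarter : at_left (PI / 4) (fun y => 0 < y < PI / 4).
Proof.
assert (P := PI_RGT_0). exists (mkposreal (PI / 4) ltac:(lra)). intros y Hy H0.
apply ball_Rabs, Rabs_def2 in Hy. simpl in Hy. lra.
Qed.

Lemma ln_tan_lim_0 : filterlim (fun x => ln (tan x)) (at_right 0) (Rbar_locally m_infty).
Proof.
apply (filterlim_comp _ _ _ tan ln (at_right 0) (at_right 0)); [|apply is_lim_ln_0].
intros Q HQ. unfold at_right, within in HQ.
assert (Ct : continuous tan 0).
{ apply (ex_derive_continuous tan). eexists. apply is_derive_tan. rewrite cos_0. lra. }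
unfold continuous in Ct. rewrite tan_0 in Ct.
generalize (filter_and _ _ (filter_le_within (F := locally 0) (fun y => 0 < y) _ (Ct _ HQ)) at_right_0_quarter).
unfold filtermap, at_right, within. apply filter_imp. intros x Hx Hx0.
destruct (Hx Hx0) as [H1 H2]. apply H1. now apply tan_quarter.
Qed.

Lemma ln_tan_lim_quarter :
  filterlim (fun x => - ln (tan x)) (at_left (PI / 4)) (at_right 0).
Proof.
assert (P := PI_RGT_0).
intros Q HQ. unfold at_right, within in HQ.
assert (C : continuous (fun x => - ln (tan x)) (PI / 4)).
{ apply (ex_derive_continuous (fun x => - ln (tan x))). eexists.
  apply (is_derive_opp (V := R_NormedModule) (fun x => ln (tan x))), is_derive_ln_tan. lra. }
unfold continuous in C. rewrite tan_PI4, ln_1, Ropp_0 in C.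
generalize (filter_and _ _ (filter_le_within (F := locally (PI / 4)) (fun y => y < PI / 4) _ (C _ HQ)) at_left_quarter).
unfold filtermap, at_left, within. apply filter_imp. intros x Hx Hx0.
destruct (Hx Hx0) as [H1 H2]. apply H1. apply tan_quarter in H2.
assert (ln (tan x) < 0); [|lra]. rewrite <- ln_1. apply ln_increasing; lra.
Qed.

Lemma is_lim_diff_quotient (f : R -> R) (x l : R) :
  is_derive f x l -> is_lim (fun y => (f y - f x) / (y - x)) x l.
Proof.
intros H. apply is_derive_Reals in H. apply is_lim_spec. intros e.
destruct (H e (cond_pos e)) as [d Hd]. exists d. intros y Hy Hyx.
apply ball_Rabs in Hy. specialize (Hd (y - x) ltac:(lra) Hy).
assert (Ey : x + (y - x) = y) by (eqR; ring). now rewrite Ey in Hd.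
Qed.

(** Both [h] and [ln (tan x)] vanish at [PI / 4], so the limit is the quotient of their derivatives
    there; that of [ln (tan x)] is 2. *)
Lemma div_ln_tan_lim_quarter (h : R -> R) (l : R) :
  is_derive h (PI / 4) l -> h (PI / 4) = 0 ->
  filterlim (fun x => h x / ln (tan x)) (at_left (PI / 4)) (locally (l / 2)).
Proof.
intros Hd H0. assert (P := PI_RGT_0).
assert (L1 := is_lim_diff_quotient _ _ _ Hd).
assert (L2 := is_lim_diff_quotient _ _ _ (is_derive_ln_tan (PI / 4) ltac:(lra))).
replace (2 / sin (2 * (PI / 4))) with 2 in L2.
2: { replace (2 * (PI / 4)) with (PI / 2) by field. rewrite sin_PI2. field. }
assert (L3 := is_lim_div _ _ (PI / 4) l 2 L1 L2 ltac:(intros E; injection E; lra) I).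
apply (filterlim_ext_loc (fun y => (h y - h (PI / 4)) / (y - PI / 4) /
   ((ln (tan y) - ln (tan (PI / 4))) / (y - PI / 4)))).
- generalize at_left_quarter. apply filter_imp. intros y Hy.
  rewrite H0, tan_PI4, ln_1, !Rminus_0_r.
  assert (T := tan_quarter y Hy).
  assert (N : ln (tan y) < 0) by (rewrite <- ln_1; apply ln_increasing; lra).
  eqR. field. lra.
- apply (filterlim_filter_le_1 (F := locally' (PI / 4))); [|exact L3].
  intros Q [d Hd']. exists d. intros y Hy Hlt. apply Hd'; [exact Hy|lra].
Qed.

(* The substitution [y = - ln (tan x)]. *)
Lemma is_RInt_div_ln_tan (g : R -> R) (m : nat) (V : R) :
  (forall x, ex_derive g x) -> g (INR m * (PI / 2)) = 0 ->
  half_line_integral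
    (fun y => g (INR m * gd_angle y) * sin (gd_angle y) / y) V ->
  is_RInt (fun x => g (INR m * (2 * x)) / ln (tan x)) 0 (PI / 4) (- (V / 2)).
Proof.
intros Hg g0 [A [A1 [A2 A3]]]. assert (P := PI_RGT_0).
set (h := fun x => g (INR m * (2 * x))).
assert (hd : forall x, ex_derive h x).
{ intros x. unfold h. apply (ex_derive_comp (V := R_NormedModule) g (fun x => INR m * (2 * x))); [apply Hg|].
  auto_derive. exact I. }
destruct (hd (PI / 4)) as [l Hl].
(* The primitive is half of [A (- ln (tan x))], since [dy = - 2 / sin (2 x) dx]. At [PI / 4] the
   variable [y] tends to [0+], with limit 0; at 0 it tends to infinity, with limit [V / 2]. *)
replace (- (V / 2)) with (/ 2 * 0 - / 2 * V) by field.
assert (N : forall x, 0 < x < PI / 4 -> ln (tan x) < 0).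
{ intros x Hx. assert (T := tan_quarter x Hx). rewrite <- ln_1. apply ln_increasing; lra. }
assert (M : forall z, filterlim (fun x => / 2 * x) (locally z) (locally (/ 2 * z))).
{ intros z. apply (continuous_scal_r (K := R_AbsRing) (V := R_NormedModule) (/ 2) (fun z => z)).
  apply continuous_id. }
apply (is_RInt_primitive_limits (fun x => h x / ln (tan x))
  (fun x => / 2 * A (- ln (tan x))) 0 (PI / 4) 0 (l / 2)).
- lra.
- intros x Hx. apply (continuous_mult h (fun x => / ln (tan x))).
  + apply (ex_derive_continuous h), hd.
  + apply (ex_derive_continuous (fun x => / ln (tan x))).
    eexists. apply is_derive_inv; [apply is_derive_ln_tan; lra|].
    specialize (N x Hx). lra.
- intros x Hx. specialize (N x Hx). assert (T := tan_quarter x Hx).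
  assert (G : gd_angle (- ln (tan x)) = 2 * x).
  { unfold gd_angle. rewrite Ropp_involutive, exp_ln by lra. rewrite atan_tan; lra. }
  assert (S : 0 < sin (2 * x)) by (apply sin_gt_0; lra).
  evar_last.
  + apply (is_derive_scal (fun x => A (- ln (tan x)))).
    apply (is_derive_comp (V := R_NormedModule) A (fun x => - ln (tan x))).
    * apply A1. lra.
    * apply (is_derive_opp (V := R_NormedModule) (fun x => ln (tan x))), is_derive_ln_tan. lra.
  + rewrite G. unfold h. eqR. field. lra.
- replace 0 with (h 0 * 0) at 2 by ring.
  apply (filterlim_comp_2 (G := locally (h 0)) (H := locally 0) h (fun x => / ln (tan x)) Rmult).
  + apply (filterlim_filter_le_1 (F := locally 0)).
    * intros Q [d Hd']. exists d. intros y Hy _. now apply Hd'.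
    * apply (ex_derive_continuous h), hd.
  + apply (filterlim_comp _ _ _ (fun x => ln (tan x)) Rinv _ (Rbar_locally m_infty)); [apply ln_tan_lim_0|].
    exact (is_lim_inv (fun y => y) m_infty m_infty (is_lim_id m_infty) ltac:(easy)).
  + apply (filterlim_mult (K := R_AbsRing)).
- apply div_ln_tan_lim_quarter; [exact Hl|]. unfold h.
  now replace (2 * (PI / 4)) with (PI / 2) by field.
- apply (filterlim_comp _ _ _ (fun x => A (- ln (tan x))) (fun z => / 2 * z) _ (locally V)); [|apply M].
  apply (filterlim_comp _ _ _ (fun x => - ln (tan x)) A _ (Rbar_locally p_infty)); [|exact A3].
  apply (filterlim_comp _ _ _ (fun x => ln (tan x)) Ropp _ (Rbar_locally m_infty)); [apply ln_tan_lim_0|].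
  apply (filterlim_Rbar_opp m_infty).
- apply (filterlim_comp _ _ _ (fun x => A (- ln (tan x))) (fun z => / 2 * z) _ (locally 0)); [|apply M].
  apply (filterlim_comp _ _ _ (fun x => - ln (tan x)) A _ (at_right 0)); [|exact A2].
  apply ln_tan_lim_quarter.
Qed.

(** * Values of zeta and beta as sums over the poles *)

Lemma Series_even_odd (a : nat -> R) :
  ex_series a -> ex_series (fun k => a (2 * k)%nat) -> ex_series (fun k => a (2 * k + 1)%nat) ->
  Series a = Series (fun k => a (2 * k)%nat) + Series (fun k => a (2 * k + 1)%nat).
Proof.
intros Ha He Ho.
assert (E : forall N, sum_n a (2 * N + 1) =
  sum_n (fun k => a (2 * k)%nat) N + sum_n (fun k => a (2 * k + 1)%nat) N).
{ induction N as [|N IH].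
  - change (2 * 0 + 1)%nat with 1%nat. rewrite sum_Sn_R, !sum_O. reflexivity.
  - replace (2 * S N + 1)%nat with (S (S (2 * N + 1))) by lia.
    rewrite !sum_Sn_R, IH.
    replace (2 * S N)%nat with (S (2 * N + 1)) by lia.
    replace (S (2 * N + 1) + 1)%nat with (S (S (2 * N + 1))) by lia. eqR. ring. }
assert (L1 : is_lim_seq (fun N => sum_n a (2 * N + 1)) (Series a)).
{ apply (is_lim_seq_subseq (sum_n a) (Series a) (fun N => (2 * N + 1)%nat)).
  - apply eventually_subseq. intros n. lia.
  - exact (Series_correct a Ha). }
assert (L2 : is_lim_seq (fun N => sum_n a (2 * N + 1))
  (Series (fun k => a (2 * k)%nat) + Series (fun k => a (2 * k + 1)%nat))).
{ apply (is_lim_seq_ext _ _ _ (fun N => eq_sym (E N))).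
  apply is_lim_seq_plus'; [exact (Series_correct _ He)|exact (Series_correct _ Ho)]. }
assert (U := eq_trans (eq_sym (is_lim_seq_unique _ _ L1)) (is_lim_seq_unique _ _ L2)).
injection U as U. exact U.
Qed.

Lemma ex_series_inv_pow (s : nat) : (2 <= s)%nat -> ex_series (fun k => / INR (k + 1) ^ s).
Proof.
(* The constant is [4^2]: since [PI <= 4], one has [odd_half_pi k <= 4 * (k + 1)]. *)
intros Hs. apply ex_series_dominated with (fun k => 16 * / odd_half_pi k ^ 2).
- intros k. assert (W := odd_half_pi_ge_1 k). assert (K := pos_INR k).
  rewrite plus_INR. simpl (INR 1).
  assert (K1 : 1 <= (INR k + 1) ^ s) by (apply pow_R1_Rle; lra).
  rewrite Rabs_pos_eq by (apply Rlt_le, Rinv_0_lt_compat; lra).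
  apply Rle_trans with (/ (INR k + 1) ^ 2).
  + apply Rinv_le_contravar; [nra|]. apply Rle_pow; [lra|exact Hs].
  + assert (B : odd_half_pi k <= 4 * (INR k + 1)).
    { unfold odd_half_pi. assert (P := PI_4). assert (P' := PI2_1). nra. }
    apply (Rmult_le_reg_r (odd_half_pi k ^ 2)); [nra|].
    rewrite Rmult_assoc, Rinv_l, Rmult_1_r by nra.
    apply (Rmult_le_reg_l ((INR k + 1) ^ 2)); [nra|].
    rewrite <- Rmult_assoc, Rinv_r, Rmult_1_l by nra. nra.
- apply (ex_series_scal (V := R_NormedModule) 16). now apply ex_series_odd_half_pi.
Qed.

Lemma ex_series_inv_odd_pow (s : nat) : (2 <= s)%nat -> ex_series (fun k => / INR (2 * k + 1) ^ s).
Proof.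
intros Hs. apply ex_series_dominated with (2 := ex_series_inv_pow s Hs).
intros k. assert (K := pos_INR k).
assert (K1 : 0 < INR (k + 1) ^ s) by (apply pow_lt, lt_0_INR; lia).
assert (K2 : INR (k + 1) ^ s <= INR (2 * k + 1) ^ s).
{ apply pow_incr. split; [apply pos_INR|apply le_INR; lia]. }
rewrite Rabs_pos_eq by (apply Rlt_le, Rinv_0_lt_compat; lra).
now apply Rinv_le_contravar.
Qed.

Lemma zeta_INR (s : nat) : zeta (INR s) = Series (fun k => / INR (k + 1) ^ s).
Proof.
apply Series_ext. intros k. rewrite Rpower_pow; [reflexivity|]. apply lt_0_INR. lia.
Qed.

Lemma dirichlet_beta_INR (s : nat) :
  dirichlet_beta (INR s) = Series (fun k => (-1) ^ k / INR (2 * k + 1) ^ s).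
Proof.
apply Series_ext. intros k. rewrite Rpower_pow; [reflexivity|]. apply lt_0_INR. lia.
Qed.

Lemma Series_inv_odd_pow (s : nat) :
  (2 <= s)%nat -> Series (fun k => / INR (2 * k + 1) ^ s) = (1 - / 2 ^ s) * zeta (INR s).
Proof.
intros Hs. rewrite zeta_INR.
assert (E : forall k, / INR (2 * k + 1 + 1) ^ s = / 2 ^ s * / INR (k + 1) ^ s).
{ intros k. replace (2 * k + 1 + 1)%nat with (2 * (k + 1))%nat by lia.
  rewrite mult_INR, Rpow_mult_distr, Rinv_mult. reflexivity. }
assert (Ho : ex_series (fun k => / INR (2 * k + 1 + 1) ^ s)).
{ apply (ex_series_ext _ _ (fun k => eq_sym (E k))).
  apply (ex_series_scal (V := R_NormedModule) (/ 2 ^ s)). now apply ex_series_inv_pow. }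
assert (X : Series (fun k => / INR (k + 1) ^ s) =
  Series (fun k => / INR (2 * k + 1) ^ s) + Series (fun k => / INR (2 * k + 1 + 1) ^ s))
  by exact (Series_even_odd _ (ex_series_inv_pow s Hs) (ex_series_inv_odd_pow s Hs) Ho).
rewrite (Series_ext _ _ E), Series_scal_l in X. lra.
Qed.

Lemma odd_half_pi_inv_pow (k s : nat) :
  / odd_half_pi k ^ s = (2 / PI) ^ s * / INR (2 * k + 1) ^ s.
Proof.
assert (P := PI_RGT_0).
rewrite <- !pow_inv, <- Rpow_mult_distr. f_equal.
unfold odd_half_pi. rewrite plus_INR, mult_INR. simpl (INR 1). simpl (INR 2).
assert (K := pos_INR k). field. lra.
Qed.

Lemma zeta_pos (s : nat) : (2 <= s)%nat -> 0 < zeta (INR s).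
Proof.
intros Hs. rewrite zeta_INR, Series_incr_1 by now apply ex_series_inv_pow.
simpl INR. rewrite pow1, Rinv_1.
assert (0 <= Series (fun k => / INR (S k + 1) ^ s)); [|simpl in *; lra].
rewrite <- (Rmult_0_l (Series (fun k => / INR (S k + 1) ^ s))), <- Series_scal_l.
apply Series_le.
- intros k. rewrite Rmult_0_l. split; [lra|]. apply Rlt_le, Rinv_0_lt_compat, pow_lt, lt_0_INR. lia.
- apply (ex_series_ext (fun k => / INR (S k + 1) ^ s)); [reflexivity|].
  apply -> (ex_series_incr_1 (fun k => / INR (k + 1) ^ s)). now apply ex_series_inv_pow.
Qed.

(* [1 / (2 j + 1)^s <= 1 / (4 j (j + 1))] for [j >= 1], and the latter series telescopes to 1/4. *)
Lemma dirichlet_beta_pos (s : nat) : (2 <= s)%nat -> 0 < dirichlet_beta (INR s).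
Proof.
intros Hs. rewrite dirichlet_beta_INR.
set (b := fun k => (-1) ^ k / INR (2 * k + 1) ^ s).
assert (L : forall N, 3 / 4 + / (4 * (INR N + 1)) <= sum_n b N).
{ induction N as [|N IH].
  - rewrite sum_O. unfold b. simpl INR. rewrite pow1. simpl. lra.
  - rewrite sum_Sn_R.
    assert (K := pos_INR N).
    assert (B : Rabs (b (S N)) <= / (2 * INR (S N) + 1) ^ 2).
    { unfold b, Rdiv. rewrite Rabs_mult, pow_1_abs, Rmult_1_l.
      assert (E : 2 * INR (S N) + 1 = INR (2 * S N + 1)) by (rewrite plus_INR, mult_INR; reflexivity).
      rewrite E. assert (G : 1 <= INR (2 * S N + 1)) by (rewrite <- E, S_INR; lra).
      assert (G2 : INR (2 * S N + 1) ^ 2 <= INR (2 * S N + 1) ^ s) by (apply Rle_pow; assumption).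
      assert (G3 : 0 < INR (2 * S N + 1) ^ 2) by (apply pow_lt; lra).
      rewrite Rabs_pos_eq by (apply Rlt_le, Rinv_0_lt_compat; lra).
      now apply Rinv_le_contravar. }
    apply Rabs_le_between in B. rewrite S_INR in *.
    assert (T : / (2 * (INR N + 1) + 1) ^ 2 <= / (4 * (INR N + 1) * (INR N + 2))).
    { apply Rinv_le_contravar; nra. }
    replace (/ (4 * (INR N + 1) * (INR N + 2))) with
      (/ (4 * (INR N + 1)) - / (4 * (INR N + 1 + 1))) in T by (field; lra).
    lra. }
assert (Hb : ex_series b).
{ apply ex_series_dominated with (2 := ex_series_inv_odd_pow s Hs). intros k.
  unfold b, Rdiv. rewrite Rabs_mult, pow_1_abs, Rmult_1_l.
  assert (0 < INR (2 * k + 1) ^ s) by (apply pow_lt, lt_0_INR; lia).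
  rewrite Rabs_pos_eq; [lra|]. now apply Rlt_le, Rinv_0_lt_compat. }
apply Rlt_le_trans with (3 / 4); [lra|].
change (Rbar_le (3 / 4) (Series b)).
apply (is_lim_seq_le (fun _ => 3 / 4) (sum_n b)).
- intros N. apply Rle_trans with (2 := L N).
  assert (0 < / (4 * (INR N + 1))); [|lra]. apply Rinv_0_lt_compat. assert (K := pos_INR N). lra.
- apply is_lim_seq_const.
- exact (Series_correct b Hb).
Qed.

(** * Parity, assembly of the two integrals, and signs *)

Lemma sum_n_even (a : nat -> R) (n : nat) :
  a 0%nat = 0 -> (forall p, a (2 * p + 1)%nat = 0) ->
  sum_n a (2 * n) = sum_n_m (fun p => a (2 * p)%nat) 1 n.
Proof.
intros a0 H. induction n as [|n IH].
- rewrite sum_n_m_zero by lia. change (2 * 0)%nat with 0%nat. now rewrite sum_O.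
- rewrite sum_n_Sm by lia. rewrite <- IH.
  replace (2 * S n)%nat with (S (S (2 * n))) by lia. rewrite !sum_Sn_R.
  replace (S (2 * n)) with (2 * n + 1)%nat at 1 by lia. rewrite H. eqR. ring.
Qed.

Lemma sum_n_odd (a : nat -> R) (n : nat) :
  (forall p, a (2 * p)%nat = 0) -> (1 <= n)%nat ->
  sum_n a (2 * n - 1) = sum_n_m (fun p => a (2 * p - 1)%nat) 1 n.
Proof.
intros H Hn. destruct n as [|n]; [lia|]. clear Hn. induction n as [|n IH].
- rewrite sum_n_n. change (2 * 1 - 1)%nat with 1%nat. rewrite sum_Sn_R, sum_O.
  change (a 0%nat) with (a (2 * 0)%nat). rewrite H. eqR. ring.
- rewrite sum_n_Sm by lia. rewrite <- IH.
  replace (2 * S (S n) - 1)%nat with (S (S (2 * S n - 1))) by lia. rewrite !sum_Sn_R.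
  replace (S (2 * S n - 1)) with (2 * S n)%nat at 1 by lia. rewrite H. eqR. ring.
Qed.

Lemma gd_coef_parity (m q d : nat) : (m + q = 2 * d + 1)%nat -> gd_coef m q = 0.
Proof.
intros H. unfold gd_coef. destruct (le_lt_dec m q) as [L|L].
- rewrite artanh_coef_lt by lia. ring.
- replace m with (q + S (2 * (d - q)))%nat by lia. rewrite artanh_coef_odd. ring.
Qed.

Lemma sum_n_m_ext_R (a b : nat -> R) (n m : nat) :
  (forall p, (n <= p <= m)%nat -> a p = b p) -> sum_n_m a n m = sum_n_m b n m.
Proof. apply sum_n_m_ext_loc. Qed.

(** The case [p = 0] is excluded, as [tanh y / y] is not integrable at infinity. *)
Lemma gd_derivative_cos_integral (p : nat) :
  (1 <= p)%nat ->
  half_line_integral (fun y => gd_derivative cos (2 * p) 1 y / y)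
    (INR (fact (2 * p)) * ((-1) ^ p * (PI *
      ((2 / PI) ^ (2 * p + 1) * ((1 - / 2 ^ (2 * p + 1)) * zeta (INR (2 * p + 1))))))).
Proof.
intros Hp.
rewrite <- Series_inv_odd_pow by lia. rewrite <- Series_scal_l.
rewrite (Series_ext _ (fun k => 1 * / odd_half_pi k ^ (2 * p + 1)))
  by (intros k; rewrite odd_half_pi_inv_pow; ring).
apply (half_line_integral_pole (fun _ => 1) (fun i => gd_derivative cos i 1)).
- intros _. rewrite Rabs_R1. lra.
- lia.
- apply derivative_chain_gd_cos.
- intros i. apply gd_derivative_bounded. intros x. apply Rabs_le, COS_bound.
- destruct (tanh_pole_remainder p) as [f [Hf E]]. exists f. split; [exact Hf|].
  intros y. rewrite <- E. simpl. rewrite Rmult_1_l. apply cos_gd_angle.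
Qed.

Lemma gd_derivative_sin_integral (p : nat) :
  half_line_integral (fun y => gd_derivative sin (2 * p + 1) 1 y / y)
    (INR (fact (2 * p + 1)) * (- (-1) ^ p * (PI *
      ((2 / PI) ^ (2 * p + 2) * dirichlet_beta (INR (2 * p + 2)))))).
Proof.
rewrite dirichlet_beta_INR, <- Series_scal_l.
replace (2 * p + 2)%nat with (2 * p + 1 + 1)%nat by lia.
rewrite (Series_ext _ (fun k => (-1) ^ k * / odd_half_pi k ^ (2 * p + 1 + 1)))
  by (intros k; rewrite odd_half_pi_inv_pow; unfold Rdiv; ring).
apply (half_line_integral_pole (pow (-1)) (fun i => gd_derivative sin i 1)).
- apply Rabs_pow_neg1.
- lia.
- apply derivative_chain_gd_sin.
- intros i. apply gd_derivative_bounded. intros x. apply Rabs_le, SIN_bound.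
- destruct (sech_pole_remainder p) as [f [Hf E]]. exists f. split; [exact Hf|].
  intros y. rewrite <- E. simpl. rewrite Rmult_1_l. apply sin_gd_angle.
Qed.

Lemma half_line_integral_scal (f : R -> R) (c L : R) :
  half_line_integral f L -> half_line_integral (fun y => c * f y) (c * L).
Proof.
intros H. apply (half_line_integral_ext (fun y => c * f y + 0 * f y)); [intros; ring|].
replace (c * L) with (c * L + 0 * L) by ring. now apply half_line_integral_lin.
Qed.

Lemma pow_neg1_sub (p n : nat) : (p <= n)%nat -> (-1) ^ p * (-1) ^ n = (-1) ^ (n - p).
Proof.
intros H. replace n with (p + (n - p))%nat at 1 by lia.
rewrite pow_add, <- Rmult_assoc, <- Rpow_mult_distr.
replace (-1 * -1) with 1 by ring. rewrite pow1. ring.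
Qed.

Lemma sin_integral (n : nat) :
  (1 <= n)%nat ->
  is_RInt (fun x : R => sin (4 * INR n * x) / ln (tan x)) 0 (PI / 4)
    ((-1) ^ n / 2 *
     sum_n_m (fun p : nat =>
       (2 ^ (2 * p + 1) - 1) * a_coef p n *
       (zeta (INR (2 * p + 1)) / PI ^ (2 * p))) 1 n).
Proof.
intros Hn. assert (P := PI_RGT_0).
(* The value of the integral for even [q > 0]; at the other [q] it has no meaning and meets the
   coefficient 0. *)
set (L := fun q => INR (fact q) * ((-1) ^ (q / 2) * (PI *
      ((2 / PI) ^ (q + 1) * ((1 - / 2 ^ (q + 1)) * zeta (INR (q + 1))))))).
assert (H0 : gd_coef (2 * n) 0 = 0).
{ unfold gd_coef. replace (2 * n)%nat with (S (2 * n - 1)) by lia.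
  rewrite artanh_coef_0_r. ring. }
assert (H1 : forall p, gd_coef (2 * n) (2 * p + 1) = 0)
  by (intros p; apply gd_coef_parity with (n + p)%nat; lia).
assert (HL := half_line_integral_sum (fun q y => gd_derivative cos q 1 y / y) (gd_coef (2 * n)) L (2 * n)).
assert (HL1 : forall q, gd_coef (2 * n) q = 0 \/ half_line_integral (fun y => gd_derivative cos q 1 y / y) (L q)).
{ intros q. destruct (Nat.Even_or_Odd q) as [[p ->]|[p ->]]; [|left; apply H1].
  destruct p as [|p]; [left; exact H0|]. right. unfold L.
  rewrite (Nat.mul_comm 2 (S p)), Nat.div_mul, (Nat.mul_comm (S p) 2) by lia.
  apply gd_derivative_cos_integral. lia. }
(* With [m = 2 n], [gd_derivative_1_cos] and [gd_derivative_S] equate [m] times the product of sines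
   with [- (m / 2)] times the sum; [m] cancels. *)
apply HL, (half_line_integral_scal _ (- / 2)) in HL1. clear HL.
assert (m0 : 0 < INR (2 * n)) by (apply lt_0_INR; lia).
assert (HS : half_line_integral (fun y => sin (INR (2 * n) * gd_angle y) * sin (gd_angle y) / y)
   (- / 2 * sum_n (fun q => gd_coef (2 * n) q * L q) (2 * n))).
{ apply half_line_integral_ext with (2 := HL1). intros y Hy.
  assert (E := gd_derivative_1_cos (2 * n) y).
  rewrite (gd_derivative_S cos (2 * n) (2 * n) 0 y) in E by lia.
  apply (Rmult_eq_reg_l (INR (2 * n) * y)); [|nra].
  transitivity (INR (2 * n) * (sin (INR (2 * n) * gd_angle y) * sin (gd_angle y))); [|field; lra].
  rewrite <- E.
  replace (sum_n (fun q => gd_coef (2 * n) q * (gd_derivative cos q 1 y / y)) (2 * n)) with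
    (/ y * sum_n (fun q => gd_coef (2 * n) q * gd_derivative cos (0 + q) 1 y) (2 * n)).
  - field. lra.
  - transitivity (/ y * sum_n (fun q => gd_coef (2 * n) q * gd_derivative cos (0 + q) 1 y) (2 * n)
      + 0 * sum_n (fun _ => 0) (2 * n)); [ring|].
    rewrite <- sum_n_lin_R. apply sum_n_ext. intros q. change (0 + q)%nat with q. unfold Rdiv. eqR. ring. }
assert (HI := is_RInt_div_ln_tan sin (2 * n) _
  ltac:(intros x; eexists; apply is_derive_sin)
  ltac:(rewrite mult_INR; simpl (INR 2); rewrite <- (sin_INR_PI n); f_equal; field) HS).
apply (is_RInt_ext (fun x => sin (INR (2 * n) * (2 * x)) / ln (tan x))).
{ intros x _. rewrite mult_INR. simpl (INR 2). eqR. do 2 f_equal. ring. }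
match type of HI with is_RInt _ _ _ ?v => replace v with
  (/ 4 * sum_n (fun q => gd_coef (2 * n) q * L q) (2 * n)) in HI by field end.
rewrite sum_n_even in HI; [|rewrite H0; ring|intros p; rewrite H1; ring].
evar_last; [exact HI|].
transitivity (sum_n_m (fun p => / 4 * (gd_coef (2 * n) (2 * p) * L (2 * p)%nat)) 1 n).
{ symmetry. apply (sum_n_m_mult_l (K := R_AbsRing) (/ 4)). }
transitivity (sum_n_m (fun p => (-1) ^ n / 2 * ((2 ^ (2 * p + 1) - 1) * a_coef p n *
       (zeta (INR (2 * p + 1)) / PI ^ (2 * p)))) 1 n).
2: { apply (sum_n_m_mult_l (K := R_AbsRing) ((-1) ^ n / 2)). }
apply sum_n_m_ext_R. intros p Hp.
rewrite a_coef_artanh by exact Hp. unfold gd_coef, L.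
assert (Ed : ((2 * p) / 2 = p)%nat) by (rewrite Nat.mul_comm; apply Nat.div_mul; lia).
rewrite Ed.
replace ((-2) ^ (2 * p)) with (2 ^ (2 * p)) by (rewrite !pow_mult; f_equal; ring).
(* The sign of [a_coef] splits into [(-1)^p], which comes from the integrals, and [(-1)^n], which
   cancels the outer factor. *)
rewrite <- (pow_neg1_sub p n) by lia.
assert (En : (-1) ^ n * (-1) ^ n = 1).
{ rewrite <- Rpow_mult_distr. replace (-1 * -1) with 1 by ring. apply pow1. }
assert (E2 : 2 ^ (2 * p) = 2 * 2 ^ (2 * p - 1)).
{ replace (2 * p)%nat with (S (2 * p - 1)) at 1 by lia. reflexivity. }
transitivity (((-1) ^ n * (-1) ^ n) * ((-1) ^ p * / 2 * ((2 ^ (2 * p + 1) - 1) * 2 ^ (2 * p - 1) *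
  artanh_coef (2 * n) (2 * p) * (zeta (INR (2 * p + 1)) / PI ^ (2 * p))))); [|unfold Rdiv; ring].
rewrite En, Rmult_1_l.
unfold Rdiv at 2. rewrite Rpow_mult_distr, pow_inv, !(pow_add _ (2 * p) 1), !pow_1, E2.
assert (T : 0 < 2 ^ (2 * p - 1)) by (apply pow_lt; lra).
assert (T2 : 0 < PI ^ (2 * p)) by (apply pow_lt; lra).
assert (F := INR_fact_neq_0 (2 * p)).
field. repeat split; lra.
Qed.

Lemma cos_integral (n : nat) :
  (1 <= n)%nat ->
  is_RInt (fun x : R => cos ((4 * INR n - 2) * x) / ln (tan x)) 0 (PI / 4)
    ((-1) ^ n *
     sum_n_m (fun p : nat =>
       2 ^ (2 * p - 1) * b_coef p n *
       (dirichlet_beta (INR (2 * p)) / PI ^ (2 * p - 1))) 1 n).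
Proof.
intros Hn. assert (P := PI_RGT_0).
set (L := fun q => INR (fact q) * (- (-1) ^ (q / 2) * (PI *
      ((2 / PI) ^ (q + 1) * dirichlet_beta (INR (q + 1)))))).
assert (H1 : forall p, gd_coef (2 * n - 1) (2 * p) = 0)
  by (intros p; apply gd_coef_parity with (n + p - 1)%nat; lia).
assert (HL := half_line_integral_sum (fun q y => gd_derivative sin q 1 y / y) (gd_coef (2 * n - 1)) L (2 * n - 1)).
assert (Ed : forall p, ((2 * p + 1) / 2 = p)%nat).
{ intros p. rewrite Nat.mul_comm, Nat.div_add_l by lia. simpl. lia. }
assert (HL1 : forall q, gd_coef (2 * n - 1) q = 0 \/ half_line_integral (fun y => gd_derivative sin q 1 y / y) (L q)).
{ intros q. destruct (Nat.Even_or_Odd q) as [[p ->]|[p ->]]; [left; apply H1|]. right. unfold L.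
  rewrite Ed. replace (2 * p + 1 + 1)%nat with (2 * p + 2)%nat by lia.
  apply gd_derivative_sin_integral. }
(* The factor is now positive, because differentiating the sine brings the additional sign of
   [gd_derivative_1_sin]. *)
apply HL, (half_line_integral_scal _ (/ 2)) in HL1. clear HL.
assert (m0 : 0 < INR (2 * n - 1)) by (apply lt_0_INR; lia).
assert (Em : INR (2 * n - 1) = 2 * INR n - 1)
  by (rewrite minus_INR, mult_INR by lia; simpl; ring).
assert (HS : half_line_integral (fun y => cos (INR (2 * n - 1) * gd_angle y) * sin (gd_angle y) / y)
   (/ 2 * sum_n (fun q => gd_coef (2 * n - 1) q * L q) (2 * n - 1))).
{ apply half_line_integral_ext with (2 := HL1). intros y Hy.
  assert (E := gd_derivative_1_sin (2 * n - 1) y).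
  rewrite (gd_derivative_S sin (2 * n - 1) (2 * n - 1) 0 y) in E by lia.
  apply (Rmult_eq_reg_l (- INR (2 * n - 1) * y)); [|nra].
  transitivity (- INR (2 * n - 1) * (cos (INR (2 * n - 1) * gd_angle y) * sin (gd_angle y))); [|field; lra].
  rewrite <- E.
  replace (sum_n (fun q => gd_coef (2 * n - 1) q * (gd_derivative sin q 1 y / y)) (2 * n - 1)) with
    (/ y * sum_n (fun q => gd_coef (2 * n - 1) q * gd_derivative sin (0 + q) 1 y) (2 * n - 1)).
  - field. lra.
  - transitivity (/ y * sum_n (fun q => gd_coef (2 * n - 1) q * gd_derivative sin (0 + q) 1 y) (2 * n - 1)
      + 0 * sum_n (fun _ => 0) (2 * n - 1)); [ring|].
    rewrite <- sum_n_lin_R. apply sum_n_ext. intros q. change (0 + q)%nat with q. unfold Rdiv. eqR. ring. }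
(* An odd multiple of [PI / 2]: the numerator vanishes at [x = PI / 4], which makes the singularity
   there removable. *)
assert (Hc : cos (INR (2 * n - 1) * (PI / 2)) = 0).
{ replace (INR (2 * n - 1) * (PI / 2)) with (odd_half_pi (n - 1)); [apply cos_odd_half_pi|].
  unfold odd_half_pi. rewrite Em, minus_INR by lia. simpl (INR 1). ring. }
assert (HI := is_RInt_div_ln_tan cos (2 * n - 1) _
  ltac:(intros x; eexists; apply is_derive_cos) Hc HS).
apply (is_RInt_ext (fun x => cos (INR (2 * n - 1) * (2 * x)) / ln (tan x))).
{ intros x _. rewrite Em. eqR. do 2 f_equal. ring. }
match type of HI with is_RInt _ _ _ ?v => replace v with
  (- / 4 * sum_n (fun q => gd_coef (2 * n - 1) q * L q) (2 * n - 1)) in HI by field end.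
rewrite sum_n_odd in HI; [|intros p; rewrite H1; ring|exact Hn].
evar_last; [exact HI|].
transitivity (sum_n_m (fun p => - / 4 * (gd_coef (2 * n - 1) (2 * p - 1) * L (2 * p - 1)%nat)) 1 n).
{ symmetry. apply (sum_n_m_mult_l (K := R_AbsRing) (- / 4)). }
transitivity (sum_n_m (fun p => (-1) ^ n * (2 ^ (2 * p - 1) * b_coef p n *
       (dirichlet_beta (INR (2 * p)) / PI ^ (2 * p - 1)))) 1 n).
2: { apply (sum_n_m_mult_l (K := R_AbsRing) ((-1) ^ n)). }
apply sum_n_m_ext_R. intros p Hp.
rewrite b_coef_artanh by exact Hp. unfold gd_coef, L.
destruct p as [|p]; [lia|].
rewrite <- (pow_neg1_sub (S p) n) by lia.
replace (2 * S p - 1)%nat with (2 * p + 1)%nat by lia.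
replace (2 * S p - 2)%nat with (2 * p)%nat by lia.
replace (2 * S p)%nat with (2 * p + 1 + 1)%nat by lia.
rewrite Ed.
assert (En : (-1) ^ n * (-1) ^ n = 1).
{ rewrite <- Rpow_mult_distr. replace (-1 * -1) with 1 by ring. apply pow1. }
transitivity (((-1) ^ n * (-1) ^ n) * ((-1) ^ S p * (2 ^ (2 * p + 1) * (2 ^ (2 * p) *
  artanh_coef (2 * n - 1) (2 * p + 1)) * (dirichlet_beta (INR (2 * p + 1 + 1)) / PI ^ (2 * p + 1)))));
  [|unfold Rdiv; ring].
rewrite En, Rmult_1_l.
unfold Rdiv at 2. rewrite Rpow_mult_distr, pow_inv, !(pow_add _ (2 * p + 1) 1), !(pow_add _ (2 * p) 1), !pow_1.
replace ((-2) ^ (2 * p)) with (2 ^ (2 * p)) by (rewrite !pow_mult; f_equal; ring).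
rewrite <- (tech_pow_Rmult (-1) p).
assert (T2 : 0 < PI ^ (2 * p)) by (apply pow_lt; lra).
assert (F := INR_fact_neq_0 (2 * p + 1)).
field. repeat split; lra.
Qed.

Lemma a_coef_sign (p n : nat) : (1 <= p <= n)%nat -> (-1) ^ (n - p) * a_coef p n > 0.
Proof.
intros H. rewrite a_coef_artanh by exact H.
replace (-1) with (- (1)) by ring.
assert (E : (- (1)) ^ (n - p) * (- (1)) ^ (n - p) = 1)
  by (rewrite <- Rpow_mult_distr; replace (- (1) * - (1)) with 1 by ring; apply pow1).
assert (T := artanh_coef_pos (n - p) (2 * p - 1)).
replace (S (2 * p - 1) + 2 * (n - p))%nat with (2 * n)%nat in T by lia.
replace (S (2 * p - 1)) with (2 * p)%nat in T by lia.
rewrite <- !Rmult_assoc, E, Rmult_1_l. apply Rmult_lt_0_compat; [apply pow_lt; lra|exact T].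
Qed.

Lemma b_coef_sign (p n : nat) : (1 <= p <= n)%nat -> (-1) ^ (n - p) * b_coef p n > 0.
Proof.
intros H. rewrite b_coef_artanh by exact H.
assert (E : (-1) ^ (n - p) * (-1) ^ (n - p) = 1)
  by (rewrite <- Rpow_mult_distr; replace (-1 * -1) with 1 by ring; apply pow1).
assert (T := artanh_coef_pos (n - p) (2 * p - 2)).
replace (S (2 * p - 2) + 2 * (n - p))%nat with (2 * n - 1)%nat in T by lia.
replace (S (2 * p - 2)) with (2 * p - 1)%nat in T by lia.
rewrite <- !Rmult_assoc, E, Rmult_1_l. apply Rmult_lt_0_compat; [apply pow_lt; lra|exact T].
Qed.

Theorem proposition2p3 (n : nat) (hn : (1 <= n)%nat) :
  is_RInt (fun x : R => sin (4 * INR n * x) / ln (tan x)) 0 (PI / 4)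
    ((-1) ^ n / 2 *
     sum_n_m (fun p : nat =>
       (2 ^ (2 * p + 1) - 1) * a_coef p n *
       (zeta (INR (2 * p + 1)) / PI ^ (2 * p))) 1 n)
  /\
  is_RInt (fun x : R => cos ((4 * INR n - 2) * x) / ln (tan x)) 0 (PI / 4)
    ((-1) ^ n *
     sum_n_m (fun p : nat =>
       2 ^ (2 * p - 1) * b_coef p n *
       (dirichlet_beta (INR (2 * p)) / PI ^ (2 * p - 1))) 1 n)
  /\
  (forall p : nat, (1 <= p <= n)%nat ->
     (-1) ^ (n - p) * a_coef p n > 0 /\ (-1) ^ (n - p) * b_coef p n > 0)
  /\
  (forall p : nat, (1 <= p <= n)%nat ->
     (-1) ^ p *
       ((-1) ^ n *
        ((2 ^ (2 * p + 1) - 1) * a_coef p n *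
         (zeta (INR (2 * p + 1)) / PI ^ (2 * p)))) > 0 /\
     (-1) ^ p *
       ((-1) ^ n *
        (2 ^ (2 * p - 1) * b_coef p n *
         (dirichlet_beta (INR (2 * p)) / PI ^ (2 * p - 1)))) > 0).
Proof.
assert (Pi := PI_RGT_0).
split; [now apply sin_integral|]. split; [now apply cos_integral|]. split.
- intros p Hp. split; [now apply a_coef_sign|now apply b_coef_sign].
(* As [(-1)^p * (-1)^n = (-1)^(n - p)], the sign is that of the signed coefficient; the remaining
   factors are positive. *)
- intros p Hp. split.
  + replace ((-1) ^ p * ((-1) ^ n * ((2 ^ (2 * p + 1) - 1) * a_coef p n *
         (zeta (INR (2 * p + 1)) / PI ^ (2 * p))))) with
      (((-1) ^ p * (-1) ^ n * a_coef p n) * ((2 ^ (2 * p + 1) - 1) *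
         (zeta (INR (2 * p + 1)) / PI ^ (2 * p)))) by ring.
    rewrite pow_neg1_sub by lia.
    apply Rmult_lt_0_compat; [now apply a_coef_sign|].
    apply Rmult_lt_0_compat.
    * assert (1 < 2 ^ (2 * p + 1)); [|lra]. apply Rlt_pow_R1; [lra|lia].
    * apply Rdiv_lt_0_compat; [apply zeta_pos; lia|now apply pow_lt].
  + replace ((-1) ^ p * ((-1) ^ n * (2 ^ (2 * p - 1) * b_coef p n *
         (dirichlet_beta (INR (2 * p)) / PI ^ (2 * p - 1))))) with
      (((-1) ^ p * (-1) ^ n * b_coef p n) * (2 ^ (2 * p - 1) *
         (dirichlet_beta (INR (2 * p)) / PI ^ (2 * p - 1)))) by ring.
    rewrite pow_neg1_sub by lia.
    apply Rmult_lt_0_compat; [now apply b_coef_sign|].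
    apply Rmult_lt_0_compat; [apply pow_lt; lra|].
    apply Rdiv_lt_0_compat; [apply dirichlet_beta_pos; lia|now apply pow_lt].
Qed.
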